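(* Let $\alpha>0$, $\beta>0$, $\delta\in[0,1)$, $M\ge1$. Let $V$ be a non-negative $M\times M$ Hermitian matrix-valued function (on $(0,2\pi/\alpha)$, respectively on $(0,2\pi)$) such that $\operatorname{Tr}V^{3/2}\in L_1$. Then the operators with periodic boundary conditions $$H_1(\beta)=-\frac{d^2}{dx^2}+\alpha^2\beta-V(x)\ \text{ on } L_2(0,2\pi/\alpha)^M,\qquad H_2(\delta)=-\frac{d^2}{dx^2}-\delta-\mathrm{P}(V(x)\mathrm{P}\,\cdot)\ \text{ on }\dot L_2(0,2\pi)^M$$ have discrete spectrum, and their negative eigenvalues $\{-\lambda_j\}$ (of $H_1(\beta)$) and $\{-\mu_j\}$ (of $H_2(\delta)$) satisfy respectively $$\sum_j\lambda_j\le\frac{2}{3\sqrt3}K_1(\beta)\int_0^{2\pi/\alpha}\operatorname{Tr}[V(x)^{3/2}]\,dx,\qquad \sum_j\mu_j\le\frac{2}{3\sqrt3}K_2(\delta)\int_0^{2\pi}\operatorname{Tr}[V(x)^{3/2}]\,dx.$$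
   Context: $\dot L_2(0,2\pi)=\{f\in L_2(0,2\pi):\int_0^{2\pi}f\,dx=0\}$, and $(\mathrm{P}\psi)(x)=\psi(x)-\frac1{2\pi}\int_0^{2\pi}\psi(t)\,dt$ acts component-wise on $\mathbb{C}^M$-valued functions. The operators are defined via their quadratic forms on periodic $H^1$ functions; eigenvalues are counted with multiplicity. $K_1(\beta)$, $\beta>0$, is the smallest constant such that $$\|u\|_\infty^2\le K_1(\beta)\Bigl(\int_0^{2\pi/\alpha}(u'(x)^2+\alpha^2\beta u(x)^2)dx\Bigr)^{1/2}\Bigl(\int_0^{2\pi/\alpha}u(x)^2dx\Bigr)^{1/2}$$ for all real $2\pi/\alpha$-periodic $u\in H^1$ (it does not depend on $\alpha$; $K_1(\beta)=\sup_{\lambda>0}\sqrt{\lambda}\,\frac{\coth(\pi\sqrt{\beta+\lambda})}{\sqrt{\beta+\lambda}}$). $K_2(\delta)$, $0\le\delta<1$, is the smallest constant such that $$\|u\|_\infty^2\le K_2(\delta)\Bigl(\int_0^{2\pi}(u'(x)^2-\delta u(x)^2)dx\Bigr)^{1/2}\Bigl(\int_0^{2\pi}u(x)^2dx\Bigr)^{1/2}$$ for all real $2\pi$-periodic $u\in H^1$ with $\int_0^{2\pi}u\,dx=0$ (equivalently $K_2(\delta)=\sup_{\lambda>0}\frac{\sqrt\lambda}{\pi}\sum_{k\in\mathbb{Z}\setminus\{0\}}\frac1{k^2-\delta+\lambda}$). *)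

(* Defs.v *)
From HB Require Import structures.
From mathcomp Require Import all_boot all_order all_algebra.
From mathcomp Require Import all_classical all_reals all_analysis.
From mathcomp Require Import complex.

Set Implicit Arguments.
Unset Strict Implicit.
Unset Printing Implicit Defensive.

Import Order.TTheory GRing.Theory Num.Theory.
Import numFieldNormedType.Exports.

Local Open Scope classical_set_scope.
Local Open Scope ring_scope.
Local Open Scope complex_scope.
Local Open Scope sesquilinear_scope.

(* Functions on an interval (0, L) are represented by total functions on R;
   their values outside [0, L] play no role. *)

Definition int0 (R : realType) (L : R) (f : R -> R) : R :=
  \int[@lebesgue_measure R]_(x in `]0, L[) f x.

Definition sq_integrable (R : realType) (L : R) (f : R -> R) : Prop :=
  measurable_fun `]0, L[ f /\
  (@lebesgue_measure R).-integrable `]0, L[ (EFin \o (fun x => f x ^+ 2)).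

(* On an interval the functions of H^1 are the indefinite integrals of
   square-integrable functions; u below is the continuous representative. *)
Definition is_wderiv (R : realType) (L : R) (u du : R -> R) : Prop :=
  sq_integrable L du /\
  forall x, x \in `[0, L] -> u x = u 0 + int0 x du.

(* The weak derivative, unique up to a null set. *)
Definition wderiv (R : realType) (L : R) (u : R -> R) : R -> R :=
  xget (fun=> 0) [set du | is_wderiv L u du].

Definition H1per (R : realType) (L : R) (u : R -> R) : Prop :=
  (exists du, is_wderiv L u du) /\ u L = u 0.

Definition sup_norm (R : realType) (L : R) (u : R -> R) : R :=
  sup [set `|u x| | x in `[0, L]].

(* K1 does not depend on alpha, but its defining inequality does. *)
Definition K1 (R : realType) (alpha beta : R) : R :=
  let L := 2 * pi / alpha in
  inf [set K : R | forall u : R -> R, H1per L u ->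
    sup_norm L u ^+ 2 <=
      K * Num.sqrt (int0 L (fun x =>
            wderiv L u x ^+ 2 + alpha ^+ 2 * beta * u x ^+ 2))
        * Num.sqrt (int0 L (fun x => u x ^+ 2))].

Definition K2 (R : realType) (delta : R) : R :=
  let L := 2 * pi in
  inf [set K : R | forall u : R -> R, H1per L u -> int0 L u = 0 ->
    sup_norm L u ^+ 2 <=
      K * Num.sqrt (int0 L (fun x => wderiv L u x ^+ 2 - delta * u x ^+ 2))
        * Num.sqrt (int0 L (fun x => u x ^+ 2))].

Definition cint0 (R : realType) (L : R) (f : R -> R[i]) : R[i] :=
  int0 L (fun x => complex.Re (f x)) +i* int0 L (fun x => complex.Im (f x)).

Definition vfun (R : realType) (M : nat) := R -> 'cV[R[i]]_M.

Definition re_part (R : realType) (M : nat) (f : vfun R M) (i : 'I_M) : R -> R :=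
  fun x => complex.Re (f x i 0).
Definition im_part (R : realType) (M : nat) (f : vfun R M) (i : 'I_M) : R -> R :=
  fun x => complex.Im (f x i 0).

Definition vL2 (R : realType) (M : nat) (L : R) : set (vfun R M) :=
  [set f | forall i, sq_integrable L (re_part f i) /\
                     sq_integrable L (im_part f i)].

Definition vL2dot (R : realType) (M : nat) (L : R) : set (vfun R M) :=
  [set f | vL2 L f /\ forall i, cint0 L (fun x => f x i 0) = 0].

Definition vH1per (R : realType) (M : nat) (L : R) : set (vfun R M) :=
  [set u | forall i, H1per L (re_part u i) /\ H1per L (im_part u i)].

Definition vH1perdot (R : realType) (M : nat) (L : R) : set (vfun R M) :=
  [set u | vH1per L u /\ forall i, cint0 L (fun x => u x i 0) = 0].

Definition vwderiv (R : realType) (M : nat) (L : R) (u : vfun R M) : vfun R M :=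
  fun x => \col_i (wderiv L (re_part u i) x +i* wderiv L (im_part u i) x).

(* Linear in the first argument. *)
Definition vip (R : realType) (M : nat) (L : R) (f g : vfun R M) : R[i] :=
  cint0 L (fun x => \sum_i f x i 0 * Num.conj (g x i 0)).

Definition Pmean (R : realType) (M : nat) (f : vfun R M) : vfun R M :=
  fun x => f x - \col_i (((2 * pi)^-1)%:C * cint0 (2 * pi) (fun t => f t i 0)).

Definition mulpot (R : realType) (M : nat) (V : R -> 'M[R[i]]_M)
    (u : vfun R M) : vfun R M :=
  fun x => V x *m u x.

(* The real power of a non-negative Hermitian matrix, by diagonalisation in an
   orthonormal basis of eigenvectors. *)
Definition herm_pow (R : realType) (M : nat) (A : 'M[R[i]]_M) (p : R) :
    'M[R[i]]_M :=
  invmx (spectralmx A)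
  *m diag_mx (map_mx (fun z => (complex.Re z `^ p)%:C) (spectral_diag A))
  *m spectralmx A.

(* Tr V(x)^(3/2); the trace is a real number. *)
Definition tr_pow32 (R : realType) (M : nat) (V : R -> 'M[R[i]]_M) (x : R) : R :=
  complex.Re (\tr (herm_pow (V x) (3 / 2))).

Definition potential (R : realType) (M : nat) (L : R)
    (V : R -> 'M[R[i]]_M) : Prop :=
  [/\ forall i j, measurable_fun `]0, L[ (fun x => complex.Re (V x i j)) /\
                  measurable_fun `]0, L[ (fun x => complex.Im (V x i j)),
      forall x, x \in `]0, L[ -> V x \is hermsymmx,
      forall x, x \in `]0, L[ ->
        forall v : 'cV[R[i]]_M, 0 <= (v ^t* *m V x *m v) 0 0
    & (@lebesgue_measure R).-integrable `]0, L[ (EFin \o tr_pow32 V)].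

(* Operators in a Hilbert space.  The Hilbert space is the set H of vectors of E
   taken modulo the null vectors of the semi-definite inner product ip, and an
   operator is the relation [T u f], read "u is in the domain and T u = f". *)

Definition hnorm (R : realType) (E : lmodType R[i]) (ip : E -> E -> R[i])
    (u : E) : R :=
  Num.sqrt (complex.Re (ip u u)).

(* The operator given by the first representation theorem for the form h with
   form domain Q. *)
Definition form_operator (R : realType) (E : lmodType R[i]) (H : set E)
    (ip : E -> E -> R[i]) (Q : set E) (h : E -> E -> R[i]) : E -> E -> Prop :=
  fun u f => [/\ Q u, H f & forall v, Q v -> h u v = ip f v].

Definition resolvent_set (R : realType) (E : lmodType R[i]) (H : set E)
    (ip : E -> E -> R[i]) (T : E -> E -> Prop) : set R[i] :=
  [set z | [/\ forall f, H f -> exists u, T u (z *: u + f),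
               forall u, T u (z *: u) -> hnorm ip u = 0
             & exists c : R, forall u f, H f -> T u (z *: u + f) ->
                 hnorm ip u <= c * hnorm ip f]].

Definition spectrum (R : realType) (E : lmodType R[i]) (H : set E)
    (ip : E -> E -> R[i]) (T : E -> E -> Prop) : set R[i] :=
  ~` resolvent_set H ip T.

Definition is_eigenvalue (R : realType) (E : lmodType R[i])
    (ip : E -> E -> R[i]) (T : E -> E -> Prop) (z : R[i]) : Prop :=
  exists u, T u (z *: u) /\ hnorm ip u != 0.

Definition lin_indep (R : realType) (E : lmodType R[i]) (ip : E -> E -> R[i])
    (n : nat) (us : 'I_n -> E) : Prop :=
  forall c : 'I_n -> R[i],
    hnorm ip (\sum_i c i *: us i) = 0 -> forall i, c i = 0.

(* The dimension of the eigenspace, possibly infinite. *)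
Definition multiplicity (R : realType) (E : lmodType R[i])
    (ip : E -> E -> R[i]) (T : E -> E -> Prop) (z : R[i]) : \bar R :=
  ereal_sup [set n%:R%:E | n in [set n : nat | exists us : 'I_n -> E,
    (forall i, T (us i) (z *: us i)) /\ lin_indep ip us]].

Definition discrete_spectrum (R : realType) (E : lmodType R[i]) (H : set E)
    (ip : E -> E -> R[i]) (T : E -> E -> Prop) : Prop :=
  forall z, spectrum H ip T z ->
    [/\ is_eigenvalue ip T z,
        (multiplicity ip T z < +oo)%E
      & exists2 e : R, 0 < e &
          forall w, spectrum H ip T w -> w != z -> e%:C <= `|w - z|].

(* The sum of l over the negative eigenvalues - l, with multiplicity. *)
Definition neg_eigenvalue_sum (R : realType) (E : lmodType R[i])
    (ip : E -> E -> R[i]) (T : E -> E -> Prop) : \bar R :=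
  \esum_(l in [set l : R | 0 < l /\ is_eigenvalue ip T (- l)%:C])
    (l%:E * multiplicity ip T (- l)%:C)%E.

Definition form1 (R : realType) (M : nat) (alpha beta : R)
    (V : R -> 'M[R[i]]_M) (u v : vfun R M) : R[i] :=
  let L := 2 * pi / alpha in
  vip L (vwderiv L u) (vwderiv L v) + (alpha ^+ 2 * beta)%:C * vip L u v
  - vip L (mulpot V u) v.

Definition H1op (R : realType) (M : nat) (alpha beta : R)
    (V : R -> 'M[R[i]]_M) : vfun R M -> vfun R M -> Prop :=
  let L := 2 * pi / alpha in
  form_operator (vL2 L) (vip L) (vH1per L) (form1 alpha beta V).

Definition form2 (R : realType) (M : nat) (delta : R)
    (V : R -> 'M[R[i]]_M) (u v : vfun R M) : R[i] :=
  let L := 2 * pi in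
  vip L (vwderiv L u) (vwderiv L v) - delta%:C * vip L u v
  - vip L (Pmean (mulpot V (Pmean u))) v.

Definition H2op (R : realType) (M : nat) (delta : R)
    (V : R -> 'M[R[i]]_M) : vfun R M -> vfun R M -> Prop :=
  let L := 2 * pi in
  form_operator (vL2dot L) (vip L) (vH1perdot L) (form2 delta V).

(* Main.v *)
(* Both operators come from a form <u', v'> + kappa <u, v> - <V u, v> on periodic
   H^1 functions, of mean zero for H_2.

   Discreteness: after adding a large multiple of <u, v> the form becomes a
   complete inner product, in which the L_2 norm is small up to finitely many
   point evaluations (Poincare's inequality on the cells of a fine partition).
   Penalising these evaluations makes the resolvent equation solvable by Riesz'
   theorem and a Neumann series; removing the penalty costs a finite matrix,
   which is singular only at an eigenvalue.

   The bound: let u_j be finitely many orthonormal eigenfunctions, K the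
   Sobolev constant, and V(x) = P^* diag(d_l) P at a fixed x.  The l-th component
   of w_l = P sum_j conj((P u_j(x))_l) u_j takes at x the value
   rho_l = sum_j |(P u_j(x))_l|^2, and |w_l|_2^2 = rho_l.  The Sobolev inequality
   for this component gives rho_l^3 <= K^2 E(w_l), where E is the form without
   potential, so that by Young's inequality
     d_l rho_l <= 2 / (3 sqrt 3) K d_l^(3/2) + E(w_l).
   Summed over l and integrated over x, the left side becomes
   sum_j <V u_j, u_j>, and by orthonormality E(w_l) becomes sum_j E(u_j). *)

(* For each precision the finite family of functionals serves three purposes: it makes the penalised
   problem contract, it keeps the correction a finite matrix, and it bounds the number of
   eigenvalues below a level. Point evaluations can play this role because elements of the form
   domain are genuine functions, determined at every point of [0, L] by their value at 0 and their
   derivative. Both operators are treated at once, with kappa = alpha^2 beta or - delta and a flag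
   for mean zero. What differs is why the form without potential controls the H^1 norm, which makes
   the Sobolev constant finite and E non-negative. For H_1 it is kappa > 0; for H_2 it is
   Wirtinger's inequality with a constant strictly between delta and 1, so that a Riccati argument
   with room to spare replaces Fourier series. In the bound, the eigenbasis of V(x) is chosen
   separately at each x, without any measurability in x. The inequality is therefore proved at a
   fixed x and summed over l first; only basis-free quantities, traces and inner products, are
   integrated. *)
Require Import Defs.
From HB Require Import structures.
From mathcomp Require Import all_boot all_order all_algebra.
From mathcomp Require Import all_classical all_reals all_analysis.
From mathcomp Require Import measurable_realfun complex.
From mathcomp Require finmap.
From mathcomp Require Import ring lra.

Set Implicit Arguments.
Unset Strict Implicit.
Unset Printing Implicit Defensive.

Import Order.TTheory GRing.Theory Num.Theory.
Import numFieldNormedType.Exports.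

Local Open Scope classical_set_scope.
Local Open Scope ring_scope.
Local Open Scope complex_scope.

(** * Integrals over an interval *)

Section IntervalIntegral.
Variable R : realType.
Implicit Types (L x y c : R) (f g : R -> R).
Notation mu := (@lebesgue_measure R).

Lemma lebesgue_measure_oo L :
  lebesgue_measure (`]0, L[%classic : set R) = if 0 < L then L%:E else 0%E.
Proof. by rewrite [LHS]lebesgue_measure_itv/= lte_fin; case: ifP => // _; rewrite oppr0 adde0. Qed.

Definition itg L f : Prop := mu.-integrable `]0, L[ (EFin \o f).

Lemma itg_measurable L f : itg L f -> measurable_fun `]0, L[ f.
Proof. by move=> /measurable_int/measurable_EFinP. Qed.

Lemma eq_itg L f g : {in `]0, L[, f =1 g} -> itg L f -> itg L g.
Proof.
move=> fg; apply: eq_integrable => // x; rewrite inE/= => xI.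
by rewrite fg.
Qed.

Lemma eq_int0 L f g : {in `]0, L[, f =1 g} -> int0 L f = int0 L g.
Proof. by move=> fg; apply: eq_Rintegral => x; rewrite inE => xI; exact: fg. Qed.

Lemma itgD L f g : itg L f -> itg L g -> itg L (fun x => f x + g x).
Proof. by move=> If Ig; apply: eq_integrable (integrableD _ If Ig). Qed.

Lemma itgZ L c f : itg L f -> itg L (fun x => c * f x).
Proof. by move=> If; apply: eq_integrable (integrableZl _ c If). Qed.

Lemma itgN L f : itg L f -> itg L (fun x => - f x).
Proof. by move=> If; apply: eq_integrable (integrableN If). Qed.

Lemma itgB L f g : itg L f -> itg L g -> itg L (fun x => f x - g x).
Proof. by move=> If Ig; apply: itgD => //; exact: itgN. Qed.

Lemma itg_cst L c : itg L (fun=> c).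
Proof.
apply: measurable_bounded_integrable => //.
  apply: (@le_lt_trans _ _ (if 0 < L then L%:E else 0%E)).
    by rewrite -lebesgue_measure_oo; exact: lexx.
  by case: ifP => // _; rewrite /= ltry.
exists `|c|; split; first exact: num_real.
by move=> z cz x _ /=; exact: ltW.
Qed.

Lemma itg0 L : itg L (fun=> 0). Proof. exact: itg_cst. Qed.

Lemma itg_le L f g : measurable_fun `]0, L[ f -> itg L g ->
  (forall x, x \in `]0, L[ -> `|f x| <= g x) -> itg L f.
Proof.
move=> mf Ig fg; apply: le_integrable Ig => //; first exact/measurable_EFinP.
move=> x /= xI; rewrite lee_fin; apply: le_trans (fg x _) (ler_norm _).
exact: xI.
Qed.

Lemma itg_norm L f : itg L f -> itg L (fun x => `|f x|).
Proof. by move=> If; exact: integrable_norm. Qed.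

Lemma itgS L x f : x <= L -> itg L f -> itg x f.
Proof.
move=> xL; apply: integrableS => //.
by apply: subset_itvl; rewrite bnd_simp.
Qed.

Lemma int0D L f g : itg L f -> itg L g ->
  int0 L (fun x => f x + g x) = int0 L f + int0 L g.
Proof. by move=> If Ig; exact: RintegralD. Qed.

Lemma int0B L f g : itg L f -> itg L g ->
  int0 L (fun x => f x - g x) = int0 L f - int0 L g.
Proof. by move=> If Ig; exact: RintegralB. Qed.

Lemma int0Z L c f : itg L f -> int0 L (fun x => c * f x) = c * int0 L f.
Proof. by move=> If; exact: RintegralZl. Qed.

Lemma int0N L f : itg L f -> int0 L (fun x => - f x) = - int0 L f.
Proof.
move=> If; rewrite -mulN1r -int0Z//; apply: eq_int0 => x _.
by rewrite mulN1r.
Qed.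

Lemma int0_cst L c : 0 <= L -> int0 L (fun=> c) = c * L.
Proof.
move=> L0; rewrite /int0 Rintegral_cst//; congr (c * _).
transitivity (fine (if 0 < L then L%:E else 0%E)).
  by congr fine; exact: lebesgue_measure_oo.
by case: ltP => //= H; have -> : L = 0 by lra.
Qed.

Lemma int00 L : int0 L (fun=> 0) = 0.
Proof. by rewrite /int0 Rintegral_cst// mul0r. Qed.

Lemma int0_itv0 f : int0 0 f = 0.
Proof. by rewrite /int0 set_itv_ge ?bnd_simp// Rintegral_set0. Qed.

Lemma itg_bigsum L I (s : seq I) (F : I -> R -> R) : (forall j, itg L (F j)) ->
  itg L (fun x => \sum_(j <- s) F j x).
Proof.
move=> IF; elim: s => [|j s IH].
  by apply: eq_itg (itg0 L) => x _; rewrite big_nil.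
by apply: eq_itg (itgD (IF j) IH) => x _; rewrite big_cons.
Qed.

Lemma int0_bigsum L I (s : seq I) (F : I -> R -> R) : (forall j, itg L (F j)) ->
  int0 L (fun x => \sum_(j <- s) F j x) = \sum_(j <- s) int0 L (F j).
Proof.
move=> IF; elim: s => [|j s IH].
  by rewrite big_nil -[RHS](int00 L); apply: eq_int0 => x _; rewrite big_nil.
rewrite big_cons -IH -int0D//; last exact: itg_bigsum.
by apply: eq_int0 => x _; rewrite big_cons.
Qed.

Lemma int0_ge0 L f : (forall x, x \in `]0, L[ -> 0 <= f x) -> 0 <= int0 L f.
Proof. by move=> f0; apply: Rintegral_ge0 => x; exact: f0. Qed.

Lemma le_int0 L f g : itg L f -> itg L g ->
  (forall x, x \in `]0, L[ -> f x <= g x) -> int0 L f <= int0 L g.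
Proof. by move=> If Ig fg; apply: le_Rintegral => // x; exact: fg. Qed.

Lemma ae_int0 L f g : measurable_fun `]0, L[ f -> measurable_fun `]0, L[ g ->
  ae_eq mu (`]0, L[%classic) f g -> int0 L f = int0 L g.
Proof.
move=> mf mg fg; congr fine; apply: ae_eq_integral => //.
- exact/measurable_EFinP.
- exact/measurable_EFinP.
- exact: ae_eq_comp fg.
Qed.

(** The integral from [x] to [y], encoded as a difference of integrals from 0 so that additivity
    over adjacent intervals is plain algebra. [J_itv] is the link with an integral over an interval;
    it needs [0 < x] because []0, x[] is split off. *)
Definition J f x y := int0 y f - int0 x f.

Lemma J_itv L f x y : itg L f -> 0 < x -> x <= y -> y <= L ->
  J f x y = \int[mu]_(t in `[x, y[) f t.
Proof.
move=> If x0 xy yL; rewrite /J /int0.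
rewrite (@itv_bndbnd_setU _ _ _ (BLeft x)) ?bnd_simp//.
rewrite Rintegral_setU//=.
- by rewrite addrC addKr.
- rewrite -itv_bndbnd_setU ?bnd_simp//; exact: itgS If.
- rewrite disj_set2E; apply/eqP; rewrite -subset0 => t /= [].
  by rewrite !in_itv/= => /andP[_ tx] /andP[xt _]; lra.
Qed.

Lemma J_ge0 L f x y : itg L f -> 0 <= x -> x <= y -> y <= L ->
  (forall t, 0 < t -> x <= t < y -> 0 <= f t) -> 0 <= J f x y.
Proof.
move=> If; rewrite le_eqVlt => /orP[/eqP<-|x0] xy yL f0.
  rewrite /J int0_itv0 subr0; apply: int0_ge0 => t.
  by rewrite in_itv/= => /andP[t0 ty]; apply: f0 => //; rewrite ltW.
rewrite (J_itv If)//; apply: Rintegral_ge0 => t /=.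
rewrite in_itv/= => txy; apply: f0 => //.
by case/andP: txy => xt _; lra.
Qed.

Lemma J_lin L a b f g x y : itg L f -> itg L g -> 0 <= x -> x <= y -> y <= L ->
  J (fun t => a * f t + b * g t) x y = a * J f x y + b * J g x y.
Proof.
move=> If Ig x0 xy yL.
have [Ify Igy] : itg y f /\ itg y g by split; [exact: itgS If|exact: itgS Ig].
have [Ifx Igx] : itg x f /\ itg x g by split; [exact: itgS Ify|exact: itgS Igy].
rewrite /J !int0D ?int0Z//; try exact: itgZ.
ring.
Qed.

Lemma JD L f g x y : itg L f -> itg L g -> 0 <= x -> x <= y -> y <= L ->
  J (fun t => f t + g t) x y = J f x y + J g x y.
Proof.
move=> If Ig x0 xy yL; rewrite -[J f x y]mul1r -[J g x y]mul1r.
rewrite -(J_lin _ _ If Ig)//; congr J; apply/funext => t; ring.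
Qed.

Lemma JB L f g x y : itg L f -> itg L g -> 0 <= x -> x <= y -> y <= L ->
  J (fun t => f t - g t) x y = J f x y - J g x y.
Proof.
move=> If Ig x0 xy yL; rewrite -[J f x y]mul1r -[_ - _]addrC -mulN1r addrC.
rewrite -(J_lin _ _ If Ig)//; congr J; apply/funext => t; ring.
Qed.

Lemma JZ L a f x y : itg L f -> 0 <= x -> x <= y -> y <= L ->
  J (fun t => a * f t) x y = a * J f x y.
Proof.
move=> If x0 xy yL.
have <- : a * J f x y + 0 * J f x y = a * J f x y by ring.
rewrite -(J_lin _ _ If If)//; congr J; apply/funext => t; ring.
Qed.

Lemma J_cst c x y : 0 <= x -> x <= y -> J (fun=> c) x y = c * (y - x).
Proof.
by move=> x0 xy; rewrite /J !int0_cst//; [ring|exact: le_trans xy].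
Qed.

Lemma le_J L f g x y : itg L f -> itg L g -> 0 <= x -> x <= y -> y <= L ->
  (forall t, 0 < t -> x <= t < y -> f t <= g t) -> J f x y <= J g x y.
Proof.
move=> If Ig x0 xy yL fg; rewrite -subr_ge0 -(JB Ig If)//.
apply: (J_ge0 (itgB Ig If)) => // t t0 txy.
by rewrite subr_ge0; exact: fg.
Qed.

Lemma ler_norm_J L f x y : itg L f -> 0 <= x -> x <= y -> y <= L ->
  `|J f x y| <= J (fun t => `|f t|) x y.
Proof.
move=> If x0 xy yL; have In := itg_norm If.
rewrite ler_norml; apply/andP; split; last first.
  by apply: (le_J If In) => // t _ _; exact: ler_norm.
rewrite -mulN1r -(JZ _ In)//; apply: (le_J (itgZ _ In) If) => // t _ _.
by rewrite mulN1r lerNl -normrN ler_norm.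
Qed.

Lemma J_cat f x y z : J f x y + J f y z = J f x z.
Proof. by rewrite /J; ring. Qed.

(** No sign of [a] is assumed: the hypothesis excludes [a < 0] and forces [b = 0] when [a = 0]. This
    serves both Cauchy-Schwarz inequalities, and with [c = 0] it turns minimality into a vanishing
    first variation in [riesz]. *)
Lemma discriminant_le (a b c : R) : (forall t, 0 <= a * t ^+ 2 + 2 * b * t + c) ->
  b ^+ 2 <= a * c.
Proof.
move=> H; have c0 : 0 <= c by have := H 0; rewrite expr0n/= !mulr0 !add0r.
have [a0|a0|a0] := ltgtP a 0.
(* [t] is chosen with [a * t = a - c]. As [t >= 1], this gives [a * t ^+ 2 <= a - c < - c], against
   the sum of the hypothesis at [t] and at [- t]. *)
- pose t := c / - a + 1; have t1 : 1 <= t by rewrite lerDr divr_ge0//; lra.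
  have ta : a * t = a - c by rewrite /t; field; lra.
  have : a * t ^+ 2 <= a * t by rewrite ler_nM2l// expr2 ler_peMl//; lra.
  have := H t; have := H (- t); rewrite sqrrN ta; lra.
- have := H (- b / a).
  have -> : a * (- b / a) ^+ 2 + 2 * b * (- b / a) + c = (a * c - b ^+ 2) / a by field; lra.
  by rewrite pmulr_lge0 ?invr_gt0// subr_ge0.
- have [->|b0] := eqVneq b 0; first by rewrite a0 mul0r expr0n.
  have := H (- (c + 1) / (2 * b)); rewrite a0 mul0r add0r.
  have -> : 2 * b * (- (c + 1) / (2 * b)) + c = -1 by field.
  by rewrite oppr_ge0 ler10.
Qed.

Lemma JCS L f g x y : itg L (fun t => f t ^+ 2) -> itg L (fun t => g t ^+ 2) ->
  itg L (fun t => f t * g t) -> 0 <= x -> x <= y -> y <= L ->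
  (J (fun t => f t * g t) x y) ^+ 2 <=
  J (fun t => f t ^+ 2) x y * J (fun t => g t ^+ 2) x y.
Proof.
move=> If Ig Ifg x0 xy yL; apply: discriminant_le => s.
have I1 : itg L (fun t => s ^+ 2 * f t ^+ 2) by exact: itgZ.
have I2 : itg L (fun t => 2 * s * (f t * g t)) by exact: itgZ.
have -> : J (fun t => f t ^+ 2) x y * s ^+ 2 + 2 * J (fun t => f t * g t) x y * s
    + J (fun t => g t ^+ 2) x y = J (fun t => (s * f t + g t) ^+ 2) x y.
  transitivity (J (fun t => s ^+ 2 * f t ^+ 2 + 2 * s * (f t * g t) + g t ^+ 2) x y).
    rewrite (JD (itgD I1 I2) Ig)// (JD I1 I2)// (JZ _ If)// (JZ _ Ifg)//; ring.
  by congr J; apply/funext => t; ring.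
apply: (@J_ge0 L) => //; last by move=> t _ _; exact: sqr_ge0.
apply: eq_itg (itgD (itgD I1 I2) Ig) => t _; ring.
Qed.

Local Notation sqi := (@sq_integrable R).

Lemma sqi_measurable L f : sqi L f -> measurable_fun `]0, L[ f.
Proof. by case. Qed.

Lemma sqi_itg2 L f : sqi L f -> itg L (fun t => f t ^+ 2).
Proof. by case. Qed.

Lemma sqi_itgM L f g : sqi L f -> sqi L g -> itg L (fun t => f t * g t).
Proof.
move=> [mf If] [mg Ig]; apply: (itg_le _ (itgD If Ig)).
  exact: measurable_funM.
move=> t _; rewrite ler_norml; apply/andP; split; nra.
Qed.

Lemma bounded_sqi L f c : measurable_fun `]0, L[ f ->
  (forall x, x \in `]0, L[ -> `|f x| <= c) -> sqi L f.
Proof.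
move=> mf fc; split => //; apply: (itg_le _ (itg_cst L (c ^+ 2))).
  exact: measurable_funX.
move=> x xI; rewrite normrX lerXn2r ?nnegrE ?fc//.
by apply: le_trans (fc _ xI).
Qed.

Lemma sqi_cst L c : sqi L (fun=> c).
Proof. by apply: (@bounded_sqi _ _ `|c|). Qed.

Lemma sqi_itg L f : sqi L f -> itg L f.
Proof.
move=> sf; have := sqi_itgM sf (sqi_cst L 1).
by apply: eq_itg => t _; rewrite mulr1.
Qed.

Lemma sqiD L f g : sqi L f -> sqi L g -> sqi L (fun x => f x + g x).
Proof.
move=> sf sg; split.
  by apply: measurable_funD; exact: sqi_measurable.
have := itgD (itgD (sqi_itg2 sf) (sqi_itg2 sg)) (itgZ 2 (sqi_itgM sf sg)).
by apply: eq_itg => t _; ring.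
Qed.

Lemma sqiZ L c f : sqi L f -> sqi L (fun x => c * f x).
Proof.
move=> sf; split.
  by apply: measurable_funM => //; exact: sqi_measurable.
by have := itgZ (c ^+ 2) (sqi_itg2 sf); apply: eq_itg => t _; ring.
Qed.

Lemma sqiN L f : sqi L f -> sqi L (fun x => - f x).
Proof.
move=> sf; have -> : (fun x => - f x) = (fun x => -1 * f x) by apply/funext => x; ring.
exact: sqiZ.
Qed.

Lemma sqiB L f g : sqi L f -> sqi L g -> sqi L (fun x => f x - g x).
Proof. by move=> sf sg; apply: sqiD => //; exact: sqiN. Qed.

Lemma sqiM_bounded L f g c : sqi L f -> measurable_fun `]0, L[ g ->
  (forall x, x \in `]0, L[ -> `|g x| <= c) -> sqi L (fun x => g x * f x).
Proof.
move=> sf mg gc; split.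
  by apply: measurable_funM => //; exact: sqi_measurable.
apply: (itg_le _ (itgZ (c ^+ 2) (sqi_itg2 sf))).
  by apply: measurable_funX; apply: measurable_funM => //; exact: sqi_measurable.
move=> x xI; rewrite exprMn normrM ger0_norm ?sqr_ge0// ger0_norm ?sqr_ge0//.
rewrite ler_wpM2r ?sqr_ge0// -real_normK ?num_real//.
by rewrite lerXn2r ?nnegrE ?gc//; apply: le_trans (gc _ xI).
Qed.

Lemma eq_sqi L f g : {in `]0, L[, f =1 g} -> sqi L f -> sqi L g.
Proof.
move=> fg [mf If]; split.
  by apply: eq_measurable_fun mf => x; rewrite inE => /fg.
by apply: eq_itg If => x /fg ->.
Qed.

Lemma int0CS L f g : 0 <= L -> sqi L f -> sqi L g ->
  (int0 L (fun t => f t * g t)) ^+ 2 <=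
  int0 L (fun t => f t ^+ 2) * int0 L (fun t => g t ^+ 2).
Proof.
move=> L0 sf sg; have := @JCS L f g 0 L (sqi_itg2 sf) (sqi_itg2 sg) (sqi_itgM sf sg).
by rewrite /J !int0_itv0 !subr0; apply.
Qed.

End IntervalIntegral.

(** * Weak derivatives *)

Section WeakDerivative.
Variable R : realType.
Implicit Types (L x y c : R) (f g u v du dv : R -> R).
Notation mu := (@lebesgue_measure R).
Local Notation sqi := (@sq_integrable R).

Lemma is_wderiv_sqi L u du : is_wderiv L u du -> sqi L du.
Proof. by case. Qed.

Lemma is_wderiv_itg L u du : is_wderiv L u du -> itg L du.
Proof. by move/is_wderiv_sqi; exact: sqi_itg. Qed.

Lemma is_wderiv_J L u du x y : is_wderiv L u du -> 0 <= x -> x <= y -> y <= L ->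
  u y - u x = J du x y.
Proof.
move=> [_ H] x0 xy yL; rewrite (H y) ?(H x) /J ?in_itv/=; first by ring.
- by apply/andP; split => //; exact: le_trans yL.
- by apply/andP; split => //; exact: le_trans xy.
Qed.

Lemma is_wderivP L u du : sqi L du ->
  (forall x y, 0 <= x -> x <= y -> y <= L -> u y - u x = J du x y) ->
  is_wderiv L u du.
Proof.
move=> sdu H; split => // x; rewrite in_itv/= => /andP[x0 xL].
by have := H 0 x (lexx 0) x0 xL; rewrite /J int0_itv0 subr0 => <-; ring.
Qed.

Lemma is_wderiv_lin L a b u v du dv : is_wderiv L u du -> is_wderiv L v dv ->
  is_wderiv L (fun x => a * u x + b * v x) (fun x => a * du x + b * dv x).
Proof.
move=> Du Dv; apply: is_wderivP.
  by apply: sqiD; apply: sqiZ; [exact: is_wderiv_sqi Du|exact: is_wderiv_sqi Dv].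
move=> x y x0 xy yL.
rewrite (J_lin _ _ (is_wderiv_itg Du) (is_wderiv_itg Dv))//.
by rewrite -(is_wderiv_J Du)// -(is_wderiv_J Dv)//; ring.
Qed.

Lemma is_wderiv_cst L c : is_wderiv L (fun=> c) (fun=> 0).
Proof. by split; [exact: sqi_cst|move=> x _; rewrite int00 addr0]. Qed.

(** Lebesgue differentiation: extended by zero, [d] has the constant 0 as its primitive from minus
    infinity, and almost everywhere the derivative of the primitive is the function. This makes weak
    derivatives unique up to null sets, so that the chosen [wderiv] may be replaced under integrals
    by any other one. *)
Lemma int0_indef_eq0 L d : itg L d -> 0 <= L ->
  (forall x, x \in `[0, L] -> int0 x d = 0) ->
  ae_eq mu (`]0, L[%classic) d (cst 0).
Proof.
move=> Id L0 H.
pose D : set R := `]0, L[%classic.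
have mD : measurable D by exact: measurable_itv.
pose f := d \_ D.
have If : mu.-integrable setT (EFin \o f).
  have := (@integrable_mkcond _ _ _ mu D (EFin \o d) mD).1 Id.
  by rewrite restrict_EFin.
have lf : locally_integrable [set: R] f by exact: (integrable_locally mD Id).
have F0 x : \int[mu]_(t in `]-oo, x]) f t = 0.
  rewrite /f -Rintegral_mkcondr.
  have [x0|x0] := leP x 0.
    rewrite (_ : _ `&` _ = set0) ?Rintegral_set0// -subset0 => t /=.
    case=> + tD; move: tD; rewrite /D/= !in_itv/= => /andP[t0 _] tx.
    by have := lt_le_trans t0 (le_trans tx x0); rewrite ltxx.
  have [xL|xL] := leP L x.
    rewrite (_ : _ `&` _ = D); last first.
      apply/seteqP; split => t /=; first by case.
      by rewrite !in_itv/= => /andP[t0 tL]; split; [exact: ltW (lt_le_trans tL xL)|apply/andP].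
    by apply: H; rewrite in_itv/= lexx andbT.
  rewrite (_ : _ `&` _ = `]0, x]%classic); last first.
    apply/seteqP; split => t /=; rewrite !in_itv/=.
      by case=> tx /andP[t0 tL]; apply/andP.
    move=> /andP[t0 tx]; split => //; rewrite /D/= in_itv/= t0/=.
    exact: le_lt_trans tx xL.
  rewrite -Rintegral_itv_bndo_bndc; last exact: itgS (ltW xL) Id.
  by apply: H; rewrite in_itv/= !ltW.
have Iy y : mu.-integrable `]-oo, y] (EFin \o f).
  by apply: integrableS If => //; exact: subsetT.
have := FTC1Ny Iy lf.
move=> /=; apply: filterS => [|x [_]]; first exact: (ae_filter_ringOfSetsType mu).
under eq_fun do rewrite F0.
rewrite derive1_cst => fx Dx; rewrite fx /f patchE mem_set//.
Qed.

Lemma is_wderiv_uniq L u du dv : 0 <= L -> is_wderiv L u du -> is_wderiv L u dv ->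
  ae_eq mu (`]0, L[%classic) du dv.
Proof.
move=> L0 Du Dv.
have Id := itgB (is_wderiv_itg Du) (is_wderiv_itg Dv).
have := int0_indef_eq0 Id L0.
have H x : x \in `[0, L] -> int0 x (fun x0 => du x0 - dv x0) = 0.
  move=> xI; have E := Du.2 x xI; have := Dv.2 x xI.
  move: xI; rewrite in_itv/= => /andP[x0 xL].
  rewrite int0B; [|exact: itgS xL (is_wderiv_itg Du)|exact: itgS xL (is_wderiv_itg Dv)].
  by rewrite E => /addrI ->; rewrite subrr.
move=> /(_ H); apply: filterS => x /= Hx Dx.
by apply/eqP; rewrite -subr_eq0; apply/eqP; exact: Hx.
Qed.

Lemma wderivP L u : (exists du, is_wderiv L u du) -> is_wderiv L u (wderiv L u).
Proof. by move=> H; rewrite /wderiv; exact: (xgetPex (fun=> 0) H). Qed.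

Lemma is_wderiv_wderiv L u du : is_wderiv L u du -> is_wderiv L u (wderiv L u).
Proof. by move=> H; apply: wderivP; exists du. Qed.

Lemma wderiv_ae L u du : 0 <= L -> is_wderiv L u du ->
  ae_eq mu (`]0, L[%classic) (wderiv L u) du.
Proof. by move=> L0 H; exact: is_wderiv_uniq (is_wderiv_wderiv H) H. Qed.

Lemma int0_sub_ge0 L f x y : itg L f -> 0 <= x -> x <= y -> y <= L ->
  (forall t, 0 < t < L -> 0 <= f t) -> J f x y <= int0 L f.
Proof.
move=> If x0 xy yL f0.
have H1 : 0 <= J f 0 x.
  apply: (@J_ge0 _ L) => //; first exact: le_trans yL.
  by move=> t t0 /andP[_ tx]; apply: f0; rewrite t0/=; lra.
have H2 : 0 <= J f y L.
  apply: (@J_ge0 _ L) => //; first exact: le_trans xy.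
  by move=> t t0 /andP[_ tx]; apply: f0; rewrite t0.
by move: H1 H2; rewrite /J int0_itv0; lra.
Qed.

(** Cauchy-Schwarz for [du] against the constant 1. Continuity, boundedness, the product rule and
    the sampling inequality all rest on this estimate of increments. *)
Lemma is_wderiv_hoelder L u du x y : is_wderiv L u du ->
  0 <= x -> x <= y -> y <= L ->
  (u y - u x) ^+ 2 <= (y - x) * J (fun t => du t ^+ 2) x y.
Proof.
move=> Du x0 xy yL; rewrite (is_wderiv_J Du)//.
have sdu := is_wderiv_sqi Du.
have := @JCS _ L (cst 1) du x y (sqi_itg2 (sqi_cst L 1)) (sqi_itg2 sdu).
have -> : (fun t => cst 1 t * du t) = du by apply/funext => t; rewrite mul1r.
move=> /(_ (sqi_itg sdu) x0 xy yL); rewrite /cst.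
by rewrite [X in _ <= X * _](J_cst (1 ^+ 2) x0 xy) expr1n mul1r.
Qed.

Lemma is_wderiv_hoelder_abs L u du x y : is_wderiv L u du ->
  0 <= x <= L -> 0 <= y <= L ->
  (u y - u x) ^+ 2 <= `|y - x| * int0 L (fun t => du t ^+ 2).
Proof.
move=> Du; have I2 := sqi_itg2 (is_wderiv_sqi Du).
wlog : x y / x <= y => [W xI yI|xy /andP[x0 xL] /andP[y0 yL]].
  case: (leP x y) => xy; first exact: W.
  by rewrite distrC -sqrrN opprB; apply: W => //; exact: ltW.
apply: le_trans (is_wderiv_hoelder Du x0 xy yL) _.
rewrite ger0_norm ?subr_ge0// ler_wpM2l ?subr_ge0//.
by apply: int0_sub_ge0 => // t _; exact: sqr_ge0.
Qed.

Lemma hoelder_continuous L M w : 0 <= M ->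
  (forall x y, 0 <= x <= L -> 0 <= y <= L -> (w y - w x) ^+ 2 <= `|y - x| * M) ->
  {within `[0, L], continuous w}.
Proof.
move=> M0 H; apply/subspace_continuousP => x /=; rewrite in_itv/= => xI.
apply/cvgrPdist_lt => e e0; rewrite /prop_near1/= nbhs_simpl/=.
(* [M + 1] instead of [M], which may be 0. *)
have d0 : 0 < e ^+ 2 / (M + 1) by apply: mulr_gt0; [exact: exprn_gt0|rewrite invr_gt0; lra].
have nx : \forall y \near (x : R), `|x - y| < e ^+ 2 / (M + 1).
  by apply: (@cvgr_dist_lt _ _ _ (nbhs (x : R)) _ id (x : R)); [exact: cvg_id|].
rewrite /within/=.
near=> y; rewrite in_itv/= => yI.
have d : `|x - y| < e ^+ 2 / (M + 1) by near: y.
rewrite -(@ltr_pXn2r _ 2)// ?nnegrE ?(ltW e0)// real_normK ?num_real//.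
apply: le_lt_trans (H _ _ yI xI) _.
apply: (@le_lt_trans _ _ (e ^+ 2 / (M + 1) * M)); first by rewrite ler_wpM2r// ltW.
rewrite mulrAC ltr_pdivrMr; last lra.
have := exprn_gt0 2 e0; nra.
Unshelve. all: end_near. Qed.

Lemma is_wderiv_cont L u du : is_wderiv L u du -> {within `[0, L], continuous u}.
Proof.
move=> Du; apply: (@hoelder_continuous _ (int0 L (fun t => du t ^+ 2))).
  by apply: int0_ge0 => t _; exact: sqr_ge0.
by move=> x y xI yI; exact: is_wderiv_hoelder_abs.
Qed.

Lemma is_wderiv_measurable L u du : is_wderiv L u du ->
  measurable_fun `]0, L[ u.
Proof.
move=> /is_wderiv_cont cu; apply: subspace_continuous_measurable_fun => //.
by apply: continuous_subspaceW cu; exact: subset_itv_oo_cc.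
Qed.

Lemma is_wderiv_bound L u du : 0 <= L -> is_wderiv L u du ->
  exists2 c, 0 <= c & forall x, 0 <= x <= L -> `|u x| <= c.
Proof.
move=> L0 Du; set M := int0 L (fun t => du t ^+ 2).
have M0 : 0 <= M by apply: int0_ge0 => t _; exact: sqr_ge0.
exists (`|u 0| + (1 + L * M)); first by apply: addr_ge0 => //; nra.
move=> x xI; have := @is_wderiv_hoelder_abs L u du 0 x Du.
rewrite lexx L0 => /(_ isT xI); rewrite subr0 -/M => H.
have H2 : `|u x - u 0| <= 1 + L * M.
  have : `|u x - u 0| ^+ 2 <= L * M.
    rewrite real_normK ?num_real//; apply: le_trans H _; rewrite ler_wpM2r//.
    by case/andP: xI => x0 xL; rewrite ger0_norm.
  have := normr_ge0 (u x - u 0); move: (`|_|) => z z0 zz.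
  have [|] := lerP z 1; nra.
have -> : u x = u 0 + (u x - u 0) by ring.
by apply: le_trans (ler_normD _ _) _; rewrite lerD2l.
Qed.

Lemma is_wderiv_sqi_fun L u du : 0 <= L -> is_wderiv L u du -> sqi L u.
Proof.
move=> L0 Du; have [c _ uc] := is_wderiv_bound L0 Du.
apply: (@bounded_sqi _ _ _ c); first exact: is_wderiv_measurable Du.
by move=> x; rewrite in_itv/= => /andP[x0 xL]; apply: uc; rewrite !ltW.
Qed.

(* Stands in for differentiation almost everywhere in the proof of the product
   rule: on n steps the increments add up to O(1/n). *)
Lemma small_increments_cst (F Phi : R -> R) X : 0 <= X ->
  (forall x y, 0 <= x -> x <= y -> y <= X ->
     `|F y - F x| <= (y - x) * (Phi y - Phi x)) -> F X = F 0.
Proof.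
move=> X0 H.
have step (h : R) (n : nat) : 0 <= h -> n%:R * h <= X ->
    `|F (n%:R * h) - F 0| <= h * (Phi (n%:R * h) - Phi 0).
  move=> h0; elim: n => [|n IH] nX; first by rewrite mul0r !subrr normr0 mulr0.
  have nX' : n%:R * h <= X by move: nX; rewrite -natr1; nra.
  have n0 : 0 <= n%:R * h by exact: mulr_ge0.
  have E : n.+1%:R * h = n%:R * h + h by rewrite -natr1 mulrDl mul1r.
  have := IH nX'; have := H (n%:R * h) (n.+1%:R * h) n0.
  rewrite E in nX *; move=> /(_ _ nX); rewrite lerDl => /(_ h0).
  have -> : n%:R * h + h - n%:R * h = h by ring.
  set a := F (_ + _); set b := F (n%:R * h) => h1 h2.
  have -> : a - F 0 = (a - b) + (b - F 0) by ring.
  apply: le_trans (ler_normD _ _) _; nra.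
apply/eqP; rewrite -subr_eq0 -normr_eq0; apply/negP => /negP ne.
have e0 : 0 < `|F X - F 0| by rewrite lt_def ne /=.
set e := `|_| in e0 ne.
set K := X * (Phi X - Phi 0).
have [N KN] : exists N : nat, K / e < N.+1%:R.
  by exists (Num.truncn (K / e)); exact: truncnS_gt.
have := step (X / N.+1%:R) N.+1 (divr_ge0 X0 (ler0n _ _)).
have -> : N.+1%:R * (X / N.+1%:R) = X by rewrite mulrC divfK// pnatr_eq0.
move=> /(_ (lexx _)); rewrite -/e => H1.
have : e * N.+1%:R <= K.
  by rewrite /K -ler_pdivlMr ?ltr0n//; apply: le_trans H1 _; rewrite -!mulrA [_^-1 * _]mulrC.
move: KN; rewrite ltr_pdivrMr// => KN; lra.
Qed.

(* With F = u v - int (u v' + v u') and Phi = int (u'^2 + v'^2), Hoelder's estimate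
   gives |F y - F x| <= (y - x) (Phi y - Phi x). *)
Lemma is_wderivM L u v du dv : 0 <= L -> is_wderiv L u du -> is_wderiv L v dv ->
  is_wderiv L (fun x => u x * v x) (fun x => u x * dv x + v x * du x).
Proof.
move=> L0 Du Dv.
have [cu cu0 ucu] := is_wderiv_bound L0 Du.
have [cv cv0 vcv] := is_wderiv_bound L0 Dv.
have su : sqi L (fun x => u x * dv x).
  apply: (@sqiM_bounded _ _ _ _ cu (is_wderiv_sqi Dv) (is_wderiv_measurable Du)).
  by move=> x; rewrite in_itv/= => /andP[x0 xL]; apply: ucu; rewrite !ltW.
have sv : sqi L (fun x => v x * du x).
  apply: (@sqiM_bounded _ _ _ _ cv (is_wderiv_sqi Du) (is_wderiv_measurable Dv)).
  by move=> x; rewrite in_itv/= => /andP[x0 xL]; apply: vcv; rewrite !ltW.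
have sw := sqiD su sv.
split => // X; rewrite in_itv/= => /andP[X0 XL].
pose G := fun x => int0 x (fun t => u t * dv t + v t * du t).
have I1 := sqi_itg2 (is_wderiv_sqi Du); have I2 := sqi_itg2 (is_wderiv_sqi Dv).
have I12 := itgD I1 I2.
pose Phi := fun x => int0 x (fun t => du t ^+ 2 + dv t ^+ 2).
suff : u X * v X - G X = u 0 * v 0 - G 0.
  by rewrite /G int0_itv0 subr0 => /eqP; rewrite subr_eq => /eqP ->.
apply: (@small_increments_cst (fun x => u x * v x - G x) Phi) => // x y x0 xy yX.
have yL := le_trans yX XL.
have hu t : x <= t < y -> 0 < t -> `|u y - u t| <= Num.sqrt (y - x) * Num.sqrt (J (fun t => du t ^+ 2) x y).
  move=> /andP[xt ty] t0; rewrite -sqrtrM ?subr_ge0//.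
  rewrite -[leLHS]ger0_norm// -sqrtr_sqr ler_wsqrtr// real_normK ?num_real//.
  apply: le_trans (is_wderiv_hoelder Du (ltW t0) (ltW ty) yL) _.
  apply: ler_pM.
  - by rewrite subr_ge0 ltW.
  - apply: (@J_ge0 _ L) => //; [exact: ltW|exact: ltW|].
    by move=> s _ _; exact: sqr_ge0.
  - lra.
  - rewrite -(J_cat _ x t y) lerDr; apply: (@J_ge0 _ L) => //; first lra.
    by move=> s _ _; exact: sqr_ge0.
have hv t : x <= t < y -> 0 < t -> `|v t - v x| <= Num.sqrt (y - x) * Num.sqrt (J (fun t => dv t ^+ 2) x y).
  move=> /andP[xt ty] t0; rewrite -sqrtrM ?subr_ge0//.
  have tL : t <= L by lra.
  rewrite -[leLHS]ger0_norm// -sqrtr_sqr ler_wsqrtr// real_normK ?num_real//.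
  apply: le_trans (is_wderiv_hoelder Dv x0 xt tL) _.
  apply: ler_pM.
  - by rewrite subr_ge0.
  - apply: (@J_ge0 _ L) => //.
    by move=> s _ _; exact: sqr_ge0.
  - lra.
  - rewrite -(J_cat _ x t y) lerDl; apply: (@J_ge0 _ L) => //; [lra|lra|].
    by move=> s _ _; exact: sqr_ge0.
have Idu := is_wderiv_itg Du; have Idv := is_wderiv_itg Dv.
have hJ1 d : sqi L d -> J (fun t => `|d t|) x y <= Num.sqrt (y - x) * Num.sqrt (J (fun t => d t ^+ 2) x y).
  move=> sd; rewrite -sqrtrM ?subr_ge0//.
  have J0 : 0 <= J (fun t => `|d t|) x y by apply: (@J_ge0 _ L) => //; exact: itg_norm (sqi_itg sd).
  rewrite -[leLHS]ger0_norm// -sqrtr_sqr ler_wsqrtr//.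
  have Eabs : (fun t => `|d t| ^+ 2) = (fun t => d t ^+ 2).
    by apply/funext => t; rewrite real_normK ?num_real.
  have := @JCS _ L (cst 1) (fun t => `|d t|) x y (sqi_itg2 (sqi_cst L 1)).
  rewrite Eabs => /(_ (sqi_itg2 sd)).
  have -> : (fun t => cst 1 t * `|d t|) = (fun t => `|d t|) by apply/funext => t; rewrite mul1r.
  move=> /(_ (itg_norm (sqi_itg sd)) x0 xy yL); rewrite /cst.
  by rewrite [X in _ <= X * _](J_cst (1 ^+ 2) x0 xy) expr1n mul1r.
set A := J (fun t => du t ^+ 2) x y in hu *.
set B := J (fun t => dv t ^+ 2) x y in hv *.
have A0 : 0 <= A by apply: (@J_ge0 _ L) => // t _ _; exact: sqr_ge0.
have B0 : 0 <= B by apply: (@J_ge0 _ L) => // t _ _; exact: sqr_ge0.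
have IU := itgB (itgZ (u y) Idv) (sqi_itg su).
have IV := itgB (sqi_itg sv) (itgZ (v x) Idu).
(* As [u y * v y - u x * v x = u y * (v y - v x) + v x * (u y - u x)], [u] is frozen at the right
   end in front of [dv] and [v] at the left end in front of [du]. Each of the two error integrals is
   at most [(y - x) * sqrt (A * B)]. *)
have -> : u y * v y - G y - (u x * v x - G x) =
    J (fun t => (u y * dv t - u t * dv t)) x y - J (fun t => (v t * du t - v x * du t)) x y.
  rewrite (JB (itgZ (u y) Idv) (sqi_itg su))// (JB (sqi_itg sv) (itgZ (v x) Idu))//.
  rewrite (JZ _ Idv)// (JZ _ Idu)// -(is_wderiv_J Du)// -(is_wderiv_J Dv)//.
  have -> : G y = G x + J (fun t => u t * dv t + v t * du t) x y by rewrite /J /G; ring.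
  rewrite (JD (sqi_itg su) (sqi_itg sv))//; ring.
have -> : (y - x) * (Phi y - Phi x) = (y - x) * (A + B).
  by congr (_ * _); rewrite -[LHS]/(J (fun t => du t ^+ 2 + dv t ^+ 2) x y) (JD I1 I2).
have sq2 : Num.sqrt (y - x) * Num.sqrt (y - x) = y - x.
  by rewrite -expr2 sqr_sqrtr// subr_ge0.
have ab : 2 * (Num.sqrt A * Num.sqrt B) <= A + B.
  by rewrite -{2}(sqr_sqrtr A0) -{2}(sqr_sqrtr B0); have := sqr_ge0 (Num.sqrt A - Num.sqrt B); nra.
have K1 : `|J (fun t => (u y * dv t - u t * dv t)) x y| <= (y - x) * (Num.sqrt A * Num.sqrt B).
  apply: le_trans (ler_norm_J IU x0 xy yL) _.
  apply: (@le_trans _ _ (J (fun t => Num.sqrt (y - x) * Num.sqrt A * `|dv t|) x y)).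
    apply: (le_J (itg_norm IU) (itgZ _ (itg_norm Idv))) => // t t0 txy.
    by rewrite -mulrBl normrM ler_wpM2r// hu.
  rewrite (JZ _ (itg_norm Idv))// -{2}sq2.
  have := hJ1 dv (is_wderiv_sqi Dv); rewrite -/B.
  have := mulr_ge0 (sqrtr_ge0 (y - x)) (sqrtr_ge0 A).
  move=> p0 /(ler_wpM2l p0); nra.
have K2 : `|J (fun t => (v t * du t - v x * du t)) x y| <= (y - x) * (Num.sqrt A * Num.sqrt B).
  apply: le_trans (ler_norm_J IV x0 xy yL) _.
  apply: (@le_trans _ _ (J (fun t => Num.sqrt (y - x) * Num.sqrt B * `|du t|) x y)).
    apply: (le_J (itg_norm IV) (itgZ _ (itg_norm Idu))) => // t t0 txy.
    by rewrite -mulrBl normrM ler_wpM2r// hv.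
  rewrite (JZ _ (itg_norm Idu))// -{2}sq2.
  have := hJ1 du (is_wderiv_sqi Du); rewrite -/A.
  have := mulr_ge0 (sqrtr_ge0 (y - x)) (sqrtr_ge0 B).
  move=> p0 /(ler_wpM2l p0); nra.
apply: le_trans (ler_normB _ _) _; apply: le_trans (lerD K1 K2) _.
by rewrite -mulrDr ler_wpM2l ?subr_ge0//; move: ab; nra.
Qed.

(** By the product rule [u x ^+ 2 <= u y ^+ 2 + 2 * W] for every [y]; the estimate is the average
    over [y]. *)
Lemma agmon L u du x : 0 < L -> is_wderiv L u du -> 0 <= x <= L ->
  u x ^+ 2 <= L^-1 * int0 L (fun t => u t ^+ 2) + 2 * int0 L (fun t => `|u t * du t|).
Proof.
move=> L0 Du xI; have DM := is_wderivM (ltW L0) Du Du.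
have su := is_wderiv_sqi_fun (ltW L0) Du.
have Iud := sqi_itgM su (is_wderiv_sqi Du).
set W := int0 L (fun t => `|u t * du t|).
have key y : 0 <= y <= L -> u x ^+ 2 <= u y ^+ 2 + 2 * W.
  have E : (fun t => u t * du t + u t * du t) = (fun t => 2 * (u t * du t)).
    by apply/funext => t; ring.
  have h a b : 0 <= a -> a <= b -> b <= L -> `|u b * u b - u a * u a| <= 2 * W.
    move=> a0 ab bL; rewrite (is_wderiv_J DM)// E (JZ _ Iud)// normrM ger0_norm// ler_wpM2l//.
    apply: le_trans (ler_norm_J Iud a0 ab bL) _.
    by apply: int0_sub_ge0 => //; exact: itg_norm.
  case/andP: xI => x0 xL /andP[y0 yL]; rewrite !expr2.
  case: (leP x y) => [xy|/ltW yx].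
    by have := h x y x0 xy yL; rewrite ler_norml => /andP[]; lra.
  by have := h y x y0 yx xL; rewrite ler_norml => /andP[]; lra.
have := @le_int0 _ L (fun=> u x ^+ 2) (fun y => u y ^+ 2 + 2 * W) (itg_cst _ _)
  (itgD (sqi_itg2 su) (itg_cst _ _)).
rewrite int0D ?int0_cst ?(ltW L0)//; [|exact: sqi_itg2|exact: itg_cst].
move=> /(_ _)H; have {H} : u x ^+ 2 * L <= int0 L (fun y => u y ^+ 2) + 2 * W * L.
  by apply: H => t; rewrite in_itv/= => /andP[t0 tL]; apply: key; rewrite !ltW.
by rewrite -ler_pdivlMr// mulrDl mulfK ?gt_eqF// mulrC.
Qed.

End WeakDerivative.

(** * Completeness of L_2 and of H^1 *)

Section Completeness.
Variable R : realType.
Implicit Types (L x y c e : R) (f g u v du dv : R -> R).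
Notation mu := (@lebesgue_measure R).
Local Notation sqi := (@sq_integrable R).

Lemma cauchy_seq_cvg (a : nat -> R) :
  (forall e, 0 < e -> exists N, forall m n, (N <= m)%N -> (N <= n)%N ->
     `|a m - a n| <= e) ->
  exists l, forall e, 0 < e -> exists N, forall n, (N <= n)%N -> `|a n - l| <= e.
Proof.
move=> H; have ca : cauchy (a @ \oo).
  apply: cauchy_exP => e e0; have [N HN] := H _ (divr_gt0 e0 (ltr0n R 2)).
  exists (a N); exists N => //= n /= Nn; rewrite /ball/=.
  apply: le_lt_trans (HN _ _ (leqnn _) Nn) _; lra.
have /cauchy_cvgP/cvg_ex[l la] := ca; exists l => e e0.
have [N _ HN] := cvgr_dist_le _ _ la _ e0.
by exists N => n Nn; rewrite distrC; exact: HN.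
Qed.

Lemma sqi_int0E L f : sqi L f ->
  (\int[mu]_(x in `]0%R, L[) (f x ^+ 2)%:E)%E = (int0 L (fun x => f x ^+ 2))%:E.
Proof.
move=> sf; rewrite /int0 /Rintegral fineK//.
by apply: integrable_fin_num => //; exact: sqi_itg2 sf.
Qed.

Lemma geometric4_sum_le n : \sum_(0 <= k < n) (4^-1 : R) ^+ k <= 2.
Proof.
apply: (@le_trans _ _ (2 - 2 * 4^-1 ^+ n)); last first.
  by rewrite lerBlDr lerDl mulr_ge0// exprn_ge0.
elim: n => [|n IH]; first by rewrite big_geq// expr0; lra.
rewrite big_nat_recr//= exprS; have := @exprn_ge0 R n 4^-1; lra.
Qed.

Lemma fatou_sqi L (d : nat -> R -> R) g e : (forall k, sqi L (d k)) ->
  (forall x, x \in `]0, L[ -> d ^~ x @ \oo --> g x) ->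
  (forall k, int0 L (fun x => d k x ^+ 2) <= e) ->
  sqi L g /\ int0 L (fun x => g x ^+ 2) <= e.
Proof.
move=> sd dg de.
have mg : measurable_fun `]0, L[ g.
  apply: (@measurable_fun_cvg _ _ _ _ d) => [m|x xI]; first exact: sqi_measurable.
  exact: dg.
pose F k x := ((d k x) ^+ 2)%:E.
have mF k : measurable_fun `]0, L[ (F k).
  by apply/measurable_EFinP; apply: measurable_funX; exact: sqi_measurable.
have FT := @fatou _ _ R mu `]0, L[%classic (measurable_itv _) F mF
  (fun n x _ => sqr_ge0 (d n x)).
have E1 : (\int[mu]_(x in `]0%R, L[) limn_einf (F ^~ x) =
          \int[mu]_(x in `]0%R, L[) (g x ^+ 2)%:E)%E.
  apply: eq_integral => x; rewrite inE => xI.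
  apply: (cvg_limn_einf_sup _).1.
  apply: cvg_EFin; first by near=> k.
  rewrite /F /comp/= expr2; apply: cvgM; exact: dg.
have E2 : (limn_einf (fun n => \int[mu]_(x in `]0%R, L[) F n x) <= e%:E)%E.
  rewrite limn_einf_lim; apply: lime_le; first exact: is_cvg_einfs.
  near=> k; rewrite /einfs/=.
  apply: (@le_trans _ _ (\int[mu]_(x in `]0%R, L[) F k x)%E).
    by apply: ereal_inf_lbound; exists k => /=.
  by rewrite /F sqi_int0E// lee_fin.
rewrite E1 in FT.
have le_e := le_trans FT E2.
have sg : sqi L g.
  split => //; apply/integrableP; split.
    by apply/measurable_EFinP; exact: measurable_funX.
  apply: le_lt_trans (ltry e); apply: le_trans le_e.
  have -> // : (\int[mu]_(x in `]0%R, L[) `|(EFin \o (fun x0 => (g x0 ^+ 2)%R)) x| =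
    \int[mu]_(x in `]0%R, L[) (g x ^+ 2)%:E)%E.
  by apply: eq_integral => x _; rewrite /= ger0_norm ?sqr_ge0.
by split => //; rewrite -lee_fin -sqi_int0E.
Unshelve. all: end_near. Qed.

(* A subsequence with increments of L_2 norm at most 4^-k converges almost everywhere;
   Fatou's lemma turns this into convergence in norm. *)
Lemma L2_complete L (d : nat -> R -> R) : (forall n, sqi L (d n)) ->
  (forall e, 0 < e -> exists N, forall m n, (N <= m)%N -> (N <= n)%N ->
     int0 L (fun x => (d m x - d n x) ^+ 2) <= e) ->
  exists2 g, sqi L g & forall e, 0 < e -> exists N, forall n, (N <= n)%N ->
     int0 L (fun x => (d n x - g x) ^+ 2) <= e.
Proof.
move=> sd H.
(* Squared increments below [16^-1 ^+ k] leave room for the weights [4 ^+ k] below: the weighted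
   series has integral at most the sum of the [4^-1 ^+ k], hence at most 2. *)
have /choice[phi Hphi] : forall k : nat, exists N, forall m n, (N <= m)%N -> (N <= n)%N ->
     int0 L (fun x => (d m x - d n x) ^+ 2) <= (16^-1) ^+ k.
  by move=> k; apply: H; exact: exprn_gt0.
(* The sum makes [psi] monotone and at least [phi k]; the summand [k] makes it at least [k]. *)
pose psi k := (k + \sum_(j < k.+1) phi j)%N.
have psi_ge k : (phi k <= psi k)%N.
  by rewrite /psi big_ord_recr/= addnA leq_addl.
have psiS k : (psi k <= psi k.+1)%N.
  by rewrite /psi [in leqRHS]big_ord_recr/= leq_add// leq_addr.
have psi_id k : (k <= psi k)%N by rewrite leq_addr.
pose eps k x := d (psi k.+1) x - d (psi k) x.
have seps k : sqi L (eps k) by exact: sqiB.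
have Heps k : int0 L (fun x => eps k x ^+ 2) <= 16^-1 ^+ k.
  by apply: Hphi => //; apply: leq_trans (psiS _).
(* Where the sum [h] of these terms is finite, each term is at most [h x]; the increments then decay
   like [2^-1 ^+ k] and the subsequence converges. *)
pose t k x := (4 ^+ k * eps k x ^+ 2)%:E : \bar R.
have t0 k x : (0 <= t k x)%E by rewrite lee_fin mulr_ge0 ?sqr_ge0// exprn_ge0.
have mt k : measurable_fun `]0, L[ (t k).
  apply/measurable_EFinP; apply: measurable_funM => //.
  by apply: measurable_funX; exact: sqi_measurable.
pose h x := (\sum_(k <oo) t k x)%E.
have mh : measurable_fun `]0, L[ h.
  rewrite /h; apply: (@ge0_emeasurable_sum _ _ _ _ t xpredT) => //.
have h0 x : (0 <= h x)%E by apply: nneseries_ge0 => k _ _; exact: t0.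
have Ih : (\int[mu]_(x in `]0%R, L[) h x <= 2%:E)%E.
  rewrite /h integral_nneseries//.
  apply: lime_le; first by apply: is_cvg_nneseries => n _ _; apply: integral_ge0 => x _; exact: t0.
  near=> n; apply: (@le_trans _ _ (\sum_(0 <= k < n) ((4^-1) ^+ k)%:E)%E).
    apply: lee_sum => k _; rewrite /t; under eq_integral do rewrite EFinM.
    rewrite ge0_integralZl//; last 2 first.
    - by apply/measurable_EFinP; apply: measurable_funX; exact: sqi_measurable.
    - by move=> x _; rewrite lee_fin sqr_ge0.
    rewrite sqi_int0E// -EFinM lee_fin.
    apply: le_trans (ler_wpM2l (exprn_ge0 _ _) (Heps k)) _ => //.
    rewrite -exprMn_comm; last exact: mulrC.
    by rewrite (_ : 4 * 16^-1 = 4^-1)//; field.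
  rewrite sumEFin lee_fin; exact: geometric4_sum_le.
have ih : mu.-integrable `]0, L[ h.
  apply/integrableP; split => //; apply: le_lt_trans (ltry 2).
  have -> // : (\int[mu]_(x in `]0%R, L[) `|h x| = \int[mu]_(x in `]0%R, L[) h x)%E.
  by apply: eq_integral => x _; rewrite gee0_abs.
pose A : set R := `]0, L[%classic `&` [set x | h x \is a fin_num].
have mA : measurable A by exact: emeasurable_fin_num.
have cvgA x : A x -> exists l : R, d (psi k) x @[k --> \oo] --> l.
  move=> [_ /= hx].
  have bk k : `|eps k x| <= Num.sqrt (fine (h x)) * 2^-1 ^+ k.
    have E : 4 ^+ k * eps k x ^+ 2 <= fine (h x).
      rewrite -lee_fin fineK//.
      have := @nneseries_lim_ge R (fun k => t k x) xpredT 0 k.+1 (fun n _ _ => t0 n x).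
      apply: le_trans; rewrite big_nat_recr//= leeDr//.
      by apply: sume_ge0 => i _; exact: t0.
    rewrite -[leLHS]ger0_norm// -sqrtr_sqr real_normK ?num_real//.
    rewrite -[X in _ * X]ger0_norm ?exprn_ge0// -sqrtr_sqr -sqrtrM ?fine_ge0//.
    apply: ler_wsqrtr; apply: le_trans (ler_wpM2r _ E); last exact: sqr_ge0.
    rewrite mulrAC -exprM mulnC exprM -exprMn.
    by rewrite (_ : 4 * 2^-1 ^+ 2 = 1) ?expr1n ?mul1r//; field.
  have ce : cvgn (series (eps ^~ x)).
    apply: normed_cvg; apply: (@series_le_cvg _ _ (geometric (Num.sqrt (fine (h x))) 2^-1)).
    - by move=> n; exact: normr_ge0.
    - by move=> n; rewrite /geometric/= mulr_ge0 ?sqrtr_ge0// exprn_ge0.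
    - by move=> n; exact: bk.
    - by apply: is_cvg_geometric_series; rewrite ger0_norm//; lra.
  exists (d (psi 0) x + limn (series (eps ^~ x))).
  have -> : (fun k => d (psi k) x) = (fun k => d (psi 0) x + series (eps ^~ x) k).
    apply/funext => k; rewrite /series/= /eps telescope_sumr//; ring.
  by apply: cvgD => //; exact: cvg_cst.
(* Cutting off outside [A] gives convergence at every point, as [fatou_sqi] asks. No integral
   changes, since [h] is integrable and thus finite almost everywhere. *)
pose f k x := \1_A x * d (psi k) x.
have sf k : sqi L (f k).
  apply: (@sqiM_bounded _ _ _ _ 1 (sd _)); first exact: measurable_indic.
  by move=> x _; rewrite indicE; case: (_ \in _); rewrite ?normr1 ?normr0.
pose g x := limn (f ^~ x).
have fg x : f ^~ x @ \oo --> g x.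
  have [Ax|Ax] := boolP (x \in A).
    have [l Hl] := cvgA _ (set_mem Ax).
    have E : f ^~ x = (fun k => d (psi k) x).
      by apply/funext => k; rewrite /f indicE Ax mul1r.
    by rewrite /g E; apply/cvg_ex; exists l.
  have E : f ^~ x = cst 0.
    by apply/funext => k; rewrite /f indicE (negbTE Ax) mul0r.
  by rewrite /g E; apply/cvg_ex; exists 0; exact: cvg_cst.
have aef k n : int0 L (fun x => (d n x - f k x) ^+ 2) = int0 L (fun x => (d n x - d (psi k) x) ^+ 2).
  apply: ae_int0.
  - exact: itg_measurable (sqi_itg2 (sqiB (sd _) (sf _))).
  - exact: itg_measurable (sqi_itg2 (sqiB (sd _) (sd _))).
  have Hf : {ae mu, forall x, `]0, L[%classic x -> h x \is a fin_num}.
    by apply: integrable_ae ih.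
  apply: (@filterS _ _ (ae_filter_ringOfSetsType mu) _ _ _ Hf) => x Hx Dx; rewrite /f indicE.
  by rewrite (_ : x \in A) ?mul1r// inE; split => //; exact: Hx.
have main e : 0 < e -> exists N, forall n, (N <= n)%N -> sqi L (fun x => d n x - g x) /\
    int0 L (fun x => (d n x - g x) ^+ 2) <= e.
  move=> e0; have [N HN] := H e e0; exists N => n Nn.
  (* The shift by [N] makes the Cauchy bound hold for every [k], not only for large ones. *)
  apply: (@fatou_sqi L (fun k x => d n x - f (k + N)%N x)).
  - by move=> k; exact: sqiB.
  - move=> x _; apply: cvgB; first exact: cvg_cst.
    by rewrite (cvg_shiftn N (f ^~ x)).
  - move=> k; rewrite aef; apply: HN => //.
    by apply: leq_trans (psi_id _); rewrite leq_addl.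
exists g.
  have [N /(_ N (leqnn N))[s _]] := main 1 ltr01.
  have := sqiB (sd N) s; congr (sqi L); apply/funext => x; ring.
by move=> e e0; have [N HN] := main e e0; exists N => n /HN[].
Unshelve. all: end_near. Qed.

(** The derivatives converge in L_2 and, by Agmon's inequality, the values at 0 converge; the limit
    is rebuilt from these two data. Convergence is stated uniformly in [x] because periodicity and
    mean zero must pass to the limit. *)
Lemma is_wderiv_lim L (u : nat -> R -> R) (d : nat -> R -> R) : 0 < L ->
  (forall n, is_wderiv L (u n) (d n)) ->
  (forall e, 0 < e -> exists N, forall m n, (N <= m)%N -> (N <= n)%N ->
     int0 L (fun x => (d m x - d n x) ^+ 2) + int0 L (fun x => (u m x - u n x) ^+ 2) <= e) ->
  exists v dv, is_wderiv L v dv /\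
   (forall e, 0 < e -> exists N, forall n, (N <= n)%N ->
     int0 L (fun x => (d n x - dv x) ^+ 2) <= e /\
     forall x, 0 <= x <= L -> `|u n x - v x| <= e).
Proof.
move=> L0 Du H.
have sd n := is_wderiv_sqi (Du n).
have su n := is_wderiv_sqi_fun (ltW L0) (Du n).
have [|dv sdv Hdv] := @L2_complete L d sd.
  move=> e /H[N HN]; exists N => m n Nm Nn; apply: le_trans (HN _ _ Nm Nn).
  by rewrite lerDl; apply: int0_ge0 => x _; exact: sqr_ge0.
have [l Hl] : exists l, forall e, 0 < e -> exists N, forall n, (N <= n)%N -> `|u n 0 - l| <= e.
  apply: cauchy_seq_cvg => e e0.
  have C0 : 0 < L^-1 + 2 by rewrite addr_gt0// invr_gt0.
  have [N HN] := H _ (divr_gt0 (exprn_gt0 2 e0) C0).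
  exists N => m n Nm Nn; have := HN _ _ Nm Nn => {HN}.
  have Dd : is_wderiv L (fun x => u m x - u n x) (fun x => d m x - d n x).
    have := is_wderiv_lin 1 (-1) (Du m) (Du n).
    by congr (is_wderiv L); apply/funext => x; ring.
  have := @agmon _ L _ _ 0 L0 Dd; rewrite lexx ltW// => /(_ isT).
  have s1 := is_wderiv_sqi_fun (ltW L0) Dd; have s2 := is_wderiv_sqi Dd.
  have : 2 * int0 L (fun t => `|(u m t - u n t) * (d m t - d n t)|) <=
     int0 L (fun x => (d m x - d n x) ^+ 2) + int0 L (fun x => (u m x - u n x) ^+ 2).
    rewrite -int0Z; last exact: itg_norm (sqi_itgM s1 s2).
    rewrite -int0D; [|exact: sqi_itg2 s2|exact: sqi_itg2 s1].
    apply: le_int0; first exact: itgZ (itg_norm (sqi_itgM s1 s2)).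
      exact: itgD (sqi_itg2 s2) (sqi_itg2 s1).
    move=> x _; rewrite normrM -[X in _ <= X + _]real_normK ?num_real// -[X in _ <= _ + X]real_normK ?num_real//.
    by have := sqr_ge0 (`|u m x - u n x| - `|d m x - d n x|); nra.
  have : 0 <= int0 L (fun x => (d m x - d n x) ^+ 2) by apply: int0_ge0 => x _; exact: sqr_ge0.
  have : 0 <= int0 L (fun x => (u m x - u n x) ^+ 2) by apply: int0_ge0 => x _; exact: sqr_ge0.
  set A := int0 L _; set B := int0 L _; set W := 2 * _.
  move=> A0 B0 WAB h hh.
  have Li : 0 < L^-1 by rewrite invr_gt0.
  have : (u m 0 - u n 0) ^+ 2 <= e ^+ 2.
    apply: (@le_trans _ _ ((B + A) * (L^-1 + 2))); first by nra.
    by rewrite -ler_pdivlMr.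
  rewrite -real_normK ?num_real// ler_pXn2r// ?nnegrE//; exact: ltW.
exists (fun x => l + int0 x dv), dv; split.
  by split => // x _; rewrite int0_itv0 addr0.
move=> e e0; have e2 : 0 < e / 2 by lra.
have [N1 HN1] := Hl _ e2.
have [N2 HN2] := Hdv _ (divr_gt0 (exprn_gt0 2 e2) L0).
have [N3 HN3] := Hdv _ e0.
exists (maxn N1 (maxn N2 N3)) => n; rewrite !geq_max => /and3P[n1 n2 n3]; split; first exact: HN3.
move=> x /andP[x0 xL].
have -> : u n x = u n 0 + int0 x (d n) by have := (Du n).2 x; rewrite in_itv/= x0 xL; exact.
have -> : u n 0 + int0 x (d n) - (l + int0 x dv) = (u n 0 - l) + (int0 x (d n) - int0 x dv) by ring.
apply: le_trans (ler_normD _ _) _; rewrite [leRHS]splitr; apply: lerD; first exact: HN1.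
have sB := sqiB (sd n) sdv.
rewrite -int0B; [|exact: itgS xL (sqi_itg (sd n))|exact: itgS xL (sqi_itg sdv)].
rewrite -(@ler_pXn2r _ 2)// ?nnegrE// ?(ltW e2)//.
rewrite real_normK ?num_real//.
have := @JCS _ L (cst 1) (fun t => d n t - dv t) 0 x (sqi_itg2 (sqi_cst L 1)) (sqi_itg2 sB).
have -> : (fun t => cst 1 t * (d n t - dv t)) = (fun t => d n t - dv t).
  by apply/funext => t; rewrite mul1r.
move=> /(_ (sqi_itg sB) (lexx 0) x0 xL); rewrite /cst.
rewrite [X in _ <= X * _](J_cst (1 ^+ 2) (lexx 0) x0) expr1n mul1r subr0.
rewrite {1}/J int0_itv0 subr0 => h; apply: le_trans h _.
have I2 := sqi_itg2 sB.
have h1 : J (fun t => (d n t - dv t) ^+ 2) 0 x <= int0 L (fun t => (d n t - dv t) ^+ 2).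
  by apply: int0_sub_ge0 => // t _; exact: sqr_ge0.
have h2 := HN2 n n2; rewrite ler_pdivlMr// in h2.
have h3 : 0 <= J (fun t => (d n t - dv t) ^+ 2) 0 x.
  by apply: (@J_ge0 _ L) => // t _ _; exact: sqr_ge0.
nra.
Qed.

End Completeness.

(** * Wirtinger's inequality *)

Section Wirtinger.
Variable R : realType.
Implicit Types (L x y c e w s : R) (f g u v du dv F t : R -> R).
Notation mu := (@lebesgue_measure R).
Local Notation sqi := (@sq_integrable R).

(** For integrands controlled only inside the interval: the indicator in [is_wderiv_clamp] vanishes
    at both end points. *)
Lemma J_ge0_oo L f x y : itg L f -> 0 <= x -> x <= y -> y <= L ->
  (forall z, x < z < y -> 0 <= f z) -> 0 <= J f x y.
Proof.
move=> If; rewrite le_eqVlt => /orP[/eqP<-|x0] xy yL f0.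
  by apply: (@J_ge0 _ L) => // z z0 /andP[_ zy]; apply: f0; exact/andP.
rewrite (J_itv If)// -Rintegral_itv_obnd_cbnd; last first.
  apply: integrableS If => // z /=; rewrite !in_itv/= => /andP[xz zy].
  by rewrite (lt_trans x0 xz) (lt_le_trans zy yL).
by apply: Rintegral_ge0 => z /=; rewrite in_itv/= => zxy; exact: f0.
Qed.

Lemma Rint_C1 (a b : R) F f : a <= b ->
  (forall x, a <= x <= b -> is_derive x 1 F (f x)) ->
  (forall x, a <= x <= b -> {for x, continuous f}) ->
  \int[mu]_(x in `]a, b[) f x = F b - F a.
Proof.
rewrite le_eqVlt => /orP[/eqP<- _ _|ab dF cf].
  by rewrite set_itv_ge ?bnd_simp ?ltxx// Rintegral_set0 subrr.
have cfw : {within `[a, b], continuous f}.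
  by apply: continuous_in_subspaceT => x; rewrite inE/= in_itv/= => /cf.
have cF x : a <= x <= b -> {for x, continuous F}.
  by move=> /dF[dx _]; apply: differentiable_continuous; exact/derivable1_diffP.
have If : mu.-integrable `[a, b] (EFin \o f).
  by apply: continuous_compact_integrable => //; exact: segment_compact.
have := @continuous_FTC2 R f F a b ab cfw.
have H1 : derivable_oo_LRcontinuous F a b.
  split.
  - by move=> x; rewrite in_itv/= => /andP[ax xb]; have [] := dF x; rewrite ?ltW.
  - by apply: cvg_at_right_filter; apply: cF; rewrite lexx ltW.
  - by apply: cvg_at_left_filter; apply: cF; rewrite lexx ltW.
have H2 : {in `]a, b[, F^`()%classic =1 f}.
  move=> x; rewrite in_itv/= => /andP[ax xb]; rewrite derive1E.
  by have [|_] := dF x; rewrite ?ltW.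
move=> /(_ H1 H2) E.
have If' : mu.-integrable `]a, b[ (EFin \o f).
  by apply: integrableS If => //; exact: subset_itv_oo_cc.
rewrite Rintegral_itv_bndo_bndc// Rintegral_itv_obnd_cbnd; last first.
  apply: integrableS If => // z /=; rewrite !in_itv/= => /andP[az zb].
  by rewrite ltW.
by rewrite /Rintegral E.
Qed.

(** The projection of the line onto [a, b]. Composition with it extends a function that is smooth on
    [a, b] by constants, so that it has a weak derivative on all of (0, L) and the product rule
    applies to it. *)
Definition clamp (a b x : R) := Order.max a (Order.min x b).

Lemma is_wderiv_clamp L (a b : R) F f : 0 <= a -> a <= b -> b <= L ->
  (forall x, a <= x <= b -> is_derive x 1 F (f x)) ->
  (forall x, a <= x <= b -> {for x, continuous f}) ->
  is_wderiv L (fun x => F (clamp a b x)) (fun x => f x * \1_(`]a, b[%classic) x).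
Proof.
move=> a0 ab bL dF cf.
have cfw : {within `[a, b], continuous f}.
  by apply: continuous_in_subspaceT => x; rewrite inE/= in_itv/= => /cf.
have mf : measurable_fun `]a, b[ f.
  apply: measurable_funS (subspace_continuous_measurable_fun (measurable_itv _) cfw) => //.
  exact: subset_itv_oo_cc.
have E : (fun x => f x * \1_(`]a, b[%classic) x) = f \_ `]a, b[%classic.
  apply/funext => x; rewrite patchE indicE; case: ifP => _; first by rewrite mulr1.
  by rewrite mulr0.
have [B hB] : exists B, forall x, a < x < b -> `|f x| <= B.
  have cn : {within `[a, b], continuous (fun x => `|f x|)}.
    by move=> x; apply: (@cvg_comp _ _ _ _ (fun z : R => `|z|)); [exact: cfw|exact: norm_continuous].
  have [c _ Hc] := EVT_max ab cn; exists `|f c| => x /andP[ax xb].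
  by apply: Hc; rewrite in_itv/= !ltW.
have B0 x : a < x < b -> 0 <= B by move=> /hB; exact: le_trans.
rewrite E; split.
  apply: (@bounded_sqi _ _ _ `|B|).
    apply/measurable_restrict => //; apply: measurable_funS mf => //.
  move=> x _; rewrite patchE; case: ifP => [|_]; last by rewrite normr0.
  by rewrite inE/= in_itv/= => /hB h; apply: le_trans h _; exact: ler_norm.
move=> y; rewrite in_itv/= => /andP[y0 yL].
rewrite /int0 -Rintegral_mkcondr.
have -> : clamp a b 0 = a.
  rewrite /clamp; apply/max_idPl; rewrite ge_min a0//.
have [ya|ay] := leP y a.
  rewrite (_ : _ `&` _ = set0) ?Rintegral_set0//; last first.
    rewrite -subset0 => z /=; rewrite !in_itv/= => -[/andP[_ zy] /andP[az _]].
    by have := lt_trans (lt_le_trans zy ya) az; rewrite ltxx.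
  rewrite addr0; congr F; apply/max_idPl; rewrite ge_min ya//.
have -> : clamp a b y = Order.min y b.
  by apply/max_idPr; rewrite le_min ltW.
set m := Order.min y b.
have mb : m <= b by rewrite ge_min lexx orbT.
have am : a <= m by rewrite le_min ltW.
rewrite (_ : _ `&` _ = `]a, m[%classic); last first.
  apply/seteqP; split => z /=; rewrite !in_itv/= /m lt_min.
    by move=> [/andP[_ ->] /andP[-> ->]].
  by move=> /and3P[az zy zb]; rewrite zy az zb (le_lt_trans a0 az).
have -> : \int[mu]_(x in `]a, m[) f x = F m - F a; last by ring.
apply: Rint_C1 => //.
  by move=> x /andP[ax xm]; apply: dF; rewrite ax (le_trans xm mb).
by move=> x /andP[ax xm]; apply: cf; rewrite ax (le_trans xm mb).
Qed.

(* (u^2 t)' = 2 u u' t + u^2 t' <= u'^2 - w^2 u^2. *)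
Lemma riccati_lower_bound L (a b w : R) u du t : 0 <= L -> is_wderiv L u du ->
  0 <= a -> a <= b -> b <= L ->
  (forall x, a <= x <= b -> is_derive x 1 t (- w ^+ 2 - t x ^+ 2)) ->
  u b ^+ 2 * t b - u a ^+ 2 * t a <= J (fun x => du x ^+ 2 - w ^+ 2 * u x ^+ 2) a b.
Proof.
move=> L0 Du a0 ab bL dt.
have cdt x : a <= x <= b -> {for x, continuous (fun x => - w ^+ 2 - t x ^+ 2)}.
  move=> /dt[dx _].
  have ct : {for x, continuous t}.
    by apply: differentiable_continuous; exact/derivable1_diffP.
  apply: cvgB; first exact: cvg_cst.
  rewrite expr2; under eq_fun do rewrite expr2.
  exact: cvgM.
have Dt := is_wderiv_clamp a0 ab bL dt cdt.
have Dg := is_wderivM L0 (is_wderivM L0 Du Du) Dt.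
have := is_wderiv_J Dg a0 ab bL.
have -> : clamp a b b = b.
  by rewrite /clamp minxx; apply/max_idPr.
have -> : clamp a b a = a by rewrite /clamp; apply/max_idPl; rewrite ge_min lexx.
rewrite !expr2 => ->.
have su := is_wderiv_sqi_fun L0 Du.
have I1 := itgB (sqi_itg2 (is_wderiv_sqi Du)) (itgZ (w ^+ 2) (sqi_itg2 su)).
rewrite -subr_ge0 -(JB I1 (is_wderiv_itg Dg))//.
apply: (J_ge0_oo (itgB I1 (is_wderiv_itg Dg))) => // x /andP[ax xb].
have -> : clamp a b x = x.
  by rewrite /clamp (min_idPl _) ?ltW//; apply/max_idPr; exact: ltW.
rewrite indicE mem_set/= ?in_itv/= ?ax// mulr1.
have := sqr_ge0 (du x - u x * t x); lra.
Qed.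

Lemma tan_riccati (w s x : R) : cos (w * (x - s)) != 0 ->
  is_derive x 1 (fun x => - w * tan (w * (x - s)))
    (- w ^+ 2 - (- w * tan (w * (x - s))) ^+ 2).
Proof.
move=> c0.
have d1 : is_derive x 1 (fun x => w * (x - s)) w.
  have -> : (fun x => w * (x - s)) = (w \*: (fun x => x - s)) by [].
  by apply: is_derive_eq; rewrite subr0 /GRing.scale/= mulr1.
have d2 := is_derive_tan c0.
have d3 := @is_derive1_comp R tan (fun x => w * (x - s)) x _ _ d2 d1.
have -> : (fun x => - w * tan (w * (x - s))) = ((- w) \*: (tan \o (fun x => w * (x - s)))) by [].
apply: is_derive_eq; rewrite /GRing.scale/= exprMn.
have := cos2_tan2 c0; rewrite -[(_ ^- 2)]/((cos (w * (x - s)) ^+ 2)^-1) => ->.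
ring.
Qed.

Lemma cos_half_neq0 (z : R) : `|z| < pi / 2 -> cos z != 0.
Proof.
by rewrite ltr_norml => /andP[h1 h2]; rewrite gt_eqF// cos_gt0_pihalf// h1 h2.
Qed.

(* Choose c with u c = u (c + pi) and put g = u - u c.  On the intervals cut by c and
   c + pi, t = - w tan (w (x - s)) with s suitably shifted solves the Riccati equation
   without poles as w < 1, and the boundary terms g^2 t cancel. *)
Lemma wirtinger_lt1 (w : R) u du : 0 < w -> w < 1 -> is_wderiv (2 * pi) u du ->
  u (2 * pi) = u 0 -> int0 (2 * pi) u = 0 ->
  w ^+ 2 * int0 (2 * pi) (fun x => u x ^+ 2) <= int0 (2 * pi) (fun x => du x ^+ 2).
Proof.
move=> w0 w1 Du uper umean.
have p0 : 0 < (pi : R) := pi_gt0 R.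
set L := 2 * pi in Du uper umean *.
have L0 : 0 <= L by rewrite /L; lra.
have LE : L = 2 * pi by [].
pose M := int0 L (fun x => du x ^+ 2).
have M0 : 0 <= M by apply: int0_ge0 => t _; exact: sqr_ge0.
(* By periodicity [u x - u (x + pi)] takes opposite values at 0 and at [pi]. *)
have [c cI cE] : exists2 c, c \in `[0, pi] & u c - u (c + pi) = 0.
  apply: (@IVT R (fun x => u x - u (x + pi))); first exact: ltW.
    apply: (@hoelder_continuous _ _ (4 * M)); first lra.
    move=> x y /andP[x0 xp] /andP[y0 yp].
    have h1 : (u y - u x) ^+ 2 <= `|y - x| * M.
      by apply: (is_wderiv_hoelder_abs Du); apply/andP; split; lra.
    have h2 : (u (y + pi) - u (x + pi)) ^+ 2 <= `|y - x| * M.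
      have -> : y - x = (y + pi) - (x + pi) by ring.
      by apply: (is_wderiv_hoelder_abs Du); apply/andP; split; lra.
    move: h1 h2; set z := `|_| * M; set p := u y - u x; set q := u (y + pi) - _.
    have -> : u y - u (y + pi) - (u x - u (x + pi)) = p - q by rewrite /p /q; ring.
    rewrite (_ : `|y - x| * (4 * M) = 4 * z); last by rewrite /z; ring.
    have := sqr_ge0 (p + q); nra.
  rewrite add0r (_ : pi + pi = L); last by rewrite LE; ring.
  rewrite uper -(opprB (u 0)); case: (leP 0 (u 0 - u pi)) => h.
    by rewrite ge_min le_max oppr_le0 h orbT.
  by rewrite ge_min le_max oppr_ge0 (ltW h) orbT.
move: cI; rewrite in_itv/= => /andP[c0 cp].
pose m := u c.
pose g x := u x - m.
have Dg : is_wderiv L g du.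
  have := is_wderiv_lin 1 (- m) Du (is_wderiv_cst L 1).
  by congr (is_wderiv L); apply/funext => x; rewrite /g; ring.
have gc : g c = 0 by rewrite /g subrr.
have gcp : g (c + pi) = 0 by rewrite /g /m; lra.
pose t s x := - w * tan (w * (x - s)).
have dt s a b : s - pi / 2 <= a -> b <= s + pi / 2 ->
    forall x, a <= x <= b -> is_derive x 1 (t s) (- w ^+ 2 - t s x ^+ 2).
  move=> ha hb x /andP[ax xb]; apply: tan_riccati; apply: cos_half_neq0.
  rewrite normrM gtr0_norm//.
  have : `|x - s| <= pi / 2 by rewrite ler_norml; apply/andP; split; lra.
  have := normr_ge0 (x - s); nra.
(* Each centre is within [pi / 2] of every point of its interval, so the argument of the tangent
   stays below [pi / 2] in modulus. The first and last centres differ by a full period, which makes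
   the boundary terms at 0 and at [L] cancel; at [c] and [c + pi] the function [g] vanishes. *)
have B1 := @riccati_lower_bound L 0 c w g du (t (c - pi / 2)) L0 Dg (lexx 0) c0.
have B2 := @riccati_lower_bound L c (c + pi) w g du (t (c + pi / 2)) L0 Dg c0.
have B3 := @riccati_lower_bound L (c + pi) L w g du (t (c + 3 * pi / 2)) L0 Dg.
have cL : c <= L by lra.
have cpL : c + pi <= L by lra.
have ccp : c <= c + pi by lra.
have cp0 : 0 <= c + pi by lra.
have {}B1 := B1 cL (@dt (c - pi / 2) 0 c _ _).
have {}B2 := B2 ccp cpL (@dt (c + pi / 2) c (c + pi) _ _).
have {}B3 := B3 cp0 cpL (lexx _) (@dt (c + 3 * pi / 2) (c + pi) L _ _).
have {}B1 : _ := B1 (ltac:(lra)) (ltac:(lra)).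
have {}B2 : _ := B2 (ltac:(lra)) (ltac:(lra)).
have {}B3 : _ := B3 (ltac:(lra)) (ltac:(lra)).
move: B1 B2 B3; rewrite gc gcp expr0n/= !mul0r.
have -> : g L = g 0 by rewrite /g uper.
have -> : t (c + 3 * pi / 2) L = t (c - pi / 2) 0.
  by rewrite /t; congr (_ * tan (_ * _)); rewrite LE; lra.
move=> B1 B2 B3.
have := lerD (lerD B1 B2) B3; rewrite !J_cat => HJ.
have {HJ} : 0 <= J (fun x => du x ^+ 2 - w ^+ 2 * g x ^+ 2) 0 L.
  by apply: le_trans HJ; rewrite le_eqVlt; apply/orP; left; apply/eqP; ring.
rewrite /J int0_itv0 subr0.
have sg := is_wderiv_sqi_fun L0 Dg; have su := is_wderiv_sqi_fun L0 Du.
rewrite int0B; [|exact: sqi_itg2 (is_wderiv_sqi Du)|exact: itgZ (sqi_itg2 sg)].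
rewrite int0Z; last exact: sqi_itg2.
(* Mean zero kills the cross term, so that subtracting the constant [m] can only increase the L_2
   norm. *)
have -> : int0 L (fun x => g x ^+ 2) = int0 L (fun x => u x ^+ 2) + m ^+ 2 * L.
  transitivity (int0 L (fun x => u x ^+ 2 + ((- 2 * m) * u x + m ^+ 2))).
    by apply: eq_int0 => x _; rewrite /g; ring.
  rewrite int0D; [|exact: sqi_itg2|exact: itgD (itgZ _ (sqi_itg su)) (itg_cst _ _)].
  rewrite int0D; [|exact: itgZ (sqi_itg su)|exact: itg_cst].
  by rewrite int0Z ?umean ?int0_cst//; [ring|exact: sqi_itg].
have : 0 <= w ^+ 2 * (m ^+ 2 * L) by rewrite mulr_ge0 ?sqr_ge0// mulr_ge0 ?sqr_ge0.
lra.
Qed.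

End Wirtinger.

(** * Semi-inner products *)

Section ComplexModulus.
Variable R : realType.
Implicit Types (z w : R[i]).
Local Notation Re := complex.Re.
Local Notation Im := complex.Im.

(** The squared modulus: real-valued, whereas [|z|] lies in [R[i]], and polynomial, so that no
    square root enters the estimates. *)
Definition cn2 z : R := Re z ^+ 2 + Im z ^+ 2.

Lemma complexP z w : Re z = Re w -> Im z = Im w -> z = w.
Proof. by case: z w => [a b] [c d] /= -> ->. Qed.

Lemma ReD z w : Re (z + w) = Re z + Re w. Proof. by case: z w => [a b] [c d]. Qed.
Lemma ImD z w : Im (z + w) = Im z + Im w. Proof. by case: z w => [a b] [c d]. Qed.
Lemma ReN z : Re (- z) = - Re z. Proof. by case: z. Qed.
Lemma ImN z : Im (- z) = - Im z. Proof. by case: z. Qed.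
Lemma ReB z w : Re (z - w) = Re z - Re w. Proof. by rewrite ReD ReN. Qed.
Lemma ImB z w : Im (z - w) = Im z - Im w. Proof. by rewrite ImD ImN. Qed.
Lemma ReM z w : Re (z * w) = Re z * Re w - Im z * Im w.
Proof. by case: z w => [a b] [c d]. Qed.
Lemma ImM z w : Im (z * w) = Re z * Im w + Im z * Re w.
Proof. by case: z w => [a b] [c d]. Qed.
Lemma ReC (x : R) : Re x%:C = x. Proof. by []. Qed.
Lemma ImC (x : R) : Im x%:C = 0. Proof. by []. Qed.
Lemma Re_conj z : Re (Num.conj z) = Re z. Proof. by case: z. Qed.
Lemma Im_conj z : Im (Num.conj z) = - Im z. Proof. by case: z. Qed.
Lemma Re0 : Re (0 : R[i]) = 0. Proof. by []. Qed.
Lemma Im0 : Im (0 : R[i]) = 0. Proof. by []. Qed.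
Lemma Re1 : Re (1 : R[i]) = 1. Proof. by []. Qed.
Lemma Im1 : Im (1 : R[i]) = 0. Proof. by []. Qed.

Definition ReImE := (ReD, ImD, ReN, ImN, ReM, ImM, ReC, ImC, Re_conj, Im_conj,
  Re0, Im0, Re1, Im1).

Lemma Re_sum I (s : seq I) (P : pred I) (F : I -> R[i]) :
  Re (\sum_(i <- s | P i) F i) = \sum_(i <- s | P i) Re (F i).
Proof. by apply: (big_morph (@complex.Re R)); [exact: ReD|exact: Re0]. Qed.

Lemma conj_sum I (s : seq I) (P : pred I) (F : I -> R[i]) :
  Num.conj (\sum_(i <- s | P i) F i) = \sum_(i <- s | P i) Num.conj (F i).
Proof. exact: rmorph_sum. Qed.

Lemma conj_real (x : R) : Num.conj (x%:C : R[i]) = x%:C.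
Proof. by apply: complexP; rewrite !ReImE ?oppr0. Qed.

Lemma cn2_ge0 z : 0 <= cn2 z. Proof. by rewrite addr_ge0 ?sqr_ge0. Qed.

Lemma cn2M z w : cn2 (z * w) = cn2 z * cn2 w.
Proof. rewrite /cn2 !ReImE; ring. Qed.

Lemma cn2_conj z : cn2 (Num.conj z) = cn2 z.
Proof. by rewrite /cn2 !ReImE sqrrN. Qed.

Lemma cn2N z : cn2 (- z) = cn2 z.
Proof. by rewrite /cn2 !ReImE !sqrrN. Qed.

Lemma cn2_real (x : R) : cn2 x%:C = x ^+ 2.
Proof. by rewrite /cn2 !ReImE expr0n addr0. Qed.

Lemma cn2_eq0 z : cn2 z = 0 -> z = 0.
Proof.
rewrite /cn2 => /eqP; rewrite paddr_eq0 ?sqr_ge0// !sqrf_eq0 => /andP[/eqP a /eqP b].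
exact: complexP.
Qed.

Lemma cn2_00 : cn2 0 = 0. Proof. by rewrite /cn2 !ReImE expr0n addr0. Qed.

Lemma mulz_conj z : z * Num.conj z = (cn2 z)%:C.
Proof. by apply: complexP; rewrite !ReImE /cn2; ring. Qed.

Lemma cn2D_le z w : cn2 (z + w) <= 2 * cn2 z + 2 * cn2 w.
Proof.
rewrite /cn2 !ReImE; have := sqr_ge0 (Re z - Re w); have := sqr_ge0 (Im z - Im w); nra.
Qed.

Lemma Re_sqr_le z : Re z ^+ 2 <= cn2 z.
Proof. by rewrite lerDl sqr_ge0. Qed.

Lemma normcE z : `|z| = (Num.sqrt (cn2 z))%:C.
Proof. by case: z. Qed.

(** A crude constant from iterating [cn2D_le]; it only has to be finite, for the boundedness of a
    matrix in [mulmx_bound]. *)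
Lemma cn2_sum_le n (F : 'I_n -> R[i]) :
  cn2 (\sum_i F i) <= 2 ^+ n * \sum_i cn2 (F i).
Proof.
elim: n F => [|n IH] F; first by rewrite !big_ord0 cn2_00 mulr0.
rewrite !big_ord_recl; apply: le_trans (cn2D_le _ _) _.
rewrite exprS -mulrA -mulrDr ler_wpM2l// mulrDr; apply: lerD; last exact: IH.
by rewrite ler_peMl ?cn2_ge0// exprn_ege1//; lra.
Qed.

End ComplexModulus.

Section SemiInnerProduct.
Variables (R : realType) (E : lmodType R[i]).
Local Notation Re := complex.Re.
Local Notation Im := complex.Im.
Local Notation C := R[i].

(* Null vectors are allowed: the elements of S are functions, not classes. *)
Record semi_ip (S : set E) (f : E -> E -> C) : Prop := SemiIp {
  sip0 : S 0;
  sipP : forall (a : C) u v, S u -> S v -> S (a *: u + v);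
  sip_lin : forall (a : C) u v w, S u -> S v -> S w ->
    f (a *: u + v) w = a * f u w + f v w;
  sip_conj : forall u v, S u -> S v -> f v u = Num.conj (f u v);
  sip_ge0 : forall u, S u -> 0 <= Re (f u u) }.

Variables (S : set E) (f : E -> E -> C).
Hypothesis Sf : semi_ip S f.
Definition N2 u := Re (f u u).

Lemma sipZ (a : C) u : S u -> S (a *: u).
Proof. by move=> Su; rewrite -[_ *: _]addr0; apply: (sipP Sf) => //; exact: sip0 Sf. Qed.
Lemma sipD u v : S u -> S v -> S (u + v).
Proof. by move=> Su Sv; rewrite -[u]scale1r; exact: (sipP Sf). Qed.
Lemma sipB u v : S u -> S v -> S (u - v).
Proof. by move=> Su Sv; rewrite addrC -scaleN1r; exact: (sipP Sf). Qed.
Lemma sip_sum I (s : seq I) (P : pred I) (F : I -> E) : (forall i, P i -> S (F i)) ->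
  S (\sum_(i <- s | P i) F i).
Proof. by move=> H; apply: big_ind => //; [exact: sip0 Sf|exact: sipD]. Qed.

Lemma sip_Zl (a : C) u w : S u -> S w -> f (a *: u) w = a * f u w.
Proof.
move=> Su Sw; have := sip_lin Sf a Su (sip0 Sf) Sw; rewrite addr0 => ->.
have := sip_lin Sf 0 (sip0 Sf) (sip0 Sf) Sw; rewrite scale0r addr0 mul0r add0r.
have := sip_lin Sf 1 (sip0 Sf) (sip0 Sf) Sw.
rewrite scale1r addr0 mul1r => /eqP; rewrite -subr_eq0 opprD addrA subrr sub0r oppr_eq0 => /eqP ->.
by rewrite addr0.
Qed.

Lemma sip_Dl u v w : S u -> S v -> S w -> f (u + v) w = f u w + f v w.
Proof. by move=> Su Sv Sw; rewrite -[u in LHS]scale1r (sip_lin Sf)// mul1r. Qed.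
Lemma sip_Bl u v w : S u -> S v -> S w -> f (u - v) w = f u w - f v w.
Proof. by move=> Su Sv Sw; rewrite addrC -scaleN1r (sip_lin Sf)// mulN1r addrC. Qed.
Lemma sip_0l w : S w -> f 0 w = 0.
Proof. by move=> Sw; rewrite -(scale0r (0 : E)) sip_Zl ?mul0r//; exact: sip0 Sf. Qed.

Lemma sip_Zr (a : C) u w : S u -> S w -> f w (a *: u) = Num.conj a * f w u.
Proof.
move=> Su Sw; rewrite (sip_conj Sf (sipZ a Su) Sw) sip_Zl// rmorphM/=.
by rewrite -(sip_conj Sf Su Sw).
Qed.
Lemma sip_Dr u v w : S u -> S v -> S w -> f w (u + v) = f w u + f w v.
Proof.
move=> Su Sv Sw; rewrite (sip_conj Sf (sipD Su Sv) Sw) sip_Dl// rmorphD/=.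
by rewrite -(sip_conj Sf Su Sw) -(sip_conj Sf Sv Sw).
Qed.
Lemma sip_Br u v w : S u -> S v -> S w -> f w (u - v) = f w u - f w v.
Proof.
move=> Su Sv Sw; rewrite (sip_conj Sf (sipB Su Sv) Sw) sip_Bl// rmorphB/=.
by rewrite -(sip_conj Sf Su Sw) -(sip_conj Sf Sv Sw).
Qed.
Lemma sip_suml I (s : seq I) (P : pred I) (F : I -> E) w : (forall i, P i -> S (F i)) ->
  S w -> f (\sum_(i <- s | P i) F i) w = \sum_(i <- s | P i) f (F i) w.
Proof.
move=> H Sw; elim: s => [|i s IH]; first by rewrite !big_nil sip_0l.
rewrite !big_cons; case: ifP => // Pi; rewrite sip_Dl ?IH//; first exact: H.
exact: sip_sum.
Qed.
Lemma sip_sumr I (s : seq I) (P : pred I) (F : I -> E) w : (forall i, P i -> S (F i)) ->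
  S w -> f w (\sum_(i <- s | P i) F i) = \sum_(i <- s | P i) f w (F i).
Proof.
move=> H Sw; rewrite (sip_conj Sf _ Sw) ?sip_suml//; last exact: sip_sum.
by rewrite conj_sum; apply: eq_bigr => i Pi; rewrite -(sip_conj Sf _ Sw)//; exact: H.
Qed.

Lemma sip_Im u : S u -> Im (f u u) = 0.
Proof.
move=> Su; have /(congr1 (@complex.Im R)) := sip_conj Sf Su Su; rewrite Im_conj; lra.
Qed.

Lemma sip_real u : S u -> f u u = (N2 u)%:C.
Proof. by move=> Su; apply: complexP; rewrite ?sip_Im. Qed.

Lemma N2_ge0 u : S u -> 0 <= N2 u. Proof. exact: (sip_ge0 Sf). Qed.

Lemma N2Z (a : C) u : S u -> N2 (a *: u) = cn2 a * N2 u.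
Proof.
move=> Su; rewrite /N2 sip_Zl//; last exact: sipZ.
rewrite sip_Zr// mulrA mulz_conj sip_real//.
by rewrite !ReImE mul0r subr0.
Qed.

Lemma sipN u : S u -> S (- u).
Proof. by rewrite -scaleN1r; exact: sipZ. Qed.

Lemma sip_Nl u w : S u -> S w -> f (- u) w = - f u w.
Proof. by move=> Su Sw; rewrite -scaleN1r sip_Zl// mulN1r. Qed.

Lemma N2N u : S u -> N2 (- u) = N2 u.
Proof. by move=> Su; rewrite -scaleN1r N2Z// cn2N cn2_real expr1n mul1r. Qed.

Lemma N2D u v : S u -> S v -> N2 (u + v) = N2 u + N2 v + 2 * Re (f u v).
Proof.
move=> Su Sv; rewrite /N2 sip_Dl ?sip_Dr//; last exact: sipD.
rewrite (sip_conj Sf Su Sv) !ReImE; ring.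
Qed.

Lemma N2B u v : S u -> S v -> N2 (u - v) = N2 u + N2 v - 2 * Re (f u v).
Proof.
move=> Su Sv; rewrite /N2 sip_Bl ?sip_Br//; last exact: sipB.
rewrite (sip_conj Sf Su Sv) !ReImE; ring.
Qed.

Lemma N2_parallelogram u v : S u -> S v -> N2 (u + v) + N2 (u - v) = 2 * N2 u + 2 * N2 v.
Proof. by move=> Su Sv; rewrite N2D// N2B//; ring. Qed.

Lemma N2D_le u v : S u -> S v -> N2 (u + v) <= 2 * N2 u + 2 * N2 v.
Proof. by move=> Su Sv; rewrite -N2_parallelogram// lerDl N2_ge0//; exact: sipB. Qed.

Lemma sip_CS u v : S u -> S v -> cn2 (f u v) <= N2 u * N2 v.
Proof.
move=> Su Sv; set a := f u v; set c := cn2 a.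
have c0 : 0 <= c by exact: cn2_ge0.
(* Scaling [u] by a real multiple of the conjugate of [f u v] makes the cross term real, namely
   [t * c]. The discriminant then carries a spare factor [c], divided out at the end. *)
have : c ^+ 2 <= (c * N2 u) * N2 v.
  apply: discriminant_le => t.
  have := N2_ge0 (sipD (sipZ (t%:C * Num.conj a) Su) Sv).
  rewrite N2D//; last exact: sipZ.
  rewrite N2Z// cn2M cn2_real cn2_conj -/c sip_Zl// -/a.
  have -> : Re (t%:C * Num.conj a * a) = t * c.
    by rewrite -mulrA [_^* * _]mulrC mulz_conj !ReImE mul0r subr0.
  move=> H; apply: le_trans H _; rewrite le_eqVlt; apply/orP; left; apply/eqP; ring.
move: c0; rewrite le_eqVlt => /orP[/eqP<- _|c0].
  by rewrite mulr_ge0// N2_ge0.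
by rewrite expr2 -mulrA ler_pM2l.
Qed.

Lemma sip_Re_le u v (e : R) : 0 < e -> S u -> S v ->
  2 * Re (f u v) <= e * N2 u + e^-1 * N2 v.
Proof.
move=> e0 Su Sv; have Si := N2_ge0 (sipB (sipZ e%:C Su) Sv).
move: Si; rewrite N2B//; last exact: sipZ.
rewrite N2Z// cn2_real sip_Zl// ReM ReC ImC mul0r subr0 => Si.
have : 0 <= e^-1 * (e ^+ 2 * N2 u + N2 v - 2 * (e * Re (f u v))).
  by rewrite mulr_ge0// invr_ge0 ltW.
have -> : e^-1 * (e ^+ 2 * N2 u + N2 v - 2 * (e * Re (f u v))) =
  e * N2 u + e^-1 * N2 v - 2 * Re (f u v) by field; lra.
lra.
Qed.

End SemiInnerProduct.

(** * Riesz representation and Neumann series in a complete semi-inner product space *)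

Section RieszNeumann.
Variables (R : realType) (E : lmodType R[i]) (S : set E) (f : E -> E -> R[i]).
Local Notation Re := complex.Re.
Local Notation Im := complex.Im.
Local Notation C := R[i].
Hypothesis Sf : semi_ip S f.
Local Notation N := (N2 f).

Definition sip_cauchy (u : nat -> E) := forall e : R, 0 < e ->
  exists n0, forall m n, (n0 <= m)%N -> (n0 <= n)%N -> N (u m - u n) <= e.
Definition sip_cvg (u : nat -> E) v := forall e : R, 0 < e ->
  exists n0, forall n, (n0 <= n)%N -> N (u n - v) <= e.

Hypothesis complete : forall u : nat -> E, (forall n, S (u n)) -> sip_cauchy u ->
  exists2 v, S v & sip_cvg u v.

Definition bounded_linear (lam : E -> C) :=
  (forall (a : C) u v, S u -> S v -> lam (a *: u + v) = a * lam u + lam v) /\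
  exists B, forall u, S u -> cn2 (lam u) <= B * N u.

Lemma invn_small (e : R) : 0 < e -> exists n0 : nat, forall n, (n0 <= n)%N -> n.+1%:R^-1 <= e.
Proof.
move=> e0; exists (Num.truncn e^-1) => n n0n.
rewrite invf_ple ?posrE ?ltr0n//; apply/ltW; apply: lt_le_trans (truncnS_gt _) _.
by rewrite ler_nat.
Qed.

Lemma le_eps (a b c : R) : 0 <= c -> (forall e, 0 < e -> e <= 1 -> a <= b + c * e) -> a <= b.
Proof.
move=> c0 H; apply/ler_addgt0Pr => e e0.
pose d := Order.min 1 (e / (c + 1)).
have d0 : 0 < d by rewrite lt_min ltr01/= divr_gt0//; lra.
have d1 : d <= 1 by rewrite ge_min lexx.
apply: le_trans (H _ d0 d1) _; rewrite lerD2l.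
have : d <= e / (c + 1) by rewrite ge_min lexx orbT.
rewrite ler_pdivlMr; last lra.
nra.
Qed.

(* The representative minimises N u - 2 Re (lam u). *)
Lemma riesz (lam : E -> C) : bounded_linear lam ->
  exists2 u, S u & forall v, S v -> f v u = lam v.
Proof.
case=> lin [B0 Hlam0].
pose B := `|B0|; have Bge : 0 <= B by exact: normr_ge0.
have Hlam u : S u -> cn2 (lam u) <= B * N u.
  by move=> Su; apply: le_trans (Hlam0 _ Su) _; rewrite ler_wpM2r ?ler_norm// (N2_ge0 Sf).
have lamD u v : S u -> S v -> lam (u + v) = lam u + lam v.
  by move=> Su Sv; rewrite -[u in LHS]scale1r lin// mul1r.
have lam0 : lam 0 = 0.
  have := lin 1 _ _ (sip0 Sf) (sip0 Sf); rewrite scale1r addr0 mul1r.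
  by move=> /eqP; rewrite -subr_eq0 opprD addrA subrr sub0r oppr_eq0 => /eqP.
have lamZ (a : C) u : S u -> lam (a *: u) = a * lam u.
  by move=> Su; rewrite -[_ *: _]addr0 lin ?lam0 ?addr0//; exact: (sip0 Sf).
pose Q u := N u - 2 * Re (lam u).
have lamRe u (e : R) : 0 < e -> S u -> `|2 * Re (lam u)| <= e^-1 * B * N u + e.
  move=> e0 Su; have h1 := Re_sqr_le (lam u); have h2 := Hlam _ Su.
  have h3 : Re (lam u) ^+ 2 <= B * N u by exact: le_trans h2.
  have h4 : (e - `|Re (lam u)|) ^+ 2 >= 0 by exact: sqr_ge0.
  rewrite normrM ger0_norm//; set r := `|_| in h4 *.
  have h5 : r ^+ 2 <= B * N u by rewrite real_normK ?num_real.
  have -> : e^-1 * B * N u + e = e^-1 * (B * N u + e ^+ 2) by field; lra.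
  rewrite [leRHS]mulrC ler_pdivlMr//; nra.
have Qlb u : S u -> - (B + 1) <= Q u.
  move=> Su; have B1 : 0 < B + 1 by lra.
  have := lamRe u _ B1 Su; rewrite ler_norml => /andP[_]; rewrite /Q.
  have := N2_ge0 Sf Su => Nu.
  have : (B + 1)^-1 * B * N u <= N u.
    by rewrite ler_piMl// mulrC ler_pdivrMr// mul1r; lra.
  lra.
pose V := [set Q u | u in S].
have V0 : V !=set0 by exists (Q 0), 0 => //; exact: sip0 Sf.
have Vlb : has_lbound V by exists (- (B + 1)) => _ [u Su <-]; exact: Qlb.
pose d := inf V.
have Qd u : S u -> d <= Q u by move=> Su; apply: ge_inf => //; exists u.
have /choice[w Hw] : forall n : nat, exists u, S u /\ Q u <= d + n.+1%:R^-1.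
  move=> n; have n0 : 0 < n.+1%:R^-1 :> R by rewrite invr_gt0 ltr0n.
  have [_ [u Su <-] /ltW h] := inf_adherent n0 (conj V0 Vlb).
  by exists u.
have Sw n : S (w n) by case: (Hw n).
have Qw n : Q (w n) <= d + n.+1%:R^-1 by case: (Hw n).
(* The parallelogram law: the midpoint of two near-minimisers competes for the infimum, so a
   minimising sequence is Cauchy. *)
have key m n : N (w m - w n) <= 2 * m.+1%:R^-1 + 2 * n.+1%:R^-1.
  have := N2_parallelogram Sf (Sw m) (Sw n).
  have Sm : S ((2^-1 : R)%:C *: (w m + w n)) by apply: (sipZ Sf); exact: (sipD Sf).
  have := Qd _ Sm; rewrite /Q (N2Z Sf); last exact: (sipD Sf).
  rewrite lamZ; last exact: (sipD Sf).
  rewrite lamD// cn2_real !ReImE mul0r subr0.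
  have := Qw m; have := Qw n; rewrite /Q.
  move: (N (w m)) (N (w n)) (N (w m + w n)) (N (w m - w n)) => a b c e'.
  move: (Re (lam (w m))) (Re (lam (w n))) (m.+1%:R^-1) (n.+1%:R^-1) => x y z t.
  have -> : (2^-1 : R) ^+ 2 = 4^-1 by field.
  lra.
have [v Sv wv] : exists2 v, S v & sip_cvg w v.
  apply: complete => // e e0.
  have [n0 Hn0] := @invn_small (e / 4) (ltac:(lra)).
  exists n0 => m n mn nn; apply: le_trans (key m n) _.
  have := Hn0 _ mn; have := Hn0 _ nn.
  move: (m.+1%:R^-1) (n.+1%:R^-1) => x y; lra.
exists v => //.
have Qv : Q v <= d.
  pose c := 2 + N v + B.
  have Nv := N2_ge0 Sf Sv.
  apply: (@le_eps _ _ (N v + B + 3)); first lra.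
  move=> e e0 e1.
  have [n1 Hn1] := invn_small e0.
  have [n2 Hn2] := wv _ (exprn_gt0 2 e0).
  pose n := maxn n1 n2.
  have h1 := Hn1 n (leq_maxl _ _); have h2 := Hn2 n (leq_maxr _ _).
  have Sd : S (w n - v) by exact: (sipB Sf).
  have Ewn : w n = v + (w n - v) by rewrite addrC subrK.
  have := Qw n; rewrite {1}Ewn /Q (N2D Sf)// lamD// ReD.
  have h3 := N2_ge0 Sf Sd.
  have := @sip_Re_le _ _ _ _ Sf (- v) (w n - v) e e0 (sipN Sf Sv) Sd.
  rewrite (N2N Sf)// (sip_Nl Sf)// ReN => h4.
  have := lamRe _ _ e0 Sd; rewrite ler_norml => /andP[_ h5].
  have h6 : e^-1 * N (w n - v) <= e.
    by rewrite mulrC ler_pdivrMr// -expr2.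
  have h7 : e^-1 * B * N (w n - v) <= B * e.
    by rewrite mulrAC mulrC ler_wpM2l.
  have h8 : 2 * Re (lam (w n - v)) <= B * e + e by exact: le_trans h5 (lerD h7 (lexx _)).
  move: h1 h4 h6 h3; rewrite mulrDr => h1 h4 h6 h3 h9.
  have h10 : 2 * (Re (lam v) + Re (lam (w n - v))) = 2 * Re (lam v) + 2 * Re (lam (w n - v)) by rewrite mulrDr.
  move: h9 h8 h4 h6 h1; rewrite -mulrDr h10.
  move: (Re (lam v)) (Re (lam _)) (N (w n - v)) h3 (Re (f _ _)) (N v) Nv => x y z z0 q k k0.
  move: (n.+1%:R^-1) => ni; move: (e^-1 * z) => ez h9 h8 h4 h6 h1.
  have -> : (k + B + 3) * e = e * k + B * e + 3 * e by ring.
  lra.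
move=> z Sz.
(* In the direction [a *: z] the first variation of [Q] at [v] is twice the squared modulus of the
   defect [f z v - lam z], and [Q] does not fall below its value at [v]. The discriminant bound with
   last coefficient 0 makes the defect vanish. *)
pose a := Num.conj (f z v - lam z).
have : cn2 (f z v - lam z) ^+ 2 <= (cn2 a * N z) * 0.
  apply: discriminant_le => t.
  have := Qd _ (sipD Sf (sipZ Sf (t%:C * a) Sz) Sv).
  rewrite /Q (N2D Sf)//; last exact: (sipZ Sf).
  rewrite lamD// ?lamZ//; last exact: (sipZ Sf).
  rewrite (N2Z Sf)// (sip_Zl Sf)// cn2M cn2_real ReD.
  move=> h.
  have EE : Re (t%:C * a * f z v) - Re (t%:C * a * lam z) = t * cn2 (f z v - lam z).
    rewrite -ReB -mulrBr -mulrA /a [_^* * _]mulrC mulz_conj !ReImE; ring.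
  move: Qv h; rewrite /Q; move: EE; move: (Re (_ * f z v)) (Re (_ * lam z)) => p q EE.
  have -> : cn2 a * N z * t ^+ 2 + 2 * cn2 (f z v - lam z) * t + 0 =
    t ^+ 2 * cn2 a * N z + 2 * (t * cn2 (f z v - lam z)) by ring.
  rewrite -EE; lra.
rewrite mulr0 => h; have /eqP : cn2 (f z v - lam z) ^+ 2 = 0.
  by apply/eqP; rewrite eq_le h sqr_ge0.
rewrite sqrf_eq0 => /eqP/cn2_eq0/eqP; rewrite subr_eq0 => /eqP//.
Qed.

Variables (g : E -> E -> C) (zeta : C).
Hypothesis Sg : semi_ip S g.
(** The square of [|zeta| * N2 g u <= N u / 2], which makes the iteration contract. *)
Hypothesis gf : forall u, S u -> 4 * cn2 zeta * N2 g u ^+ 2 <= N u ^+ 2.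
Hypothesis gf1 : forall u, S u -> N2 g u <= N u.

(* Iterates the map sending w to the solution u of f v u = lam v + zeta g v w, which
   contracts N by 1/4. *)
Lemma neumann (lam : E -> C) : bounded_linear lam ->
  exists2 u, S u & forall v, S v -> f v u - zeta * g v u = lam v.
Proof.
case=> lin [B Hlam].
have sol w : exists u, S w -> S u /\ forall v, S v -> f v u = lam v + zeta * g v w.
  case: (pselect (S w)) => [Sw|nSw]; last by exists 0.
  have [|u Su Hu] := @riesz (fun v => lam v + zeta * g v w); last by exists u.
  split; first by move=> a u v Su Sv; rewrite lin// (sip_lin Sg)//; ring.
  exists (2 * B + 2 * (cn2 zeta * N2 g w)) => u Su.
  apply: le_trans (cn2D_le _ _) _; rewrite [leRHS]mulrDl; apply: lerD.
    by rewrite -mulrA ler_wpM2l// Hlam.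
  rewrite -mulrA ler_wpM2l// cn2M -mulrA ler_wpM2l ?cn2_ge0//.
  apply: le_trans (sip_CS Sg Su Sw) _.
  by rewrite mulrC ler_wpM2l ?(N2_ge0 Sg)// gf1.
have [T HT] := choice sol.
pose u n := iter n T 0.
have Su n : S (u n).
  by elim: n => [|n IH]; [exact: sip0 Sf|exact: (HT _ IH).1].
have uE n v : S v -> f v (u n.+1) = lam v + zeta * g v (u n).
  by move=> Sv; exact: (HT _ (Su n)).2.
have contr m n : N (u m.+1 - u n.+1) <= 4^-1 * N (u m - u n).
  set x := u m.+1 - u n.+1; set y := u m - u n.
  have Sx : S x by exact: (sipB Sf). have Sy : S y by exact: (sipB Sf).
  (* Cauchy-Schwarz for [g] bounds [N x ^+ 2] by [cn2 zeta * (N2 g x * N2 g y)]; the hypothesis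
     [gf], at [x] and at [y], turns this into [4 * N x ^+ 2 <= N x * N y]. *)
  have Ex : f x x = zeta * g x y.
    by rewrite {2}/x (sip_Br Sf)// !uE// /y (sip_Br Sg)//; ring.
  have h1 : N x ^+ 2 <= cn2 zeta * (N2 g x * N2 g y).
    apply: (@le_trans _ _ (cn2 (f x x))); first exact: Re_sqr_le.
    by rewrite Ex cn2M ler_wpM2l ?cn2_ge0// (sip_CS Sg).
  have h2 := gf Sx; have h3 := gf Sy.
  have Nx := N2_ge0 Sf Sx; have Ny := N2_ge0 Sf Sy.
  have Gx := N2_ge0 Sg Sx; have Gy := N2_ge0 Sg Sy.
  have h4 : (4 * (cn2 zeta * (N2 g x * N2 g y))) ^+ 2 <= (N x * N y) ^+ 2.
    have -> : (4 * (cn2 zeta * (N2 g x * N2 g y))) ^+ 2 =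
      (4 * cn2 zeta * N2 g x ^+ 2) * (4 * cn2 zeta * N2 g y ^+ 2) by ring.
    rewrite exprMn; apply: ler_pM => //; rewrite !mulr_ge0 ?cn2_ge0 ?sqr_ge0//.
  rewrite ler_pXn2r ?nnegrE ?mulr_ge0 ?cn2_ge0// in h4.
  have h5 : 4 * N x ^+ 2 <= N x * N y by lra.
  move: Nx; rewrite le_eqVlt => /orP[/eqP<-|Nx]; first by rewrite mulr_ge0.
  have : N x * (4 * N x) <= N x * N y by lra.
  rewrite ler_pM2l//; lra.
pose D := N (u 1%N - u 0%N).
have D0 : 0 <= D by apply: (N2_ge0 Sf); exact: (sipB Sf).
have step n : N (u n.+1 - u n) <= 4^-1 ^+ n * D.
  elim: n => [|n IH]; first by rewrite expr0 mul1r.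
  by apply: le_trans (contr _ _) _; rewrite exprS -mulrA ler_wpM2l.
(* [N] is a squared seminorm, so splitting a difference costs a factor 2; the constant 4 solves
   [C = 2 * (C / 4) + 2]. *)
have tail k n : N (u (n + k)%N - u n) <= 4 * (4^-1 ^+ n * D).
  elim: k n => [|k IH] n.
    rewrite addn0 subrr (_ : N 0 = 0); last by rewrite /N2 (sip_0l Sf)//; exact: sip0 Sf.
    by rewrite !mulr_ge0// exprn_ge0.
  have -> : u (n + k.+1)%N - u n = (u (n.+1 + k)%N - u n.+1) + (u n.+1 - u n).
    by rewrite addrA subrK addSnnS.
  apply: le_trans (N2D_le Sf (sipB Sf (Su _) (Su _)) (sipB Sf (Su _) (Su _))) _.
  have := IH n.+1; have := step n; rewrite exprS -mulrA.
  move: (4^-1 ^+ n * D) => z; lra.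
have qcvg (e : R) : 0 < e -> exists n0, forall n, (n0 <= n)%N -> 4 * (4^-1 ^+ n * D) <= e.
  move=> e0; have [n0 Hn0] := @invn_small (e / (4 * (D + 1))) (ltac:(rewrite divr_gt0//; lra)).
  exists n0 => n nn; apply: (@le_trans _ _ (4 * (n.+1%:R^-1 * (D + 1)))).
    rewrite ler_wpM2l//; apply: ler_pM; [exact: exprn_ge0|exact: D0| |lra].
    rewrite exprVn lef_pV2 ?posrE ?ltr0n ?exprn_gt0//.
    by rewrite -natrX ler_nat; apply: ltn_expl.
  have := Hn0 _ nn; rewrite ler_pdivlMr; last lra.
  move: (n.+1%:R^-1) => z; lra.
have [v Sv uv] : exists2 v, S v & sip_cvg u v.
  apply: complete => // e e0; have [n0 Hn0] := @qcvg (e / 4) (ltac:(lra)).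
  exists n0 => m n mn nn.
  have -> : u m - u n = (u m - u n0) - (u n - u n0) by rewrite opprB addrA subrK.
  apply: le_trans (_ : _ <= 2 * N (u m - u n0) + 2 * N (u n - u n0)) _.
    rewrite -(N2_parallelogram Sf)//; try exact: (sipB Sf).
    by rewrite lerDr (N2_ge0 Sf)//; apply: (sipD Sf); exact: (sipB Sf).
  have := tail (m - n0)%N n0; have := tail (n - n0)%N n0; rewrite !subnKC//.
  have := Hn0 n0 (leqnn _); lra.
exists v => // w Sw.
have : cn2 (f w v - zeta * g w v - lam w) <= 0.
  have Nw := N2_ge0 Sf Sw.
  apply: (@le_eps _ _ (2 * N w + 2 * cn2 zeta * N w)).
    by rewrite addr_ge0 ?mulr_ge0 ?cn2_ge0.
  move=> e e0 _; have [n0 Hn0] := uv _ e0.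
  have h1 := Hn0 n0 (leqnn _); have h2 := Hn0 n0.+1 (leqnSn _).
  have -> : f w v - zeta * g w v - lam w = zeta * g w (u n0 - v) - f w (u n0.+1 - v).
    rewrite (sip_Br Sf)// (sip_Br Sg)// uE//; ring.
  have S0 : S (u n0 - v) by exact: (sipB Sf).
  have S1 : S (u n0.+1 - v) by exact: (sipB Sf).
  apply: le_trans (cn2D_le _ _) _; rewrite add0r cn2N cn2M addrC [leRHS]mulrDl.
  apply: lerD.
    rewrite -!mulrA ler_wpM2l//; apply: le_trans (sip_CS Sf Sw S1) _.
    by rewrite ler_wpM2l.
  rewrite -!mulrA ler_wpM2l// ler_wpM2l ?cn2_ge0//; apply: le_trans (sip_CS Sg Sw S0) _.
  apply: ler_pM; rewrite ?(N2_ge0 Sg)//; first exact: gf1.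
  by apply: le_trans (gf1 S0) _.
move=> h; have /cn2_eq0/eqP : cn2 (f w v - zeta * g w v - lam w) = 0.
  by apply/eqP; rewrite eq_le h cn2_ge0.
by rewrite subr_eq0 => /eqP.
Qed.

End RieszNeumann.

(** * Operators with compact resolvent *)

Lemma le_of_sqr_lt1 (R : realType) (x y : R) : (y - x) ^+ 2 < 1 -> y <= x + 1.
Proof. by move=> h3; rewrite leNgt; apply/negP => h4; nra. Qed.

Section LinearFunctional.
Variables (R : realType) (E : lmodType R[i]) (l : E -> R[i]).
Hypothesis l_lin : forall (b : R[i]) u v, l (b *: u + v) = b * l u + l v.

Lemma linear_funD u v : l (u + v) = l u + l v.
Proof. by rewrite -[u in LHS]scale1r l_lin mul1r. Qed.
Lemma linear_fun0 : l 0 = 0.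
Proof. by apply: (addrI (l 0)); rewrite -linear_funD !addr0. Qed.
Lemma linear_funZ (b : R[i]) u : l (b *: u) = b * l u.
Proof. by rewrite -[_ *: _]addr0 l_lin linear_fun0 addr0. Qed.

End LinearFunctional.

Section SpectralTheory.
Import finmap.
Variables (R : realType) (E : lmodType R[i]) (H Q : set E).
Variables (ip h : E -> E -> R[i]) (c : R).
Local Notation Re := complex.Re.
Local Notation Im := complex.Im.
Local Notation C := R[i].
Local Notation T := (form_operator H ip Q h).

Definition shifted u v := h u v + c%:C * ip u v.
Local Notation a := shifted.

Hypothesis Hip : semi_ip H ip.
Hypothesis QH : forall u, Q u -> H u.
Hypothesis Qa : semi_ip Q a.
Hypothesis acomplete : forall u : nat -> E, (forall n, Q (u n)) -> sip_cauchy a u ->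
    exists2 v, Q v & sip_cvg a u v.
Hypothesis compact_embedding : forall e : R, 0 < e -> exists m (l : 'I_m -> E -> C),
  [/\ forall i (b : C) u v, l i (b *: u + v) = b * l i u + l i v,
      exists B, forall i u, Q u -> cn2 (l i u) <= B * N2 a u
    & forall u, Q u -> N2 ip u <= e * N2 a u + \sum_i cn2 (l i u)].

Lemma sip_ipQ : semi_ip Q ip.
Proof.
split; [exact: sip0 Qa|exact: sipP Qa| | |].
- by move=> b u v w Qu Qv Qw; apply: (sip_lin Hip); exact: QH.
- by move=> u v Qu Qv; apply: (sip_conj Hip); exact: QH.
- by move=> u Qu; apply: (sip_ge0 Hip); exact: QH.
Qed.
Let Qip := sip_ipQ.

Lemma hnorm_N2 u : hnorm ip u = Num.sqrt (N2 ip u).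
Proof. by []. Qed.

Lemma hnorm_eq0 u : H u -> hnorm ip u = 0 -> N2 ip u = 0.
Proof.
move=> Hu /eqP; rewrite sqrtr_eq0 => h0; apply/eqP; rewrite eq_le h0/=.
exact: (N2_ge0 Hip).
Qed.

(** The unknown is moved to the second argument, where [riesz] and [neumann] expect it. The forms
    are linear in the first argument, hence the conjugate of the shifted spectral parameter. *)
Lemma eigenvectorE z u : T u (z *: u) <-> Q u /\ forall v, Q v -> a v u = Num.conj (z + c%:C) * ip v u.
Proof.
split=> [[Qu _ Hu]|[Qu Hu]].
  split => // v Qv; rewrite (sip_conj Qa Qu Qv) /shifted Hu//.
  rewrite (sip_Zl Hip); [|exact: QH|exact: QH].
  by rewrite -mulrDl rmorphM/= -(sip_conj Qip Qu Qv).
split => //; first by apply: (sipZ Hip); exact: QH.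
move=> v Qv; have := Hu v Qv; rewrite (sip_conj Qa Qu Qv) (sip_conj Qip Qu Qv) -rmorphM/=.
move=> /(inv_inj (@conjCK _)); rewrite /shifted mulrDl => /addIr ->.
by rewrite (sip_Zl Hip)//; exact: QH.
Qed.

Lemma operatorE z u f : H f -> T u (z *: u + f) <->
  Q u /\ forall v, Q v -> a v u = Num.conj (z + c%:C) * ip v u + ip v f.
Proof.
move=> Hf; split=> [[Qu _ Hu]|[Qu Hu]].
  split => // v Qv; rewrite (sip_conj Qa Qu Qv) /shifted Hu//.
  rewrite (sip_lin Hip) //; [|exact: QH|exact: QH].
  rewrite !rmorphD !rmorphM/= -(sip_conj Qip Qu Qv) -(sip_conj Hip Hf (QH Qv)).
  ring.
split => //; first by apply: (sipP Hip) => //; exact: QH.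
move=> v Qv; have := Hu v Qv.
rewrite (sip_conj Qa Qu Qv) (sip_conj Qip Qu Qv) (sip_conj Hip Hf (QH Qv)) -rmorphM -rmorphD/=.
move=> /(inv_inj (@conjCK _)); rewrite /shifted mulrDl.
rewrite (sip_lin Hip)//; [|exact: QH|exact: QH].
by move=> e; apply: (addIr (c%:C * ip u v)); rewrite e; ring.
Qed.

Section Penalised.
Variables (m : nat) (l : 'I_m -> E -> C) (B : R) (t : R).
Hypothesis t0 : 0 <= t.
Hypothesis l_lin : forall i (b : C) u v, l i (b *: u + v) = b * l i u + l i v.
Hypothesis lB : forall i u, Q u -> cn2 (l i u) <= B * N2 a u.

Definition penalised u v := a u v + t%:C * \sum_i l i u * Num.conj (l i v).
Local Notation p := penalised.

Lemma N2_penalised u : N2 p u = N2 a u + t * \sum_i cn2 (l i u).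
Proof.
rewrite /N2 /penalised ReD ReM ReC ImC mul0r subr0 Re_sum; congr (_ + _ * _).
by apply: eq_bigr => i _; rewrite mulz_conj.
Qed.

Lemma penalised_ge u : N2 a u <= N2 p u.
Proof. by rewrite N2_penalised lerDl mulr_ge0// sumr_ge0// => i _; exact: cn2_ge0. Qed.

Lemma sip_penalised : semi_ip Q p.
Proof.
split; [exact: sip0 Qa|exact: sipP Qa| | |].
- move=> b u v w Qu Qv Qw; rewrite /penalised (sip_lin Qa)//.
  have -> : \sum_i l i (b *: u + v) * Num.conj (l i w) =
     b * (\sum_i l i u * Num.conj (l i w)) + \sum_i l i v * Num.conj (l i w).
    rewrite mulr_sumr -big_split/=; apply: eq_bigr => i _; rewrite l_lin; ring.
  ring.
- move=> u v Qu Qv; rewrite /penalised rmorphD rmorphM/= conj_real conj_sum.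
  rewrite -(sip_conj Qa Qu Qv); congr (_ + _ * _); apply: eq_bigr => i _.
  by rewrite rmorphM/= conjCK mulrC.
- by move=> u Qu; apply: le_trans (penalised_ge u); exact: (N2_ge0 Qa).
Qed.

Lemma penalised_le u : Q u -> N2 p u <= (1 + t * (m%:R * B)) * N2 a u.
Proof.
move=> Qu; rewrite N2_penalised mulrDl mul1r lerD2l -mulrA ler_wpM2l//.
apply: (@le_trans _ _ (\sum_(i < m) B * N2 a u)).
  by apply: ler_sum => i _; exact: lB.
by rewrite sumr_const card_ord -mulrA mulr_natl.
Qed.

Lemma penalised_complete u : (forall n, Q (u n)) -> sip_cauchy p u ->
    exists2 v, Q v & sip_cvg p u v.
Proof.
move=> Qu cu; have [v Qv uv] : exists2 v, Q v & sip_cvg a u v.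
  apply: acomplete => // e e0; have [n0 Hn0] := cu e e0; exists n0 => i j ii jj.
  by apply: le_trans (penalised_ge _) _; exact: Hn0.
exists v => // e e0.
pose K := `|1 + t * (m%:R * B)| + 1.
have K0 : 0 < K by rewrite ltr_wpDl.
have [n0 Hn0] := uv (e / K) (divr_gt0 e0 K0); exists n0 => n nn.
have Qn : Q (u n - v) by exact: (sipB Qa).
apply: le_trans (penalised_le Qn) _.
have := Hn0 _ nn; rewrite ler_pdivlMr// mulrC; apply: le_trans.
rewrite ler_wpM2r ?(N2_ge0 Qa)//; apply: le_trans (ler_norm _) _.
by rewrite lerDl.
Qed.
End Penalised.

Lemma mulmx_bound n (A : 'M[C]_n) : exists2 K, 0 <= K & forall b : 'rV[C]_n,
  \sum_i cn2 ((b *m A) 0 i) <= K * \sum_j cn2 (b 0 j).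
Proof.
pose A2 := \sum_j \sum_i cn2 (A j i).
have A20 : 0 <= A2 by apply: sumr_ge0 => j _; apply: sumr_ge0 => i _; exact: cn2_ge0.
exists (2 ^+ n * A2) => [|b]; first by rewrite mulr_ge0// exprn_ge0.
apply: (@le_trans _ _ (\sum_i 2 ^+ n * \sum_j cn2 (b 0 j) * cn2 (A j i))).
  apply: ler_sum => i _; rewrite mxE; apply: le_trans (cn2_sum_le _) _.
  by rewrite ler_wpM2l ?exprn_ge0//; apply: ler_sum => j _; rewrite cn2M.
rewrite -mulr_sumr -mulrA ler_wpM2l ?exprn_ge0// exchange_big/=.
rewrite mulr_sumr; apply: ler_sum => j _; rewrite -mulr_sumr mulrC ler_wpM2r ?cn2_ge0//.
rewrite /A2 [leRHS](bigD1 j)//= lerDl; apply: sumr_ge0 => k _; apply: sumr_ge0 => i _; exact: cn2_ge0.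
Qed.

(* A solution has the form gf + t sum_j b_j g_j, where gf and g_j solve the penalised
   problem with right-hand sides <., f> and l_j, and b_j = l_j u; this determines b
   by a linear system with matrix A.  A kernel vector of A yields an eigenvector. *)
Lemma fredholm z : ~ is_eigenvalue ip T z -> resolvent_set H ip T z.
Proof.
move=> nz.
pose zeta : C := Num.conj (z + c%:C).
pose s := Num.sqrt (cn2 zeta).
have s0 : 0 <= s by exact: sqrtr_ge0.
have s2 : s ^+ 2 = cn2 zeta by rewrite sqr_sqrtr// cn2_ge0.
(* With precision [t^-1] the compact embedding reads [t * N2 ip u <= N2 p u]. From [t >= 2 * s] and
   [t >= 1] follow the two smallness hypotheses of [neumann]. *)
have [t tE] : {t : R | t = 2 * s + 2} by exists (2 * s + 2).
have t0 : 0 < t by rewrite tE; lra.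
have tV0 : 0 < t^-1 by rewrite invr_gt0.
have [m [l [l_lin [B0 lB0] lC]]] := compact_embedding tV0.
pose B := `|B0|.
have Bge : 0 <= B by exact: normr_ge0.
have lB i u : Q u -> cn2 (l i u) <= B * N2 a u.
  by move=> Qu; apply: le_trans (lB0 i u Qu) _; rewrite ler_wpM2r ?ler_norm// (N2_ge0 Qa).
pose p := penalised l t.
have Qp : semi_ip Q p by apply: sip_penalised => //; exact: ltW.
have pge u : Q u -> N2 a u <= N2 p u by move=> _; apply: penalised_ge; exact: ltW.
have pip u : Q u -> t * N2 ip u <= N2 p u.
  move=> Qu; rewrite N2_penalised; have := lC u Qu.
  rewrite -(ler_pM2l t0) mulrDr mulrA divff ?gt_eqF// mul1r//.
have pip1 u : Q u -> N2 ip u <= N2 p u.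
  move=> Qu; apply: le_trans (pip u Qu); rewrite ler_peMl ?(N2_ge0 Qip)// tE; lra.
have pipz u : Q u -> 4 * cn2 zeta * N2 ip u ^+ 2 <= N2 p u ^+ 2.
  move=> Qu; have h1 := pip u Qu; have h2 := N2_ge0 Qip Qu.
  rewrite -s2; have -> : 4 * s ^+ 2 * N2 ip u ^+ 2 = (2 * s * N2 ip u) ^+ 2 by ring.
  rewrite ler_pXn2r// ?nnegrE.
  - by apply: le_trans h1; rewrite ler_wpM2r// tE; lra.
  - by rewrite !mulr_ge0.
  - by apply: (N2_ge0 Qp).
have solve := @neumann R E Q p Qp (penalised_complete (ltW t0) lB) ip zeta Qip pipz pip1.
have llin i : bounded_linear Q p (l i).
  split; first by move=> b u v _ _; exact: l_lin.
  exists B => u Qu; apply: le_trans (lB i u Qu) _.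
  by rewrite ler_wpM2l// pge.
have /choice[g Hg] : forall i, exists u, Q u /\ forall v, Q v -> p v u - zeta * ip v u = l i v.
  by move=> i; have [u Qu Hu] := solve _ (llin i); exists u.
have Qg i : Q (g i) by case: (Hg i).
have gE i v : Q v -> p v (g i) - zeta * ip v (g i) = l i v by case: (Hg i) => _; exact.
have flin f : H f -> bounded_linear Q p (fun v => ip v f).
  move=> Hf; split; first by move=> b u v Qu Qv; apply: (sip_lin Hip) => //; exact: QH.
  exists (N2 ip f) => u Qu; apply: le_trans (sip_CS Hip (QH Qu) Hf) _.
  by rewrite mulrC ler_wpM2l ?(N2_ge0 Hip)// pip1.
have l0 i := linear_fun0 (l_lin i).
have lD i := linear_funD (l_lin i).
have lZ i := linear_funZ (l_lin i).
have lsum i (F : 'I_m -> E) : l i (\sum_j F j) = \sum_j l i (F j).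
  by apply: (big_morph (l i)); [exact: lD|exact: l0].
pose A : 'M[C]_m := \matrix_(j, i) ((j == i)%:R - t%:C * l i (g j)).
pose comb (b : 'rV[C]_m) := t%:C *: \sum_j b 0 j *: g j.
have Qcomb (b : 'rV[C]_m) : Q (comb b).
  by apply: (sipZ Qa); apply: (sip_sum Qa) => j _; exact: (sipZ Qa).
have lcomb (b : 'rV[C]_m) i : b 0 i - l i (comb b) = (b *m A) 0 i.
  rewrite mxE lZ lsum mulr_sumr.
  transitivity (\sum_j b 0 j * (j == i)%:R - \sum_j t%:C * l i (b 0 j *: g j)).
    congr (_ - _); rewrite (bigD1 i)//= eqxx mulr1 big1 ?addr0// => j /negbTE ->.
    by rewrite mulr0.
  rewrite -sumrB; apply: eq_bigr => j _; rewrite mxE lZ; ring.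
have pcomb (b : 'rV[C]_m) v : Q v -> p v (comb b) - zeta * ip v (comb b) = t%:C * \sum_j l j v * Num.conj (b 0 j).
  move=> Qv; have Qs j : Q (b 0 j *: g j) by exact: (sipZ Qa).
  have Qss : Q (\sum_j b 0 j *: g j) by exact: (sip_sum Qa).
  rewrite (sip_Zr Qp)// (sip_Zr Qip)// (sip_sumr Qp)// (sip_sumr Qip)//.
  rewrite conj_real mulrCA -mulrBr; congr (_ * _).
  rewrite mulr_sumr -sumrB; apply: eq_bigr => j _.
  by rewrite (sip_Zr Qp)// (sip_Zr Qip)// -(gE j v Qv); ring.
have pE u v : p v u = a v u + t%:C * \sum_i l i v * Num.conj (l i u) by [].
have An : A \in unitmx.
  rewrite unitmxE unitfE; apply/negP => /det0P[b b0 bA]; apply: nz.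
  have lb i : l i (comb b) = b 0 i.
    by have := lcomb b i; rewrite bA mxE => /eqP; rewrite subr_eq0 => /eqP.
  exists (comb b).
  have Te : T (comb b) (z *: comb b).
    apply/eigenvectorE; split => // v Qv; rewrite -/zeta.
    have := pcomb b v Qv; rewrite pE.
    under eq_bigr do rewrite lb.
    move=> e; apply/eqP; rewrite -subr_eq0; apply/eqP.
    by apply/(addIr (t%:C * (\sum_i l i v * Num.conj (b 0 i)))); rewrite add0r -[RHS]e; ring.
  (* [comb b] is not a null vector: otherwise its form vanishes by the eigenvalue equation, then so
     do the bounded functionals [l i (comb b) = b 0 i], against [b != 0]. *)
  split => //; apply/negP => /eqP/(hnorm_eq0 (QH (Qcomb b))) ip0.
  have /eigenvectorE[_ /(_ _ (Qcomb b))] := Te.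
  rewrite (sip_real Qip)// ip0 mulr0 => a0.
  have N0 : N2 a (comb b) = 0 by rewrite /N2 a0.
  case/negP: b0; apply/eqP/rowP => i; rewrite mxE -lb; apply: cn2_eq0.
  by apply/eqP; rewrite eq_le cn2_ge0 andbT; have := lB i _ (Qcomb b); rewrite N0 mulr0.
split.
- move=> f Hf; have [gf Qgf gfE] := solve _ (flin f Hf).
  pose b : 'rV[C]_m := (\row_i l i gf) *m invmx A.
  have bE i : b 0 i = l i (gf + comb b).
    have bA : b *m A = \row_i l i gf by rewrite /b mulmxKV.
    by rewrite lD; have := lcomb b i; rewrite bA [RHS]mxE => /eqP; rewrite subr_eq => /eqP.
  have Qu : Q (gf + comb b) by exact: (sipD Qa).
  exists (gf + comb b); apply/operatorE => //; split => // v Qv.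
  have e1 := gfE v Qv; have e2 := pcomb b v Qv.
  have e3 := pE (gf + comb b) v; move: e3.
  under eq_bigr do rewrite -bE.
  rewrite (sip_Dr Qp)//  (sip_Dr Qip)// -/zeta => e3.
  have -> : a v (gf + comb b) =
      p v gf + p v (comb b) - t%:C * (\sum_i l i v * Num.conj (b 0 i)) by rewrite e3; ring.
  by rewrite -e1 -e2; ring.
- by move=> u Tu; apply: contrapT => /eqP hu; apply: nz; exists u.
have [K K0 HK] := mulmx_bound (invmx A).
(* 4 bounds [N2 p gf] by [N2 ip f], [B] bounds each of the [m] functionals, and [K] bounds the
   inverse matrix: together they control the penalty term of [u] by [f]. *)
pose C1 := 1 + t * (K * (m%:R * (B * 4))).
exists (Num.sqrt (4 * C1)) => u f Hf /(operatorE _ _ Hf)[Qu Hu].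
have [gf Qgf gfE] := solve _ (flin f Hf).
have Nf0 := N2_ge0 Hip Hf.
(* Coercivity: by the choice of [t] the spectral term is at most half of [p]. *)
have coer w : Q w -> N2 p w <= 2 * Re (p w w - zeta * ip w w).
  move=> Qw; have h1 := pipz w Qw; have N0 := N2_ge0 Qp Qw.
  have : Re (zeta * ip w w) <= N2 p w / 2.
    apply: le_trans (ler_norm _) _.
    rewrite -(@ler_pXn2r _ 2)// ?nnegrE ?divr_ge0// real_normK ?num_real//.
    apply: le_trans (Re_sqr_le _) _; rewrite cn2M (sip_real Qip)// cn2_real expr_div_n.
    rewrite ler_pdivlMr ?exprn_gt0//; lra.
  by rewrite ReB -/(N2 p w); lra.
have gfN : N2 p gf <= 4 * N2 ip f.
  have := coer _ Qgf; rewrite gfE//.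
  have := @sip_Re_le _ _ _ _ Hip gf f 2^-1 (ltac:(lra)) (QH Qgf) Hf.
  rewrite invrK; have := pip1 _ Qgf; lra.
(* The defect in the representation of [u] solves the homogeneous penalised problem. Coercivity
   makes it null, so the functionals vanish on it, and this is the linear system for the values
   [l i u]. *)
pose w := u - gf - comb (\row_i l i u).
have Qw : Q w by apply: (sipB Qa) => //; exact: (sipB Qa).
have Qugf : Q (u - gf) by exact: (sipB Qa).
have pw : p w w - zeta * ip w w = 0.
  rewrite {2 4}/w (sip_Br Qp)// (sip_Br Qip)// (sip_Br Qp)// (sip_Br Qip)//.
  have e1 := gfE w Qw; have e2 := pcomb (\row_i l i u) w Qw; have e3 := Hu w Qw.
  have e4 := pE u w; rewrite e3 -/zeta in e4.
  have e5 : t%:C * (\sum_j l j w * Num.conj ((\row_i l i u) 0 j)) = t%:C * (\sum_j l j w * Num.conj (l j u)).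
    by congr (_ * _); apply: eq_bigr => j _; rewrite mxE.
  rewrite e5 in e2.
  have -> : p w u - p w gf - p w (comb (\row_i l i u)) - zeta * (ip w u - ip w gf - ip w (comb (\row_i l i u))) =
    (p w u - zeta * ip w u) - (p w gf - zeta * ip w gf) -
    (p w (comb (\row_i l i u)) - zeta * ip w (comb (\row_i l i u))) by ring.
  rewrite e1 e2 e4; ring.
have Nw : N2 p w <= 0 by have := coer _ Qw; rewrite pw Re0 mulr0.
have lw i : l i w = 0.
  apply: cn2_eq0; apply/eqP; rewrite eq_le cn2_ge0 andbT.
  apply: le_trans (lB i w Qw) _; rewrite mulr_ge0_le0//.
  by apply: le_trans (pge w Qw) _.
have lu : (\row_i l i u) *m A = \row_i l i gf.
  apply/rowP => i; rewrite -lcomb !mxE.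
  have := lw i; rewrite /w -[- gf]scaleN1r -[- comb _]scaleN1r !lD !lZ => /eqP.
  move=> e; apply/eqP; rewrite -subr_eq0; apply: etrans e; congr (_ == _); ring.
have luE : \row_i l i u = (\row_i l i gf) *m invmx A by rewrite -lu mulmxK.
have lbound : \sum_i cn2 (l i u) <= K * (m%:R * (B * 4)) * N2 ip f.
  have := HK (\row_i l i gf); rewrite -luE.
  under eq_bigr do rewrite mxE.
  under [X in _ <= _ * X]eq_bigr do rewrite mxE.
  move=> h1; apply: le_trans h1 _; rewrite -mulrA ler_wpM2l//.
  apply: (@le_trans _ _ (\sum_(i < m) (B * 4) * N2 ip f)).
    apply: ler_sum => i _; apply: le_trans (lB i _ Qgf) _; rewrite -mulrA ler_wpM2l//.
    by apply: le_trans gfN; exact: pge.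
  by rewrite sumr_const card_ord -[leLHS]mulr_natl mulrA.
have fin : N2 ip u <= 4 * C1 * N2 ip f.
  have h1 := coer _ Qu.
  have e4 := pE u u; rewrite Hu// -/zeta in e4.
  move: h1; rewrite e4.
  have -> : zeta * ip u u + ip u f + t%:C * (\sum_i l i u * Num.conj (l i u)) - zeta * ip u u
    = ip u f + t%:C * (\sum_i l i u * Num.conj (l i u)) by ring.
  rewrite ReD ReM ReC ImC mul0r subr0 Re_sum.
  under eq_bigr do rewrite mulz_conj ReC.
  have h2 := @sip_Re_le _ _ _ _ Hip u f 2^-1 (ltac:(lra)) (QH Qu) Hf.
  move: h2; rewrite invrK => h2 h1.
  have h3 := pip1 _ Qu.
  have h4 : t * \sum_i cn2 (l i u) <= t * (K * (m%:R * (B * 4)) * N2 ip f) by rewrite ler_pM2l.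
  have h5 : 4 * C1 * N2 ip f = 4 * N2 ip f + 4 * (t * (K * (m%:R * (B * 4)) * N2 ip f)).
    by rewrite /C1; ring.
  rewrite h5; lra.
rewrite !hnorm_N2 -sqrtrM; first by apply: ler_wsqrtr.
have : 0 <= t * (K * (m%:R * (B * 4))) by rewrite !mulr_ge0// ltW.
rewrite /C1; lra.
Qed.

Definition orthonormal (I : finType) (us : I -> E) :=
  forall i j, ip (us i) (us j) = (i == j)%:R.

Lemma eigen_real z u : T u (z *: u) -> N2 ip u != 0 -> Im z = 0.
Proof.
move=> /eigenvectorE[Qu Hu] u0; have := Hu u Qu.
rewrite (sip_real Qa)// (sip_real Qip)// => /(congr1 (@complex.Im R)).
rewrite !ReImE mulr0 add0r addr0 => /esym/eqP.
by rewrite mulf_eq0 (negbTE u0) orbF oppr_eq0 => /eqP.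
Qed.

Lemma eigen_orthogonal z w u v : T u (z *: u) -> T v (w *: v) -> Im z = 0 ->
  z != w -> ip u v = 0.
Proof.
move=> /eigenvectorE[Qu Hu] /eigenvectorE[Qv Hv] zr zw.
have := Hu v Qv; rewrite (sip_conj Qa Qu Qv) Hv// rmorphM/= conjCK -(sip_conj Qip Qu Qv).
have -> : Num.conj (z + c%:C) = z + c%:C by apply: complexP; rewrite !ReImE ?zr; ring.
move=> /eqP; rewrite -subr_eq0 -mulrBl mulf_eq0 => /orP[/eqP e|/eqP e].
  by move/eqP: zw; case; apply/esym/eqP; rewrite -subr_eq0; apply/eqP; rewrite -e; ring.
by rewrite (sip_conj Qip Qv Qu) e rmorph0.
Qed.

Lemma row_kernel (n m : nat) (M : 'M[C]_(n, m)) : (m < n)%N ->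
  exists2 b : 'rV[C]_n, b != 0 & b *m M = 0.
Proof.
move=> mn; have : kermx M != 0.
  rewrite kermx_eq0 /row_free neq_ltn; apply/orP; left.
  exact: leq_ltn_trans (rank_leq_col M) mn.
by move=> /rowV0Pn[b /sub_kermxP bM b0]; exists b.
Qed.

Lemma orthonormal_N2 n (us : 'I_n -> E) (b : 'rV[C]_n) : (forall i, H (us i)) ->
  orthonormal us -> N2 ip (\sum_i b 0 i *: us i) = \sum_i cn2 (b 0 i).
Proof.
move=> Hu ou; have Hb i : H (b 0 i *: us i) by exact: (sipZ Hip).
rewrite /N2 (sip_suml Hip)//; last exact: (sip_sum Hip).
rewrite Re_sum; apply: eq_bigr => i _; rewrite (sip_sumr Hip)// (bigD1 i)//= big1 ?addr0.
  by rewrite (sip_Zl Hip)// (sip_Zr Hip)// ou eqxx mulr1 mulz_conj.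
move=> j ji; rewrite (sip_Zl Hip)// (sip_Zr Hip)// ou eq_sym (negbTE ji) /=.
by rewrite !mulr0.
Qed.

Lemma eigenvector_in_Q z u : T u (z *: u) -> Q u.
Proof. by case. Qed.

(* Among more than m orthonormal eigenvectors some combination is annihilated by the
   m functionals of the compact embedding. *)
Lemma eigen_count (Lam : R) : exists m : nat, forall n (us : 'I_n -> E) (z : 'I_n -> C),
  orthonormal us -> (forall i, T (us i) (z i *: us i)) ->
  (forall i, Re (z i) + c <= Lam) -> (n <= m)%N.
Proof.
(* For a combination killed by the functionals, [N2 ip u <= e * N2 a u] while
   [N2 a u <= Lam * N2 ip u]; this [e] makes the product of the two factors at most 1/2. *)
pose e := (2 * (`|Lam| + 1))^-1.
have L1 : 0 < `|Lam| + 1 by rewrite ltr_wpDl.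
have e0 : 0 < e by rewrite invr_gt0 mulr_gt0.
have [m [l [l_lin _ lC]]] := compact_embedding e0.
exists m => n us z ou Tu zL; rewrite leqNgt; apply/negP => mn.
have Qu i : Q (us i) by exact: eigenvector_in_Q (Tu i).
have [b b0 bM] := row_kernel (\matrix_(i, k) l k (us i)) mn.
pose u := \sum_i b 0 i *: us i.
have Qb i : Q (b 0 i *: us i) by exact: (sipZ Qa).
have QU : Q u by exact: (sip_sum Qa).
have l0 i := linear_fun0 (l_lin i).
have lD i := linear_funD (l_lin i).
have lu k : l k u = 0.
  rewrite /u (big_morph (l k) (lD k) (l0 k)).
  transitivity ((b *m \matrix_(i, k) l k (us i)) 0 k); last by rewrite bM mxE.
  rewrite mxE; apply: eq_bigr => i _.
  by rewrite mxE (linear_funZ (l_lin k)).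
have Nu : N2 ip u = \sum_i cn2 (b 0 i) by apply: orthonormal_N2 => // i; exact: QH.
have ipu i : ip u (us i) = b 0 i.
  rewrite (sip_suml Qip)// (bigD1 i)//= big1 ?addr0.
    by rewrite (sip_Zl Qip)// ou eqxx mulr1.
  by move=> j ji; rewrite (sip_Zl Qip)// ou (negbTE ji) mulr0.
have Na : N2 a u <= Lam * N2 ip u.
  rewrite {1}/N2 {2}/u (sip_sumr Qa)// Re_sum Nu mulr_sumr.
  apply: ler_sum => i _; rewrite (sip_Zr Qa)//.
  have /eigenvectorE[_ -> //] := Tu i.
  rewrite ipu mulrCA [_^* * b 0 i]mulrC mulz_conj.
  rewrite !ReImE mulr0 subr0 ler_wpM2r ?cn2_ge0//.
have := lC u QU; under eq_bigr do rewrite lu cn2_00.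
rewrite big1// addr0 => hh.
have N0 := N2_ge0 Qip QU.
have h2 : N2 ip u <= 2^-1 * N2 ip u.
  apply: le_trans hh _; apply: (@le_trans _ _ (e * ((`|Lam| + 1) * N2 ip u))).
    apply: ler_wpM2l; first exact: ltW.
    apply: (le_trans Na); apply: ler_wpM2r => //.
    by apply: le_trans (ler_norm _) _; rewrite lerDl.
  rewrite mulrA /e (_ : (2 * (`|Lam| + 1))^-1 * (`|Lam| + 1) = 2^-1)//; field; lra.
have : N2 ip u = 0 by lra.
rewrite Nu => /eqP; rewrite psumr_eq0 => [/allP s0|i _]; last exact: cn2_ge0.
case/negP: b0; apply/eqP/rowP => i; rewrite mxE; apply: cn2_eq0; apply/eqP.
by apply: s0; rewrite mem_index_enum.
Qed.

(** By counting instead of successive projection: while [k < n] vectors are found, the n by k matrix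
    of inner products has a row kernel. It gives a combination of all the [us] orthogonal to the
    vectors found, non-null by independence. *)
Lemma gram_schmidt (P : set E) n (us : 'I_n -> E) :
  (forall (b : C) u v, P u -> P v -> P (b *: u + v)) -> P 0 -> (forall u, P u -> H u) ->
  (forall i, P (us i)) -> lin_indep ip us ->
  forall k, (k <= n)%N -> exists vs : 'I_k -> E, (forall i, P (vs i)) /\ orthonormal vs.
Proof.
move=> Plin P0 PH Pu lu; elim=> [|k IH] kn.
  by exists (fun=> 0); split; case.
have [vs [Pv ov]] := IH (ltnW kn).
have [b b0 bM] := row_kernel (\matrix_(i, j) ip (us i) (vs j)) kn.
pose w := \sum_i b 0 i *: us i.
have PZ (d : C) u : P u -> P (d *: u) by move=> Pu'; rewrite -[_ *: _]addr0; exact: Plin.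
have PD u v : P u -> P v -> P (u + v) by move=> Pu' Pv'; rewrite -[u]scale1r; exact: Plin.
have Pb i : P (b 0 i *: us i) by exact: PZ.
have Pw : P w by apply: big_ind.
have Hw := PH _ Pw.
have wv j : ip w (vs j) = 0.
  rewrite (sip_suml Hip)//; [|by move=> i _; exact: PH|exact: PH].
  transitivity ((b *m \matrix_(i, j) ip (us i) (vs j)) 0 j); last by rewrite bM mxE.
  rewrite mxE; apply: eq_bigr => i _; rewrite mxE (sip_Zl Hip)//; exact: PH.
have Nw : N2 ip w != 0.
  apply/eqP => w0; case/negP: b0; apply/eqP/rowP => i; rewrite mxE.
  by apply: (lu (b 0)); rewrite hnorm_N2 -/w w0 sqrtr0.
have Nw0 : 0 < N2 ip w by rewrite lt_def Nw (N2_ge0 Hip).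
pose w1 := ((Num.sqrt (N2 ip w))^-1)%:C *: w.
have Pw1 : P w1 by exact: PZ.
have w1v j : ip w1 (vs j) = 0 by rewrite (sip_Zl Hip)// ?wv ?mulr0//; exact: PH.
have vw1 j : ip (vs j) w1 = 0.
  by rewrite (sip_conj Hip (PH _ Pw1) (PH _ (Pv j))) w1v rmorph0.
have w11 : ip w1 w1 = 1.
  rewrite (sip_real Hip); last exact: PH.
  by rewrite (N2Z Hip)// cn2_real exprVn sqr_sqrtr ?ltW// mulVf.
pose vs' (i : 'I_k.+1) := if unlift ord_max i is Some j then vs j else w1.
exists vs'; split => [i|i j]; first by rewrite /vs'; case: unlift.
rewrite /vs'; case: unliftP => [i' ->|->]; case: unliftP => [j' ->|->].
- by rewrite ov (inj_eq lift_inj).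
- by rewrite vw1 eq_sym (negbTE (neq_lift _ _)).
- by rewrite w1v (negbTE (neq_lift _ _)).
- by rewrite w11 eqxx.
Qed.

(** Independent eigenvectors can be made orthonormal within the eigenspace, and [eigen_count] bounds
    their number; the supremum of these natural numbers is thus a maximum. *)
Lemma multiplicity_attained z : exists n (vs : 'I_n -> E),
  [/\ multiplicity ip T z = n%:R%:E, forall i, T (vs i) (z *: vs i) & orthonormal vs].
Proof.
pose P := [set u | T u (z *: u)].
have P0 : P 0.
  apply/eigenvectorE; split; first exact: sip0 Qa.
  move=> v Qv; rewrite (sip_conj Qa (sip0 Qa) Qv) (sip_conj Qip (sip0 Qip) Qv).
  by rewrite (sip_0l Qa)// (sip_0l Qip)// rmorph0 mulr0.
have Plin (b : C) u v : P u -> P v -> P (b *: u + v).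
  move=> /eigenvectorE[Qu Hu] /eigenvectorE[Qv Hv]; apply/eigenvectorE.
  split; first exact: (sipP Qa).
  move=> w Qw; have Qbu : Q (b *: u) by exact: (sipZ Qa).
  by rewrite (sip_Dr Qa)// (sip_Dr Qip)// (sip_Zr Qa)// (sip_Zr Qip)// Hu// Hv//; ring.
have PH u : P u -> H u by move=> /eigenvector_in_Q; exact: QH.
pose D n := exists us : 'I_n -> E, (forall i, T (us i) (z *: us i)) /\ lin_indep ip us.
have D0 : D 0%N by exists (fun=> 0); split=> [[]//|c0 _ []].
have [m Hm] := eigen_count (Re z + c).
have GS n : D n -> exists vs : 'I_n -> E, (forall i, P (vs i)) /\ orthonormal vs.
  by move=> [us [Pu lu]]; exact: (gram_schmidt Plin P0 PH Pu lu).
have Db n : `[< D n >] -> (n <= m)%N.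
  by move=> /asboolP/GS[vs [Pv ov]]; apply: (Hm n vs (fun=> z)) => //.
have exD : exists n, `[< D n >] by exists 0%N; apply/asboolP.
have [n /asboolP Dn nmax] := ex_maxnP exD Db.
have [vs [Pv ov]] := GS n Dn.
exists n, vs; split => //; apply/eqP; rewrite eq_le; apply/andP; split.
  apply: ge_ereal_sup => _ [k Dk <-]; rewrite lee_fin ler_nat; apply: nmax; exact/asboolP.
by apply: ereal_sup_ubound; exists n.
Qed.

Lemma lin_indep_mult_spectrum z : spectrum H ip T z -> is_eigenvalue ip T z.
Proof. by move=> sz; apply: contrapT => /fredholm. Qed.

Lemma eigen_normalise z : is_eigenvalue ip T z ->
  exists u, T u (z *: u) /\ ip u u = 1.
Proof.
move=> [u [Tu nu]]; have /eigenvectorE[Qu Hu] := Tu.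
have N0 : N2 ip u != 0.
  by apply: contraNneq nu => N0; rewrite hnorm_N2 N0 sqrtr0.
have Ng : 0 <= N2 ip u by exact: (N2_ge0 Qip).
exists (((Num.sqrt (N2 ip u))^-1)%:C *: u); split.
  apply/eigenvectorE; split; first exact: (sipZ Qa).
  by move=> v Qv; rewrite (sip_Zr Qa)// (sip_Zr Qip)// Hu//; ring.
rewrite (sip_real Qip); last exact: (sipZ Qa).
by rewrite (N2Z Qip)// cn2_real exprVn sqr_sqrtr// mulVf.
Qed.

Lemma eigenvalue_real z : is_eigenvalue ip T z -> Im z = 0.
Proof.
move=> [u [Tu nu]]; apply: eigen_real Tu _.
by apply: contraNneq nu => N0; rewrite hnorm_N2 N0 sqrtr0.
Qed.

(** If [z] were not isolated, eigenvalues could be picked one after the other within distance 1 of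
    [z], each closer than all the earlier ones and hence new. Their normalised eigenvectors are
    orthogonal and contradict [eigen_count] at the level [Re z + 1 + c]. *)
Theorem discrete_spectrum_form_operator : discrete_spectrum H ip T.
Proof.
move=> z /lin_indep_mult_spectrum ez; split => //.
  by have [n [vs [-> _ _]]] := multiplicity_attained z; rewrite ltry.
apply: contrapT => ne.
have near_ev (d : R) : 0 < d -> exists w, [/\ is_eigenvalue ip T w, w != z & cn2 (w - z) < d ^+ 2].
  move=> d0; apply: contrapT => nw; apply: ne; exists d => // w sw wz.
  rewrite normcE lecR leNgt; apply/negP => lt_d; apply: nw; exists w; split => //.
    exact: lin_indep_mult_spectrum.
  have := lt_d; rewrite -(@ltr_pXn2r _ 2)// ?nnegrE ?sqrtr_ge0 ?(ltW d0)//.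
  by rewrite sqr_sqrtr ?cn2_ge0.
pose ok w := [/\ is_eigenvalue ip T w, w != z & cn2 (w - z) < 1].
have fam n : exists s : seq C, [/\ size s = n, uniq s & forall w, w \in s -> ok w].
  elim: n => [|n [s [ss us sok]]]; first by exists [::].
  have [d d0 [d1 ds]] : exists2 d : R, 0 < d & d <= 1 /\ forall w, w \in s -> d ^+ 2 <= cn2 (w - z).
    elim: s {ss us} sok => [|w s IH] sok; first by exists 1.
    have [|d d0 [d1 ds]] := IH; first by move=> x xs; apply: sok; rewrite inE xs orbT.
    have [_ wz _] := sok w (mem_head _ _).
    have w0 : 0 < Num.sqrt (cn2 (w - z)).
      rewrite sqrtr_gt0 lt_def cn2_ge0 andbT; apply: contraNneq wz => /cn2_eq0/eqP.
      by rewrite subr_eq0.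
    exists (Order.min d (Num.sqrt (cn2 (w - z)))); first by rewrite lt_min d0.
    split; first by rewrite ge_min d1.
    move=> x; rewrite inE => /orP[/eqP->|xs].
      rewrite -[leRHS]sqr_sqrtr ?cn2_ge0// ler_pXn2r// ?nnegrE ?sqrtr_ge0//.
        by rewrite ge_min lexx orbT.
      by rewrite le_min !ltW.
    apply: le_trans (ds x xs); rewrite ler_pXn2r// ?nnegrE ?(ltW d0)//.
      by rewrite ge_min lexx.
    by rewrite le_min !ltW.
  have [w [ew wz wd]] := near_ev d d0.
  exists (w :: s); split => /=; first by rewrite ss.
    rewrite us andbT; apply/negP => ws; have := ds w ws; rewrite leNgt wd//.
  move=> x; rewrite inE => /orP[/eqP->|/sok//]; split => //.
  apply: lt_le_trans wd _; apply: exprn_ile1 => //; exact: ltW.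
have [m Hm] := eigen_count (Re z + 1 + c).
have [s [ss us sok]] := fam m.+1.
have ev (i : 'I_m.+1) : exists u, T u (s`_i *: u) /\ ip u u = 1.
  by apply: eigen_normalise; have [] := sok s`_i; rewrite ?mem_nth ?ss.
have [v Hv] := choice ev.
suff : (m.+1 <= m)%N by rewrite ltnn.
apply: (Hm m.+1 v (fun i => s`_i)).
- move=> i j; have [->|ij] := eqVneq i j; first by case: (Hv j).
  apply: (eigen_orthogonal (Hv i).1 (Hv j).1).
    by apply: eigenvalue_real; have [] := sok s`_i; rewrite ?mem_nth ?ss.
  by rewrite nth_uniq ?ss.
- by move=> i; case: (Hv i).
- move=> i; rewrite lerD2r; have [|_ _] := sok s`_i; first by rewrite mem_nth ?ss.
  move=> hh; have := Re_sqr_le (s`_i - z); rewrite ReB => h2.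
  exact: le_of_sqr_lt1 (le_lt_trans h2 hh).
Qed.

(** The extended sum is a supremum over finite sets of eigenvalues. For such a set, the pairs of an
    eigenvalue and an index in an orthonormal basis of its eigenspace form a finite type that
    repeats each eigenvalue with its multiplicity; distinct eigenvalues have orthogonal
    eigenvectors. *)
Theorem neg_eigenvalue_sum_le (Bd : R) :
  (forall (I : finType) (us : I -> E) (lam : I -> R), orthonormal us ->
     (forall i, 0 < lam i) -> (forall i, T (us i) ((- lam i)%:C *: us i)) ->
     \sum_i lam i <= Bd) ->
  (neg_eigenvalue_sum ip T <= Bd%:E)%E.
Proof.
move=> HB; have [n Hn] := choice (fun l : R => multiplicity_attained (- l)%:C).
pose vs l := sval (cid (Hn l)).
have Hvs l := svalP (cid (Hn l)).
apply: ge_ereal_sup => _ [A [finA AP] <-].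
rewrite fsbig_finite//=.
have E1 (l : R) : multiplicity ip T (- l)%:C = (n l)%:R%:E by case: (Hvs l).
under eq_bigr do rewrite E1 -EFinM.
rewrite sumEFin lee_fin.
pose X := fset_set A.
pose I := {l : X & 'I_(n (val l))}.
have := HB I (fun p => vs (val (tag p)) (tagged p)) (fun p => val (tag p)).
move=> /(_ _ _ _)HB'.
apply: le_trans (HB' _ _ _).
- rewrite big_seq_fsetE/=.
  have -> : \sum_(p : I) fsval (tag p) = \sum_(l : X) \sum_(i : 'I_(n (val l))) fsval l.
    by rewrite (sig_big_dep (fun=> true) (fun _ _ => true) (fun (l : X) (_ : 'I_(n (val l))) => fsval l)).
  rewrite le_eqVlt; apply/orP; left; apply/eqP; apply: eq_bigr => l _.
  by rewrite sumr_const card_ord mulr_natr.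
- move=> [l i] [l' j] /=.
  have [e|ne] := eqVneq l l'.
    move: j; rewrite -e => j; rewrite eq_Tagged/=.
    by have [_ _ ->] := Hvs (val l).
  have -> : (existT (fun l0 : X => 'I_(n (val l0))) l i == existT (fun l0 : X => 'I_(n (val l0))) l' j) = false.
    by apply/negP => /eqP/(congr1 (@tag _ _))/= e; move: ne; rewrite e eqxx.
  have [_ /(_ i) Ti _] := Hvs (val l); have [_ /(_ j) Tj _] := Hvs (val l').
  apply: (eigen_orthogonal Ti Tj) => //.
  apply: contraNneq ne => /(congr1 (@complex.Re R))/= /oppr_inj/val_inj ->.
  exact: eqxx.
- move=> [l i]/=; have : val l \in X by exact: valP.
  by rewrite in_fset_set// => /set_mem/AP[].
- by move=> [l i]/=; have [_ + _] := Hvs (val l); exact.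
Qed.

End SpectralTheory.

(** * The Sobolev constants *)

Section SobolevConstants.
Variable R : realType.
Implicit Types (L x y c e w kappa K : R) (f g u v du dv : R -> R) (dot : bool).
Notation mu := (@lebesgue_measure R).
Local Notation sqi := (@sq_integrable R).

(** On a cell with left end [a] and length [d], [u t ^+ 2] is at most twice [u a ^+ 2] plus twice
    the squared increment, and the increment is bounded by Hoelder's estimate. Integration over the
    cell gives a second factor [d]. *)
Lemma sampling_poincare L u du (N : nat) : 0 < L -> is_wderiv L u du ->
  int0 L (fun x => u x ^+ 2) <=
  2 * (L / N.+1%:R) * (\sum_(k < N.+1) u (k%:R * (L / N.+1%:R)) ^+ 2) +
  2 * (L / N.+1%:R) ^+ 2 * int0 L (fun x => du x ^+ 2).
Proof.
move=> L0 Du; set d := L / N.+1%:R.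
have d0 : 0 < d by rewrite divr_gt0.
have dN : N.+1%:R * d = L by rewrite /d mulrC divfK// pnatr_eq0.
have su := is_wderiv_sqi_fun (ltW L0) Du.
have I1 := sqi_itg2 su; have I2 := sqi_itg2 (is_wderiv_sqi Du).
have step n : (n <= N.+1)%N -> int0 (n%:R * d) (fun x => u x ^+ 2) <=
    2 * d * (\sum_(k < n) u (k%:R * d) ^+ 2) + 2 * d ^+ 2 * int0 (n%:R * d) (fun x => du x ^+ 2).
  elim: n => [_|n IH nN]; first by rewrite mul0r !int0_itv0 big_ord0 !mulr0 addr0.
  have := IH (ltnW nN); rewrite big_ord_recr/=.
  set a := n%:R * d; have aE : n.+1%:R * d = a + d by rewrite -natr1 mulrDl mul1r.
  have a0 : 0 <= a by rewrite mulr_ge0// ltW.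
  have adL : a + d <= L by rewrite -aE -dN ler_pM2r// ler_nat.
  have aad : a <= a + d by rewrite lerDl ltW.
  rewrite aE.
  have : J (fun x => u x ^+ 2) a (a + d) <= 2 * d * u a ^+ 2 + 2 * d ^+ 2 * J (fun x => du x ^+ 2) a (a + d).
    have -> : 2 * d * u a ^+ 2 + 2 * d ^+ 2 * J (fun x => du x ^+ 2) a (a + d) =
      J (fun=> 2 * u a ^+ 2 + 2 * (d * J (fun x => du x ^+ 2) a (a + d))) a (a + d).
      by rewrite J_cst//; ring.
    apply: (le_J I1 (itg_cst _ _)) => // t t0 /andP[at_ tad].
    have h1 := is_wderiv_hoelder Du a0 at_ (le_trans (ltW tad) adL).
    have h2 : (t - a) * J (fun x => du x ^+ 2) a t <= d * J (fun x => du x ^+ 2) a (a + d).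
      apply: ler_pM; [lra| |lra|].
        by apply: (@J_ge0 _ L) => //; [lra|move=> s _ _; exact: sqr_ge0].
      rewrite -(J_cat _ a t (a + d)) lerDl; apply: (@J_ge0 _ L) => //; [lra|lra|].
      by move=> s _ _; exact: sqr_ge0.
    have := sqr_ge0 (u t - 2 * u a); nra.
  rewrite /J; move: (int0 _ _) (int0 _ _) (int0 _ _) (int0 _ _) (\sum_(i < n) _) => p q r s z.
  move: (u a ^+ 2) => ua; rewrite !mulrDr !mulrN.
  have : 2 * d * z + 2 * d * ua = 2 * d * (z + ua) by ring.
  lra.
by have := step N.+1 (leqnn _); rewrite dN.
Qed.

(* [dot] selects the functions of mean zero. *)
Definition adm L dot u := u L = u 0 /\ (dot -> int0 L u = 0).

Definition coercive L kappa dot c0 := 0 < c0 /\ forall u du, is_wderiv L u du -> adm L dot u ->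
  c0 * (int0 L (fun x => du x ^+ 2) + int0 L (fun x => u x ^+ 2)) <=
  int0 L (fun x => du x ^+ 2) + kappa * int0 L (fun x => u x ^+ 2).

Lemma coercive_pos L kappa : 0 < kappa -> exists c0, coercive L kappa false c0.
Proof.
move=> k0; exists (Order.min 1 kappa); split; first by rewrite lt_min ltr01.
move=> u du _ _.
have a0 : 0 <= int0 L (fun x => du x ^+ 2) by apply: int0_ge0 => x _; exact: sqr_ge0.
have b0 : 0 <= int0 L (fun x => u x ^+ 2) by apply: int0_ge0 => x _; exact: sqr_ge0.
rewrite mulrDr; apply: lerD.
  by rewrite ler_piMl// ge_min lexx.
by rewrite ler_wpM2r// ge_min lexx orbT.
Qed.

Lemma coercive_meanzero (delta : R) : 0 <= delta -> delta < 1 ->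
  exists c0, coercive (2 * pi) (- delta) true c0.
Proof.
(* [w] lies strictly between [delta] and 1; its square root is the frequency given to Wirtinger's
   inequality. The constant [(w - delta) / (1 + w)] is the one with equality when the integral of
   [du ^+ 2] is exactly [w] times that of [u ^+ 2]. *)
move=> d0 d1; pose w := (1 + delta) / 2.
have w0 : 0 < w by rewrite /w; lra.
have w1 : w < 1 by rewrite /w; lra.
pose s := Num.sqrt w.
have s0 : 0 < s by rewrite sqrtr_gt0.
have s2 : s ^+ 2 = w by rewrite sqr_sqrtr// ltW.
have s1 : s < 1 by rewrite -(@ltr_pXn2r _ 2)// ?nnegrE ?ltW// s2 expr1n.
exists ((w - delta) / (1 + w)); split.
  by rewrite divr_gt0// /w; lra.
move=> u du Du [up /(_ isT) um].
have := wirtinger_lt1 s0 s1 Du up um; rewrite s2.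
have a0 : 0 <= int0 (2 * pi) (fun x => du x ^+ 2) by apply: int0_ge0 => x _; exact: sqr_ge0.
have b0 : 0 <= int0 (2 * pi) (fun x => u x ^+ 2) by apply: int0_ge0 => x _; exact: sqr_ge0.
move: (int0 _ _) (int0 _ _) a0 b0 => a b a0 b0 wab.
rewrite mulrAC ler_pdivrMr; last lra.
have wd : delta < w by rewrite /w; lra.
nra.
Qed.

Definition energy L kappa u := int0 L (fun x => wderiv L u x ^+ 2 + kappa * u x ^+ 2).

Lemma energyE L kappa u du : 0 <= L -> is_wderiv L u du ->
  energy L kappa u = int0 L (fun x => du x ^+ 2) + kappa * int0 L (fun x => u x ^+ 2).
Proof.
move=> L0 Du; have Dw := is_wderiv_wderiv Du.
have I1 := sqi_itg2 (is_wderiv_sqi Dw).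
have I2 := sqi_itg2 (is_wderiv_sqi_fun L0 Du).
rewrite /energy int0D//; last exact: itgZ.
rewrite int0Z//; congr (_ + _); apply: ae_int0.
- exact: itg_measurable.
- exact: itg_measurable (sqi_itg2 (is_wderiv_sqi Du)).
- exact: (ae_eq_comp (fun z : R => z ^+ 2)) (wderiv_ae L0 Du).
Qed.

Lemma sup_normP L u du x : 0 <= L -> is_wderiv L u du -> 0 <= x <= L ->
  `|u x| <= sup_norm L u.
Proof.
move=> L0 Du xI; apply: ub_le_sup; last by exists x => //=; rewrite in_itv.
have [c _ Hc] := is_wderiv_bound L0 Du; exists c => _ [y yI <-].
by apply: Hc; move: yI; rewrite /= in_itv.
Qed.

Lemma sup_norm_le L u c : 0 <= L -> (forall x, 0 <= x <= L -> `|u x| <= c) ->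
  sup_norm L u <= c.
Proof.
move=> L0 H; apply: ge_sup.
  by exists `|u 0|, 0 => //=; rewrite in_itv/= lexx.
by move=> _ [x xI <-]; apply: H; move: xI; rewrite /= in_itv.
Qed.

Lemma sup_norm_ge0 L u : 0 <= sup_norm L u.
Proof.
rewrite /sup_norm; set A := [set _ | _ in _].
have [hs|hs] := pselect (has_sup A); last by rewrite sup_out.
have [y Ay] := hs.1; apply: (@le_trans _ _ y).
  by case: Ay => x _ <-.
by apply: ub_le_sup => //; exact: hs.2.
Qed.

Definition sobolev_set L kappa dot : set R := [set K | forall u, H1per L u -> (dot -> int0 L u = 0) ->
  sup_norm L u ^+ 2 <= K * Num.sqrt (energy L kappa u) * Num.sqrt (int0 L (fun x => u x ^+ 2))].

Definition sobolev_const L kappa dot := inf (sobolev_set L kappa dot).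

Lemma agmon_le L u du x e : 0 < L -> 0 < e -> is_wderiv L u du -> 0 <= x <= L ->
  u x ^+ 2 <= e * int0 L (fun x => du x ^+ 2) + (L^-1 + e^-1) * int0 L (fun x => u x ^+ 2).
Proof.
move=> L0 e0 Du xI; apply: le_trans (agmon L0 Du xI) _.
have su := is_wderiv_sqi_fun (ltW L0) Du; have sd := is_wderiv_sqi Du.
have : 2 * int0 L (fun t => `|u t * du t|) <=
   e * int0 L (fun x => du x ^+ 2) + e^-1 * int0 L (fun x => u x ^+ 2).
  rewrite -int0Z; last exact: itg_norm (sqi_itgM su sd).
  rewrite -int0Z; last exact: sqi_itg2.
  rewrite -[e^-1 * _]int0Z; last exact: sqi_itg2.
  rewrite -int0D; [|exact: itgZ (sqi_itg2 sd)|exact: itgZ (sqi_itg2 su)].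
  apply: le_int0; first exact: itgZ (itg_norm (sqi_itgM su sd)).
    exact: itgD (itgZ _ (sqi_itg2 sd)) (itgZ _ (sqi_itg2 su)).
  move=> y _; rewrite normrM -[X in _ <= _ * X + _]real_normK ?num_real//.
  rewrite -[X in _ <= _ + _ * X]real_normK ?num_real//.
  move: (`|u y|) (`|du y|) => p q.
  have -> : e * q ^+ 2 + e^-1 * p ^+ 2 = 2 * (p * q) + e^-1 * (e * q - p) ^+ 2 by field; lra.
  by rewrite lerDl mulr_ge0 ?sqr_ge0// invr_ge0 ltW.
lra.
Qed.

(** Agmon's inequality and coercivity make some constant admissible, and the defining inequality is
    closed in the constant, so the infimum is admissible too. This is all that is used of the
    Sobolev constants. *)
Lemma sobolev_constP L kappa dot c0 : 0 < L -> coercive L kappa dot c0 ->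
  0 <= sobolev_const L kappa dot /\ forall u du x, is_wderiv L u du -> adm L dot u ->
  0 <= x <= L -> u x ^+ 2 <= sobolev_const L kappa dot *
   Num.sqrt (int0 L (fun x => du x ^+ 2) + kappa * int0 L (fun x => u x ^+ 2)) *
   Num.sqrt (int0 L (fun x => u x ^+ 2)).
Proof.
move=> L0 [c00 coer]; set S := sobolev_set L kappa dot.
have ub u : H1per L u -> (dot -> int0 L u = 0) -> forall x, 0 <= x <= L ->
    u x ^+ 2 <= (2 + L^-1) * (Num.sqrt c0)^-1 * Num.sqrt (energy L kappa u) * Num.sqrt (int0 L (fun x => u x ^+ 2)).
  move=> [[du Du] up] um x xI.
  rewrite (energyE _ (ltW L0) Du).
  have cu := coer _ _ Du (conj up um).
  have a0 : 0 <= int0 L (fun x => du x ^+ 2) by apply: int0_ge0 => z _; exact: sqr_ge0.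
  have b0 : 0 <= int0 L (fun x => u x ^+ 2) by apply: int0_ge0 => z _; exact: sqr_ge0.
  have su := is_wderiv_sqi_fun (ltW L0) Du; have sd := is_wderiv_sqi Du.
  have key := fun e (e0 : 0 < e) => @agmon_le L u du x e L0 e0 Du xI.
  move: (int0 L (fun x => du x ^+ 2)) (int0 L (fun x => u x ^+ 2)) a0 b0 cu key => a b a0 b0 cu key.
  set q := Num.sqrt (a + kappa * b); set p := Num.sqrt b; set sc := Num.sqrt c0.
  have sc0 : 0 < sc by rewrite sqrtr_gt0.
  have q2 : q ^+ 2 = a + kappa * b.
    by rewrite sqr_sqrtr//; apply: le_trans cu; rewrite mulr_ge0 ?addr_ge0// ltW.
  have p2 : p ^+ 2 = b by rewrite sqr_sqrtr.
  pose r := Num.sqrt (a + b).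
  have r2 : r ^+ 2 = a + b by rewrite sqr_sqrtr// addr_ge0.
  have r0 : 0 <= r by exact: sqrtr_ge0.
  have q0 : 0 <= q by exact: sqrtr_ge0.
  have p0 : 0 <= p by exact: sqrtr_ge0.
  have scr : sc * r <= q.
    rewrite -(@ler_pXn2r _ 2)// ?nnegrE ?mulr_ge0 ?(ltW sc0)//.
    by rewrite exprMn r2 q2 sqr_sqrtr// ltW.
  have pr : p <= r.
    by rewrite -(@ler_pXn2r _ 2)// ?nnegrE// r2 p2 lerDr.
  have main : u x ^+ 2 <= (2 + L^-1) * (r * p).
    have Li : 0 < L^-1 by rewrite invr_gt0.
    move: p0; rewrite le_eqVlt => /orP[/eqP p0|p0].
      have b00 : b = 0 by rewrite -p2 -p0 expr0n.
      rewrite -p0 !mulr0; apply: (@le_eps _ _ _ a a0) => e e0 _.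
      by have := key e e0; rewrite b00 mulr0 addr0 add0r mulrC.
    have rp : 0 < r by exact: lt_le_trans pr.
    (* This value of [e] balances Agmon's inequality: [e * a] and [e^-1 * b] are both at most
       [r * p], whence the 2 in the constant. For [p = 0] it degenerates, and [e] was sent to 0
       instead. *)
    have := key (p / r) (divr_gt0 p0 rp); rewrite invf_div -p2.
    have ha : a <= r ^+ 2 by rewrite r2 lerDl.
    have h1 : p / r * a <= p * r.
      rewrite (_ : p * r = p / r * r ^+ 2); last by field; rewrite gt_eqF.
      by rewrite ler_wpM2l// divr_ge0// ltW.
    have h2 : (L^-1 + r / p) * p ^+ 2 = L^-1 * p ^+ 2 + r * p by field; rewrite !gt_eqF.
    rewrite h2.
    have h3 : L^-1 * p ^+ 2 <= L^-1 * (r * p) by rewrite ler_pM2l// expr2 ler_pM2r.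
    lra.
  apply: le_trans main _; rewrite -!mulrA; apply: ler_wpM2l.
    by rewrite addr_ge0// invr_ge0 ltW.
  by rewrite mulrA ler_wpM2r// ler_pdivlMl.
pose K0 := (2 + L^-1) * (Num.sqrt c0)^-1.
have SK0 : S K0.
  move=> u Hu um; have [[du Du] up] := Hu.
  set B := _ * _ * _; have B0 : 0 <= B.
    rewrite /B /K0 !mulr_ge0 ?sqrtr_ge0 ?invr_ge0 ?sqrtr_ge0// addr_ge0// invr_ge0 ltW//.
  have : sup_norm L u <= Num.sqrt B.
    apply: sup_norm_le (ltW L0) _ => x xI; rewrite -sqrtr_sqr ler_wsqrtr//.
    exact: ub.
  move=> h; rewrite -[leRHS]sqr_sqrtr// ler_pXn2r ?nnegrE ?sup_norm_ge0 ?sqrtr_ge0//.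
suff [Kp SK] : 0 <= inf S /\ S (inf S).
  split => // u du x Du [up um] xI; have Hu : H1per L u by split => //; exists du.
  have := SK u Hu um; rewrite (energyE _ (ltW L0) Du); apply: le_trans.
  rewrite -real_normK ?num_real// ler_pXn2r ?nnegrE ?sup_norm_ge0//.
  exact: sup_normP (ltW L0) Du xI.
(* If a negative constant is admissible then all u vanish, S is unbounded below, and
   [inf S] is the junk value 0, which is still admissible. *)
case: (pselect (exists2 K, S K & K < 0)) => [[K SK Kn]|nK].
  have all0 u : H1per L u -> (dot -> int0 L u = 0) -> sup_norm L u = 0 /\
      int0 L (fun x => u x ^+ 2) = 0.
    move=> Hu um; have [[du Du] up] := Hu.
    have s0 : sup_norm L u = 0.
      have := SK u Hu um => h; apply/eqP; rewrite -sqrf_eq0 eq_le sqr_ge0 andbT.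
      apply: le_trans h _; rewrite -mulrA mulr_le0_ge0 ?(ltW Kn)// mulr_ge0// sqrtr_ge0.
    split => //; rewrite -(int00 L); apply: eq_int0 => x; rewrite in_itv/= => /andP[x0 xL].
    have := @sup_normP L u du x (ltW L0) Du; rewrite (ltW x0) (ltW xL) => /(_ isT).
    by rewrite s0 normr_le0 => /eqP ->; rewrite expr0n.
  have -> : inf S = 0.
    apply: inf_out => -[_ [lb Hlb]]; have : S (lb - 1).
      by move=> u Hu um; have [-> ->] := all0 u Hu um; rewrite sqrtr0 mulr0 expr0n.
    by move=> /Hlb; lra.
  split => // u Hu um; have [-> ->] := all0 u Hu um.
  by rewrite sqrtr0 mulr0 expr0n.
have S0 : forall K, S K -> 0 <= K.
  by move=> K SK; rewrite leNgt; apply/negP => Kn; apply: nK; exists K.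
have hi : has_inf S by split; [exists K0|exists 0].
split; first by apply: lb_le_inf => //; exists K0.
move=> u Hu um; rewrite -mulrA.
set P := Num.sqrt _ * _; have P0 : 0 <= P by rewrite mulr_ge0 ?sqrtr_ge0.
apply: (@le_eps _ _ _ P P0) => e e0 _.
have [K SK Ke] := inf_adherent e0 hi.
have := SK u Hu um; rewrite -mulrA -/P => h; apply: le_trans h _.
rewrite [P * e]mulrC -mulrDl ler_wpM2r// ltW//.
Qed.

Lemma K1E alpha beta : K1 alpha beta = sobolev_const (2 * pi / alpha) (alpha ^+ 2 * beta) false.
Proof.
rewrite /K1 /sobolev_const; congr inf; apply/seteqP; split => K /= H u Hu.
  by move=> _; exact: H.
exact: H.
Qed.

Lemma K2E delta : K2 delta = sobolev_const (2 * pi) (- delta) true.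
Proof.
have E u : energy (2 * pi) (- delta) u =
    int0 (2 * pi) (fun x => wderiv (2 * pi) u x ^+ 2 - delta * u x ^+ 2).
  by apply: eq_int0 => x _; rewrite mulNr.
rewrite /K2 /sobolev_const; congr inf; apply/seteqP; split => K /= H u Hu um.
  by rewrite E; exact: H (um isT).
by rewrite -E; exact: H.
Qed.

End SobolevConstants.

(** * Vector-valued functions *)

Section ComplexFunctions.
Variable R : realType.
Implicit Types (L : R) (f g : R -> R[i]).
Local Notation Re := complex.Re.
Local Notation Im := complex.Im.
Local Notation C := R[i].
Local Notation sqi := (@sq_integrable R).
Notation mu := (@lebesgue_measure R).

Definition citg L f := itg L (fun x => Re (f x)) /\ itg L (fun x => Im (f x)).
Definition csqi L f := sqi L (fun x => Re (f x)) /\ sqi L (fun x => Im (f x)).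

Lemma Re_cint0 L f : Re (cint0 L f) = int0 L (fun x => Re (f x)). Proof. by []. Qed.
Lemma Im_cint0 L f : Im (cint0 L f) = int0 L (fun x => Im (f x)). Proof. by []. Qed.

Lemma eq_citg L f g : {in `]0, L[, f =1 g} -> citg L f -> citg L g.
Proof. by move=> fg [h1 h2]; split; [apply: eq_itg h1|apply: eq_itg h2] => x /fg ->. Qed.

Lemma eq_cint0 L f g : {in `]0, L[, f =1 g} -> cint0 L f = cint0 L g.
Proof. by move=> fg; apply: complexP; apply: eq_int0 => x /fg ->. Qed.

Lemma citg_lin L (a : C) f g : citg L f -> citg L g -> citg L (fun x => a * f x + g x).
Proof.
move=> [f1 f2] [g1 g2]; split.
  apply: eq_itg (itgD (itgB (itgZ (Re a) f1) (itgZ (Im a) f2)) g1) => x _.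
  by rewrite !ReImE.
apply: eq_itg (itgD (itgD (itgZ (Re a) f2) (itgZ (Im a) f1)) g2) => x _.
by rewrite !ReImE.
Qed.

Lemma citg0 L : citg L (fun=> 0). Proof. by split; exact: itg0. Qed.
Lemma citgD L f g : citg L f -> citg L g -> citg L (fun x => f x + g x).
Proof. by move=> If Ig; apply: eq_citg (citg_lin 1 If Ig) => x _; rewrite mul1r. Qed.
Lemma citg_conj L f : citg L f -> citg L (fun x => Num.conj (f x)).
Proof.
move=> [f1 f2]; split; first by apply: eq_itg f1 => x _; rewrite Re_conj.
by apply: eq_itg (itgN f2) => x _; rewrite Im_conj.
Qed.
Lemma citg_sum L I (s : seq I) (F : I -> R -> C) : (forall j, citg L (F j)) ->
  citg L (fun x => \sum_(j <- s) F j x).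
Proof.
move=> IF; elim: s => [|j s IH].
  by apply: eq_citg (citg0 L) => x _; rewrite big_nil.
by apply: eq_citg (citgD (IF j) IH) => x _; rewrite big_cons.
Qed.

Lemma cint0_lin L (a : C) f g : citg L f -> citg L g ->
  cint0 L (fun x => a * f x + g x) = a * cint0 L f + cint0 L g.
Proof.
move=> [f1 f2] [g1 g2]; apply: complexP.
  rewrite [RHS]ReD [X in _ = X + _]ReM Re_cint0.
  rewrite -[Re (cint0 L f)]/(int0 L _) -[Im (cint0 L f)]/(int0 L _) -[Re (cint0 L g)]/(int0 L _).
  rewrite -int0Z// -(int0Z (Im a))// -int0B; [|exact: itgZ|exact: itgZ].
  rewrite -int0D//; last by apply: itgB; exact: itgZ.
  by apply: eq_int0 => x _; rewrite !ReImE.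
rewrite [RHS]ImD [X in _ = X + _]ImM Im_cint0.
rewrite -[Re (cint0 L f)]/(int0 L _) -[Im (cint0 L f)]/(int0 L _) -[Im (cint0 L g)]/(int0 L _).
rewrite -int0Z// -(int0Z (Im a))// -int0D; [|exact: itgZ|exact: itgZ].
rewrite -int0D//; last by apply: itgD; exact: itgZ.
by apply: eq_int0 => x _; rewrite !ReImE.
Qed.

Lemma cint00 L : cint0 L (fun=> 0) = 0.
Proof. by apply: complexP; exact: int00. Qed.
Lemma cint0D L f g : citg L f -> citg L g ->
  cint0 L (fun x => f x + g x) = cint0 L f + cint0 L g.
Proof.
move=> If Ig; rewrite -[cint0 L f]mul1r -cint0_lin//.
by apply: eq_cint0 => x _; rewrite mul1r.
Qed.
Lemma cint0Z L (a : C) f : citg L f -> cint0 L (fun x => a * f x) = a * cint0 L f.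
Proof.
move=> If; rewrite -[RHS]addr0 -(cint00 L) -cint0_lin//; last exact: citg0.
by apply: eq_cint0 => x _; rewrite addr0.
Qed.
Lemma cint0_conj L f : citg L f -> cint0 L (fun x => Num.conj (f x)) = Num.conj (cint0 L f).
Proof.
move=> [f1 f2]; apply: complexP.
  by rewrite [RHS]Re_conj; apply: eq_int0 => x _; rewrite Re_conj.
rewrite [RHS]Im_conj -[Im (cint0 L f)]/(int0 L _) -int0N//.
by apply: eq_int0 => x _; rewrite Im_conj.
Qed.
Lemma cint0_sum L I (s : seq I) (F : I -> R -> C) : (forall j, citg L (F j)) ->
  cint0 L (fun x => \sum_(j <- s) F j x) = \sum_(j <- s) cint0 L (F j).
Proof.
move=> IF; elim: s => [|j s IH].
  by rewrite big_nil -[RHS](cint00 L); apply: eq_cint0 => x _; rewrite big_nil.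
rewrite big_cons -IH -cint0D//; last exact: citg_sum.
by apply: eq_cint0 => x _; rewrite big_cons.
Qed.

Lemma csqi_citg L f : csqi L f -> citg L f.
Proof. by case=> h1 h2; split; exact: sqi_itg. Qed.

Lemma csqi_citgM L f g : csqi L f -> csqi L g -> citg L (fun x => f x * Num.conj (g x)).
Proof.
move=> [f1 f2] [g1 g2]; split.
  apply: eq_itg (itgD (sqi_itgM f1 g1) (sqi_itgM f2 g2)) => x _.
  by rewrite !ReImE; ring.
apply: eq_itg (itgB (sqi_itgM f2 g1) (sqi_itgM f1 g2)) => x _.
by rewrite !ReImE; ring.
Qed.

Lemma csqi_lin L (a : C) f g : csqi L f -> csqi L g -> csqi L (fun x => a * f x + g x).
Proof.
move=> [f1 f2] [g1 g2]; split.
  apply: eq_sqi (sqiD (sqiB (sqiZ (Re a) f1) (sqiZ (Im a) f2)) g1) => x _.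
  by rewrite !ReImE.
apply: eq_sqi (sqiD (sqiD (sqiZ (Re a) f2) (sqiZ (Im a) f1)) g2) => x _.
by rewrite !ReImE.
Qed.

Lemma csqi0 L : csqi L (fun=> 0). Proof. by split; exact: sqi_cst. Qed.

Lemma eq_csqi L f g : {in `]0, L[, f =1 g} -> csqi L f -> csqi L g.
Proof. by move=> fg [h1 h2]; split; [apply: eq_sqi h1|apply: eq_sqi h2] => x /fg ->. Qed.

Lemma ae_cint0M L f f' g g' : csqi L f -> csqi L f' -> csqi L g -> csqi L g' ->
  ae_eq mu (`]0, L[%classic) f f' -> ae_eq mu (`]0, L[%classic) g g' ->
  cint0 L (fun x => f x * Num.conj (g x)) = cint0 L (fun x => f' x * Num.conj (g' x)).
Proof.
move=> sf sf' sg sg' ff' gg'.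
have [m1 m2] := csqi_citgM sf sg; have [m1' m2'] := csqi_citgM sf' sg'.
have E : ae_eq mu (`]0, L[%classic) (fun x => f x * Num.conj (g x)) (fun x => f' x * Num.conj (g' x)).
  by apply: (@filterS2 _ _ (ae_filter_ringOfSetsType mu) _ _ _ _ ff' gg') => x h1 h2 Dx; rewrite h1// h2.
apply: complexP; apply: ae_int0; try exact: itg_measurable.
- exact: (ae_eq_comp (fun z : C => Re z)) E.
- exact: (ae_eq_comp (fun z : C => Im z)) E.
Qed.

Definition is_cder L f g := is_wderiv L (fun x => Re (f x)) (fun x => Re (g x)) /\
  is_wderiv L (fun x => Im (f x)) (fun x => Im (g x)).

Definition cder L f x := wderiv L (fun x => Re (f x)) x +i* wderiv L (fun x => Im (f x)) x.

Lemma is_cder_cder L f g : is_cder L f g -> is_cder L f (cder L f).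
Proof. by case=> h1 h2; split; [exact: is_wderiv_wderiv h1|exact: is_wderiv_wderiv h2]. Qed.

Lemma is_cder_lin L (a : C) f g df dg : is_cder L f df -> is_cder L g dg ->
  is_cder L (fun x => a * f x + g x) (fun x => a * df x + dg x).
Proof.
move=> [f1 f2] [g1 g2]; split.
  have := is_wderiv_lin 1 1 (is_wderiv_lin (Re a) (- Im a) f1 f2) g1.
  by congr (is_wderiv L); apply/funext => x; rewrite !ReImE; ring.
have := is_wderiv_lin 1 1 (is_wderiv_lin (Re a) (Im a) f2 f1) g2.
by congr (is_wderiv L); apply/funext => x; rewrite !ReImE; ring.
Qed.

Lemma is_cder0 L : is_cder L (fun=> 0) (fun=> 0).
Proof. by split; exact: is_wderiv_cst. Qed.

Lemma is_cder_sum L I (s : seq I) (a : I -> C) (F dF : I -> R -> C) :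
  (forall i, is_cder L (F i) (dF i)) ->
  is_cder L (fun x => \sum_(i <- s) a i * F i x) (fun x => \sum_(i <- s) a i * dF i x).
Proof.
move=> H; elim: s => [|i s IH].
  have := is_cder0 L; congr (is_cder L); by apply/funext => x; rewrite big_nil.
have := is_cder_lin (a i) (H i) IH.
by congr (is_cder L); apply/funext => x; rewrite big_cons.
Qed.

Lemma cder_ae L f g : 0 <= L -> is_cder L f g -> ae_eq mu (`]0, L[%classic) (cder L f) g.
Proof.
move=> L0 [h1 h2].
apply: (@filterS2 _ _ (ae_filter_ringOfSetsType mu) _ _ _ _ (wderiv_ae L0 h1) (wderiv_ae L0 h2)).
by move=> x e1 e2 Dx; apply: complexP; [exact: e1|exact: e2].
Qed.

Lemma is_cder_csqi L f g : is_cder L f g -> csqi L g.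
Proof. by case=> h1 h2; split; [exact: is_wderiv_sqi h1|exact: is_wderiv_sqi h2]. Qed.

Lemma is_cder_csqi_fun L f g : 0 <= L -> is_cder L f g -> csqi L f.
Proof. by move=> L0 [h1 h2]; split; [exact: is_wderiv_sqi_fun h1|exact: is_wderiv_sqi_fun h2]. Qed.

Lemma cn2_int0 L f : csqi L f ->
  int0 L (fun x => cn2 (f x)) = int0 L (fun x => Re (f x) ^+ 2) + int0 L (fun x => Im (f x) ^+ 2).
Proof. by move=> [h1 h2]; rewrite -int0D; [|exact: sqi_itg2|exact: sqi_itg2]. Qed.

Lemma Re_cint0_sqr L f : csqi L f ->
  Re (cint0 L (fun x => f x * Num.conj (f x))) = int0 L (fun x => cn2 (f x)).
Proof. by move=> _; apply: eq_int0 => x _; rewrite mulz_conj. Qed.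

End ComplexFunctions.

(** * The Hilbert space of vector functions and the form of the derivative *)

Section VectorFunctions.
Variables (R : realType) (M : nat) (L : R).
Hypothesis L0 : 0 < L.
Local Notation Re := complex.Re.
Local Notation Im := complex.Im.
Local Notation C := R[i].
Local Notation V := (vfun R M).
Implicit Types u v w f g du dv dw : V.

Lemma vfun_lin (a : C) u v x i : (a *: u + v) x i 0 = a * u x i 0 + v x i 0.
Proof. by rewrite !mxE. Qed.

Lemma vfun_sum I (s : seq I) (a : I -> C) (u : I -> V) x i :
  (\sum_(j <- s) a j *: u j) x i 0 = \sum_(j <- s) a j * u j x i 0.
Proof.
elim: s => [|j s IH]; first by rewrite !big_nil mxE.
by rewrite !big_cons vfun_lin IH.
Qed.

Lemma vL2P f : vL2 L f <-> forall i, csqi L (fun x => f x i 0).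
Proof. by []. Qed.

Lemma vL2_lin (a : C) u v : vL2 L u -> vL2 L v -> vL2 L (a *: u + v).
Proof.
move=> /vL2P Hu /vL2P Hv; apply/vL2P => i; apply: eq_csqi (csqi_lin a (Hu i) (Hv i)).
by move=> x _; rewrite vfun_lin.
Qed.

Lemma vL20 : vL2 L (0 : V).
Proof. by apply/vL2P => i; apply: eq_csqi (csqi0 L) => x _; rewrite mxE. Qed.

Lemma vipE u v : vL2 L u -> vL2 L v ->
  vip L u v = \sum_i cint0 L (fun x => u x i 0 * Num.conj (v x i 0)).
Proof.
by move=> /vL2P Hu /vL2P Hv; rewrite /vip cint0_sum// => i; exact: csqi_citgM.
Qed.

Lemma vip_semi_ip : semi_ip (vL2 L) (@vip R M L).
Proof.
split; [exact: vL20|exact: vL2_lin| | |].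
- move=> a u v w Hu Hv Hw; rewrite !vipE//; last exact: vL2_lin.
  rewrite mulr_sumr -big_split/=; apply: eq_bigr => i _.
  rewrite -cint0_lin; [|exact: csqi_citgM (Hu i) (Hw i)|exact: csqi_citgM (Hv i) (Hw i)].
  by apply: eq_cint0 => x _; rewrite vfun_lin; ring.
- move=> u v Hu Hv; rewrite !vipE// conj_sum; apply: eq_bigr => i _.
  rewrite -cint0_conj; last exact: csqi_citgM (Hu i) (Hv i).
  by apply: eq_cint0 => x _; rewrite rmorphM/= conjCK mulrC.
- move=> u Hu; rewrite vipE// Re_sum; apply: sumr_ge0 => i _.
  rewrite (Re_cint0_sqr (Hu i)); apply: int0_ge0 => x _; exact: cn2_ge0.
Qed.

Lemma N2_vip u : vL2 L u -> N2 (vip L) u = \sum_i int0 L (fun x => cn2 (u x i 0)).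
Proof.
move=> Hu; rewrite /N2 vipE// Re_sum; apply: eq_bigr => i _; exact: Re_cint0_sqr (Hu i).
Qed.

Definition is_vder u du := forall i, is_cder L (fun x => u x i 0) (fun x => du x i 0).

Lemma is_vder_lin (a : C) u v du dv : is_vder u du -> is_vder v dv ->
  is_vder (a *: u + v) (a *: du + dv).
Proof.
move=> Hu Hv i; have := is_cder_lin a (Hu i) (Hv i).
by congr (is_cder L); apply/funext => x; rewrite vfun_lin.
Qed.

Lemma is_vder0 : is_vder 0 0.
Proof.
by move=> i; have := is_cder0 L; congr (is_cder L); apply/funext => x; rewrite mxE.
Qed.

Lemma is_vder_mulmx (A : 'M[C]_M) u du : is_vder u du ->
  is_vder (fun x => A *m u x) (fun x => A *m du x).
Proof.
move=> H i; have := is_cder_sum (index_enum 'I_M) (A i) H.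
by congr (is_cder L); apply/funext => x; rewrite mxE.
Qed.

Lemma vH1perP u : vH1per L u <-> (exists du, is_vder u du) /\ u L = u 0.
Proof.
split=> [Hu|[[du Hdu] up] i].
  have H i : is_cder L (fun x => u x i 0) (cder L (fun x => u x i 0)).
    have [[[d1 D1] _] [[d2 D2] _]] := Hu i.
    apply: (@is_cder_cder _ _ _ (fun x => d1 x +i* d2 x)); split; [exact: D1|exact: D2].
  split; first by exists (vwderiv L u) => i; have := H i; congr (is_cder L); apply/funext => x; rewrite mxE.
  apply/matrixP => i j; rewrite ord1.
  have [[_ p1] [_ p2]] := Hu i; apply: complexP; [exact: p1|exact: p2].
have [h1 h2] := Hdu i.
by split; split; [exists (fun x => Re (du x i 0))| |exists (fun x => Im (du x i 0))|]; rewrite // /re_part /im_part up.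
Qed.

Lemma is_vder_vwderiv u du : is_vder u du -> is_vder u (vwderiv L u).
Proof.
move=> H i; have := is_cder_cder (H i).
by congr (is_cder L); apply/funext => x; rewrite mxE.
Qed.

Lemma is_vder_vL2 u du : is_vder u du -> vL2 L du.
Proof. by move=> H i; exact: is_cder_csqi (H i). Qed.

Lemma is_vder_vL2_fun u du : is_vder u du -> vL2 L u.
Proof. by move=> H i; exact: (is_cder_csqi_fun (ltW L0) (H i)). Qed.

(** The chosen derivative [vwderiv] is linear only up to null sets. Replacing it inside the inner
    product by any derivative at hand makes the form sesquilinear exactly. *)
Lemma vip_vder u v du dv : is_vder u du -> is_vder v dv ->
  vip L (vwderiv L u) (vwderiv L v) = vip L du dv.
Proof.
move=> Hu Hv; have Hu' := is_vder_vwderiv Hu; have Hv' := is_vder_vwderiv Hv.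
rewrite !vipE; [|exact: is_vder_vL2 Hu|exact: is_vder_vL2 Hv|exact: is_vder_vL2 Hu'|exact: is_vder_vL2 Hv'].
have E w i : (fun x => vwderiv L w x i 0) = cder L (fun x => w x i 0).
  by apply/funext => x; rewrite mxE.
apply: eq_bigr => i _; apply: ae_cint0M.
- exact: is_cder_csqi (Hu' i).
- exact: is_cder_csqi (Hu i).
- exact: is_cder_csqi (Hv' i).
- exact: is_cder_csqi (Hv i).
- by rewrite E; exact: (cder_ae (ltW L0) (Hu i)).
- by rewrite E; exact: (cder_ae (ltW L0) (Hv i)).
Qed.

Definition dform u v := vip L (vwderiv L u) (vwderiv L v).

Lemma vH1per_lin (a : C) u v : vH1per L u -> vH1per L v -> vH1per L (a *: u + v).
Proof.
move=> /vH1perP[[du Du] up] /vH1perP[[dv Dv] vp]; apply/vH1perP; split.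
  by exists (a *: du + dv); exact: is_vder_lin.
by rewrite !fctE/= up vp.
Qed.

Lemma vH1per0 : vH1per L (0 : V).
Proof. by apply/vH1perP; split => //; exists 0; exact: is_vder0. Qed.

Lemma vH1per_vL2 u : vH1per L u -> vL2 L u.
Proof. by move=> /vH1perP[[du Du] _]; exact: is_vder_vL2_fun Du. Qed.

Lemma dform_semi_ip : semi_ip (vH1per L) dform.
Proof.
have Hip := vip_semi_ip.
split; [exact: vH1per0|exact: vH1per_lin| | |].
- move=> a u v w /vH1perP[[du Du] _] /vH1perP[[dv Dv] _] /vH1perP[[dw Dw] _].
  rewrite /dform (vip_vder (is_vder_lin a Du Dv) Dw) (vip_vder Du Dw) (vip_vder Dv Dw).
  by rewrite (sip_lin Hip)//; [exact: is_vder_vL2 Du|exact: is_vder_vL2 Dv|exact: is_vder_vL2 Dw].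
- move=> u v /vH1perP[[du Du] _] /vH1perP[[dv Dv] _].
  rewrite /dform (vip_vder Du Dv) (vip_vder Dv Du).
  by rewrite (sip_conj Hip (is_vder_vL2 Du) (is_vder_vL2 Dv)).
- move=> u /vH1perP[[du Du] _]; rewrite /dform (vip_vder Du Du).
  exact: (sip_ge0 Hip (is_vder_vL2 Du)).
Qed.

End VectorFunctions.

(** * The potential and its form *)

Section NonnegativeMatrix.
Variables (R : realType) (M : nat).
Local Notation Re := complex.Re.
Local Notation Im := complex.Im.
Local Notation C := R[i].
Local Open Scope sesquilinear_scope.
Implicit Types (A B : 'M[C]_M) (u v : 'cV[C]_M).

Definition dotc u v : C := \sum_i u i 0 * Num.conj (v i 0).

Lemma dotcE u v : dotc u v = (v ^t* *m u) 0 0.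
Proof. by rewrite !mxE; apply: eq_bigr => i _; rewrite !mxE mulrC. Qed.

Lemma dotc_adj A u v : dotc (A *m u) v = dotc u (A ^t* *m v).
Proof. by rewrite !dotcE trmx_mul map_mxM trmxCK mulmxA. Qed.

Lemma dotc_semi_ip : semi_ip setT dotc.
Proof.
split => //.
- move=> a u v w _ _ _; rewrite /dotc mulr_sumr -big_split; apply: eq_bigr => i _.
  by rewrite !mxE/=; ring.
- move=> u v _ _; rewrite /dotc conj_sum; apply: eq_bigr => i _.
  by rewrite rmorphM/= conjCK mulrC.
- move=> u _; rewrite /dotc Re_sum; apply: sumr_ge0 => i _.
  by rewrite mulz_conj; exact: cn2_ge0.
Qed.

Lemma N2_dotc u : N2 dotc u = \sum_i cn2 (u i 0).
Proof. by rewrite /N2 Re_sum; apply: eq_bigr => i _; rewrite mulz_conj. Qed.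

Lemma dotc_unitary A u v : A \is unitarymx -> dotc (A *m u) (A *m v) = dotc u v.
Proof.
move=> /[dup] Au /unitarymx_unit AU; rewrite dotc_adj -(invmx_unitary Au).
by rewrite mulmxA mulVmx// mul1mx.
Qed.

Definition eigval A l : R := Re (spectral_diag A 0 l).
Definition eigcoord A u l : C := (spectralmx A *m u) l 0.

Lemma sum_eigcoord A u v : \sum_l eigcoord A u l * Num.conj (eigcoord A v l) = dotc u v.
Proof. exact: (dotc_unitary u v (spectral_unitarymx A)). Qed.

Lemma sum_cn2_eigcoord A u : \sum_l cn2 (eigcoord A u l) = N2 dotc u.
Proof.
by rewrite /N2 -(sum_eigcoord A u u) Re_sum; apply: eq_bigr => l _; rewrite mulz_conj.
Qed.

Lemma eigvalE A l : A \is hermsymmx -> spectral_diag A 0 l = (eigval A l)%:C.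
Proof.
move=> /hermitian_spectral_diag_real /mxOverP/(_ 0 l)/complex_realP[x hx].
by rewrite /eigval hx.
Qed.

Lemma dotc_mulmx A u v : A \is hermsymmx ->
  dotc (A *m u) v = \sum_l (eigval A l)%:C * (eigcoord A u l * Num.conj (eigcoord A v l)).
Proof.
move=> Ah; have /orthomx_spectralP EA := hermitian_normalmx Ah.
rewrite {1}EA invmx_unitary ?spectral_unitarymx// -!mulmxA dotc_adj trmxCK.
rewrite /dotc; apply: eq_bigr => l _; rewrite -!/(eigcoord A _ _) mul_diag_mx mxE.
by rewrite eigvalE// mulrA.
Qed.

Lemma eigval_ge0 A l : A \is hermsymmx ->
  (forall v, 0 <= (v ^t* *m A *m v) 0 0) -> 0 <= eigval A l.
Proof.
move=> Ah A0; pose v := (spectralmx A) ^t* *m delta_mx l (0 : 'I_1).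
have Ev k : eigcoord A v k = (k == l)%:R.
  have /unitarymxP PP := spectral_unitarymx A.
  by rewrite /eigcoord /v mulmxA PP mul1mx mxE eqxx andbT.
have := A0 v; rewrite -mulmxA -dotcE dotc_mulmx//.
have -> : \sum_k (eigval A k)%:C * (eigcoord A v k * Num.conj (eigcoord A v k)) = (eigval A l)%:C.
  rewrite (bigD1 l)//= big1 ?addr0; first by rewrite Ev eqxx mulr1n conjC1 !mulr1.
  by move=> k kl; rewrite Ev (negbTE kl) mul0r mulr0.
by rewrite -[0 in X in X -> _]/(0%:C) lecR.
Qed.

Lemma tr_herm_pow A p : \tr (herm_pow A p) = \sum_l (eigval A l `^ p)%:C.
Proof.
rewrite /herm_pow mxtrace_mulC mulmxA mulmxV ?spectral_unit// mul1mx mxtrace_diag.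
by apply: eq_bigr => l _; rewrite !mxE.
Qed.

Definition nonneg_herm A := A \is hermsymmx /\ forall v, 0 <= (v ^t* *m A *m v) 0 0.

Lemma N2_mulmx A u : A \is hermsymmx ->
  Re (dotc (A *m u) u) = \sum_l eigval A l * cn2 (eigcoord A u l).
Proof.
move=> Ah; rewrite dotc_mulmx// Re_sum; apply: eq_bigr => l _.
by rewrite mulz_conj -rmorphM.
Qed.

Lemma nonneg_herm_semi_ip A : nonneg_herm A -> semi_ip setT (fun u v => dotc (A *m u) v).
Proof.
move=> [Ah A0]; split => //.
- move=> a u v w _ _ _; rewrite mulmxDr -scalemxAr; exact: (sip_lin dotc_semi_ip).
- move=> u v _ _; rewrite !dotc_mulmx// conj_sum; apply: eq_bigr => l _.
  by rewrite !rmorphM/= conjCK conj_real [X in _ * X]mulrC.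
- move=> u _; rewrite N2_mulmx//; apply: sumr_ge0 => l _.
  by rewrite mulr_ge0 ?cn2_ge0 ?eigval_ge0.
Qed.

Lemma quad_le_tr A u : nonneg_herm A ->
  Re (dotc (A *m u) u) <= (\sum_l eigval A l) * N2 dotc u.
Proof.
move=> [Ah A0]; rewrite N2_mulmx// -(sum_cn2_eigcoord A) mulr_suml.
apply: ler_sum => l _; rewrite ler_wpM2l ?eigval_ge0// (bigD1 l)//= lerDl.
by apply: sumr_ge0 => k _; exact: cn2_ge0.
Qed.

(** Cauchy-Schwarz for the semi-inner product given by [A], at two basis vectors. The entries of the
    potential, measurable by hypothesis, are thereby dominated without any measurability of the
    eigenvalues. *)
Lemma entry_le_tr A i j : nonneg_herm A -> cn2 (A i j) <= (\sum_l eigval A l) ^+ 2.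
Proof.
move=> An; have S0 : 0 <= \sum_l eigval A l.
  by case: An => Ah A0; apply: sumr_ge0 => l _; exact: eigval_ge0.
pose e k : 'cV[C]_M := delta_mx k 0.
have Ne k : N2 dotc (e k) = 1.
  rewrite N2_dotc (bigD1 k)//= !mxE !eqxx/= big1 ?addr0.
    by rewrite (cn2_real (1 : R)) expr1n.
  by move=> l lk; rewrite !mxE (negbTE lk) cn2_00.
have -> : A i j = dotc (A *m e j) (e i).
  rewrite /dotc (bigD1 i)//= big1 ?addr0.
    by rewrite -colE !mxE !eqxx rmorph1 mulr1.
  by move=> k ki; rewrite [e i k 0]mxE (negbTE ki) rmorph0 mulr0.
apply: le_trans (sip_CS (nonneg_herm_semi_ip An) (I : setT (e j)) (I : setT (e i))) _.
have h k : N2 (fun u v => dotc (A *m u) v) (e k) <= \sum_l eigval A l.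
  by have := quad_le_tr (e k) An; rewrite Ne mulr1.
by rewrite expr2; apply: ler_pM; rewrite ?h//; exact: (N2_ge0 (nonneg_herm_semi_ip An) (I : setT (e _))).
Qed.

(** On a bounded interval this turns integrability of the trace of V^(3/2) into integrability of V;
    the summand [M] pays for the eigenvalues below 1. *)
Lemma tr_le_tr_pow A : nonneg_herm A ->
  \sum_l eigval A l <= M%:R + Re (\tr (herm_pow A (3 / 2))).
Proof.
move=> [Ah A0]; rewrite tr_herm_pow Re_sum -[M in M%:R]card_ord -sumr_const -big_split/=.
apply: ler_sum => l _; set d := eigval A l; have d0 : 0 <= d by exact: eigval_ge0.
have [d1|d1] := leP d 1.
  by apply: le_trans d1 _; rewrite lerDl powR_ge0.
have : d <= d `^ (3 / 2) by rewrite -[leLHS]powRr1//; apply: ler_powR; lra.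
lra.
Qed.

End NonnegativeMatrix.

(** * Scalar estimates carried over to complex-valued components *)

Section ComponentEstimates.
Variable R : realType.
Local Notation Re := complex.Re.
Local Notation Im := complex.Im.
Local Notation C := R[i].
Notation mu := (@lebesgue_measure R).

Lemma itgM_bounded (L : R) (f g : R -> R) (c : R) : itg L f -> measurable_fun `]0, L[ g ->
  (forall x, x \in `]0, L[ -> `|g x| <= c) -> itg L (fun x => f x * g x).
Proof.
move=> If mg gc; apply: (itg_le _ (itgZ c (itg_norm If))).
  by apply: measurable_funM => //; exact: itg_measurable.
by move=> x xI; rewrite normrM mulrC ler_wpM2r// gc.
Qed.

Lemma citgM_cder (L : R) f g dg : 0 <= L -> citg L f -> is_cder L g dg ->
  citg L (fun x => f x * g x).
Proof.
move=> L0 [f1 f2] [g1 g2].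
have [c _ Hc] := is_wderiv_bound L0 g1; have [d _ Hd] := is_wderiv_bound L0 g2.
have B1 f' : itg L f' -> itg L (fun x => f' x * Re (g x)).
  move=> If; apply: (itgM_bounded If (is_wderiv_measurable g1) (c := c)) => x.
  by rewrite in_itv/= => /andP[x0 xL]; rewrite Hc// !ltW.
have B2 f' : itg L f' -> itg L (fun x => f' x * Im (g x)).
  move=> If; apply: (itgM_bounded If (is_wderiv_measurable g2) (c := d)) => x.
  by rewrite in_itv/= => /andP[x0 xL]; rewrite Hd// !ltW.
split.
  by apply: eq_itg (itgB (B1 _ f1) (B2 _ f2)) => x _; rewrite ReM.
by apply: eq_itg (itgD (B2 _ f1) (B1 _ f2)) => x _; rewrite ImM.
Qed.

Lemma is_cder_conj (L : R) f df : is_cder L f df ->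
  is_cder L (fun x => Num.conj (f x)) (fun x => Num.conj (df x)).
Proof.
move=> [f1 f2]; split.
  by move: f1; congr (is_wderiv L); apply/funext => x; rewrite Re_conj.
have := is_wderiv_lin (-1) 0 f2 f2.
by congr (is_wderiv L); apply/funext => x; rewrite Im_conj; ring.
Qed.

Lemma cder_agmon (L : R) f df x e : 0 < L -> 0 < e -> is_cder L f df -> 0 <= x <= L ->
  cn2 (f x) <= e * int0 L (fun t => cn2 (df t)) + (L^-1 + e^-1) * int0 L (fun t => cn2 (f t)).
Proof.
move=> L0 e0 Df xI; have sd := is_cder_csqi Df.
have sf := is_cder_csqi_fun (ltW L0) Df; case: Df => f1 f2.
rewrite !cn2_int0//; have := agmon_le L0 e0 f1 xI; have := agmon_le L0 e0 f2 xI.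
by rewrite /cn2 !mulrDr; lra.
Qed.

Lemma cder_sampling (L : R) f df (N : nat) : 0 < L -> is_cder L f df ->
  int0 L (fun x => cn2 (f x)) <=
  2 * (L / N.+1%:R) * (\sum_(k < N.+1) cn2 (f (k%:R * (L / N.+1%:R)))) +
  2 * (L / N.+1%:R) ^+ 2 * int0 L (fun x => cn2 (df x)).
Proof.
move=> L0 Df; have sd := is_cder_csqi Df.
have sf := is_cder_csqi_fun (ltW L0) Df; case: Df => f1 f2.
rewrite !cn2_int0// big_split/=.
have := sampling_poincare N L0 f1; have := sampling_poincare N L0 f2.
move: (2 * (L / _)) (2 * (L / _) ^+ 2) => p q; rewrite !mulrDr.
by move: (p * _) (p * _) (q * _) (q * _) => *; lra.
Qed.

Lemma cder_lim (L : R) (f d : nat -> R -> C) : 0 < L ->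
  (forall n, is_cder L (f n) (d n)) ->
  (forall e, 0 < e -> exists N, forall m n, (N <= m)%N -> (N <= n)%N ->
     int0 L (fun x => cn2 (d m x - d n x)) + int0 L (fun x => cn2 (f m x - f n x)) <= e) ->
  exists g dg, is_cder L g dg /\ forall e, 0 < e -> exists N, forall n, (N <= n)%N ->
     int0 L (fun x => cn2 (d n x - dg x)) <= e /\
     forall x, 0 <= x <= L -> cn2 (f n x - g x) <= e.
Proof.
move=> L0 Df Hc.
have sub (F G : R -> C) : csqi L F -> csqi L G -> csqi L (fun x => F x - G x).
  move=> sF sG; apply: eq_csqi (csqi_lin (-1) sG sF) => x _; ring.
have sd n := is_cder_csqi (Df n); have sf n := is_cder_csqi_fun (ltW L0) (Df n).
have p1 : forall e, 0 < e -> exists N, forall m n, (N <= m)%N -> (N <= n)%N ->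
     int0 L (fun x => (Re (d m x) - Re (d n x)) ^+ 2) + int0 L (fun x => (Re (f m x) - Re (f n x)) ^+ 2) <= e /\
     int0 L (fun x => (Im (d m x) - Im (d n x)) ^+ 2) + int0 L (fun x => (Im (f m x) - Im (f n x)) ^+ 2) <= e.
  move=> e /Hc[N HN]; exists N => m n mN nN; have := HN m n mN nN.
  rewrite !cn2_int0; [|exact: sub|exact: sub].
  have E1 F G : (fun x => Re (F x - G x : C) ^+ 2) = (fun x => (Re (F x) - Re (G x)) ^+ 2) :> (R -> R).
    by apply/funext => x; rewrite ReB.
  have E2 F G : (fun x => Im (F x - G x : C) ^+ 2) = (fun x => (Im (F x) - Im (G x)) ^+ 2) :> (R -> R).
    by apply/funext => x; rewrite ImB.
  rewrite !E1 !E2.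
  have pos F : 0 <= int0 L (fun x => F x ^+ 2) by apply: int0_ge0 => x _; exact: sqr_ge0.
  have := pos (fun x => Re (d m x) - Re (d n x)); have := pos (fun x => Re (f m x) - Re (f n x)).
  have := pos (fun x => Im (d m x) - Im (d n x)); have := pos (fun x => Im (f m x) - Im (f n x)).
  by move=> *; split; lra.
have [g1 [dg1 [D1 C1]]] := is_wderiv_lim L0 (fun n => (Df n).1)
  (fun e e0 => let: ex_intro N HN := p1 e e0 in ex_intro _ N (fun m n a b => (HN m n a b).1)).
have [g2 [dg2 [D2 C2]]] := is_wderiv_lim L0 (fun n => (Df n).2)
  (fun e e0 => let: ex_intro N HN := p1 e e0 in ex_intro _ N (fun m n a b => (HN m n a b).2)).
exists (fun x => g1 x +i* g2 x), (fun x => dg1 x +i* dg2 x).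
have Dg : is_cder L (fun x => g1 x +i* g2 x) (fun x => dg1 x +i* dg2 x) by [].
split => // e e0.
(* The bound by 1 gives [y ^+ 2 <= e1] from [|y| <= e1], so that the real and the imaginary part
   contribute at most [e / 2] each. *)
pose e1 := Order.min 1 (e / 2).
have e10 : 0 < e1 by rewrite lt_min ltr01 divr_gt0.
have e11 : e1 <= 1 by rewrite ge_min lexx.
have e1e : e1 <= e / 2 by rewrite ge_min lexx orbT.
have [N1 H1] := C1 e1 e10; have [N2 H2] := C2 e1 e10.
exists (maxn N1 N2) => n; rewrite geq_max => /andP[/H1[a1 b1] /H2[a2 b2]]; split.
  rewrite cn2_int0; last exact: sub (is_cder_csqi Dg).
  under eq_int0 do rewrite ReB.
  under [X in _ + X]eq_int0 do rewrite ImB.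
  by rewrite /=; lra.
move=> x xI; have := b1 x xI; have := b2 x xI; rewrite /cn2 ReB ImB/= => h1 h2.
have sq (y : R) : `|y| <= e1 -> y ^+ 2 <= e / 2.
  move=> h; rewrite -real_normK ?num_real//; apply: le_trans e1e.
  by have := normr_ge0 y; nra.
have := sq _ h1; have := sq _ h2; lra.
Qed.

End ComponentEstimates.

(** * The Schroedinger form satisfies the hypotheses of the abstract theory *)

Section FormHypotheses.
Variables (R : realType) (M : nat) (L kappa : R) (dot : bool) (V : R -> 'M[R[i]]_M).
Local Notation Re := complex.Re.
Local Notation Im := complex.Im.
Local Notation C := R[i].
Local Notation vip := (@vip R M L).
Local Notation dform := (@dform R M L).
Hypothesis L0 : 0 < L.
Hypothesis HV : potential L V.
Implicit Types u v du dv : vfun R M.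

Definition mean_zero u := dot -> forall i, cint0 L (fun x => u x i 0) = 0.
Definition Hper : set (vfun R M) := [set u | vL2 L u /\ mean_zero u].
Definition Qper : set (vfun R M) := [set u | vH1per L u /\ mean_zero u].
Definition pform u v := vip (mulpot V u) v.
Definition kform u v := dform u v + kappa%:C * vip u v - pform u v.

Lemma mean_zero_lin (a : C) u v : vL2 L u -> vL2 L v -> mean_zero u -> mean_zero v ->
  mean_zero (a *: u + v).
Proof.
move=> Hu Hv u0 v0 d i; rewrite (_ : (fun x => _) = (fun x => a * u x i 0 + v x i 0)).
  by rewrite cint0_lin; [rewrite u0 ?v0 ?mulr0 ?addr0|exact: csqi_citg (Hu i)|exact: csqi_citg (Hv i)].
by apply/funext => x; rewrite vfun_lin.
Qed.

Lemma mean_zero0 : mean_zero 0.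
Proof. by move=> d i; rewrite -[RHS](cint00 L); apply: eq_cint0 => x _; rewrite mxE. Qed.

Lemma Hper_semi_ip : semi_ip Hper vip.
Proof.
have S := vip_semi_ip M L; split.
- by split; [exact: vL20|exact: mean_zero0].
- move=> a u v [Hu u0] [Hv v0]; split; first exact: vL2_lin.
  exact: mean_zero_lin.
- by move=> a u v w [Hu _] [Hv _] [Hw _]; exact: (sip_lin S).
- by move=> u v [Hu _] [Hv _]; exact: (sip_conj S).
- by move=> u [Hu _]; exact: (sip_ge0 S).
Qed.

Lemma Qper_H u : Qper u -> Hper u.
Proof. by move=> [Hu u0]; split => //; exact: vH1per_vL2. Qed.

Lemma Qper0 : Qper 0.
Proof. by split; [exact: vH1per0|exact: mean_zero0]. Qed.

Lemma Qper_lin (a : C) u v : Qper u -> Qper v -> Qper (a *: u + v).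
Proof.
move=> [Hu u0] [Hv v0]; split; first exact: vH1per_lin.
by apply: mean_zero_lin => //; exact: vH1per_vL2.
Qed.

Lemma vH1per_vder u : vH1per L u -> is_vder L u (vwderiv L u).
Proof. by move=> /vH1perP[[du Du] _]; exact: is_vder_vwderiv Du. Qed.

(* d <= 1 + d^(3/2) for every eigenvalue d of V(x). *)
Definition majorant x : R := M%:R + tr_pow32 V x.

Lemma potential_nonneg x : x \in `]0, L[ -> nonneg_herm (V x).
Proof. by move=> xI; case: HV => _ h1 h2 _; split; [exact: h1|exact: h2]. Qed.

Lemma itg_tr_pow32 : itg L (tr_pow32 V).
Proof. by case: HV. Qed.

Lemma itg_majorant : itg L majorant.
Proof. by apply: itgD; [exact: itg_cst|exact: itg_tr_pow32]. Qed.

Lemma majorant_ge x : x \in `]0, L[ -> \sum_l eigval (V x) l <= majorant x.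
Proof. by move=> /potential_nonneg; exact: tr_le_tr_pow. Qed.

Lemma sum_eigval_ge0 x : x \in `]0, L[ -> 0 <= \sum_l eigval (V x) l.
Proof. by move=> /potential_nonneg[Ah A0]; apply: sumr_ge0 => l _; exact: eigval_ge0. Qed.

Lemma citg_potential i j : citg L (fun x => V x i j).
Proof.
have [mV _ _ _] := HV; have [m1 m2] := mV i j.
have H x : x \in `]0, L[ -> cn2 (V x i j) <= majorant x ^+ 2.
  move=> xI; apply: le_trans (entry_le_tr i j (potential_nonneg xI)) _.
  by rewrite ler_sqr ?nnegrE ?majorant_ge ?sum_eigval_ge0//; apply: le_trans (majorant_ge xI); exact: sum_eigval_ge0.
have H' x (y : R) : x \in `]0, L[ -> y ^+ 2 <= cn2 (V x i j) -> `|y| <= majorant x.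
  move=> xI yV; have W0 : 0 <= majorant x by apply: le_trans (majorant_ge xI); exact: sum_eigval_ge0.
  rewrite -(ler_pXn2r (n := 2)) ?nnegrE// real_normK ?num_real//.
  exact: le_trans (H x xI).
split; apply: (itg_le _ itg_majorant) => // x xI; apply: (H' x) => //.
  by rewrite /cn2 lerDl sqr_ge0.
by rewrite /cn2 lerDr sqr_ge0.
Qed.

Lemma citg_mulpot u du i : is_vder L u du -> citg L (fun x => mulpot V u x i 0).
Proof.
move=> Du; have := citg_sum (index_enum 'I_M) (fun j => citgM_cder (ltW L0) (citg_potential i j) (Du j)).
by apply: eq_citg => x _; rewrite !mxE.
Qed.

Lemma citg_mulpotM u v du dv i : is_vder L u du -> is_vder L v dv ->
  citg L (fun x => mulpot V u x i 0 * Num.conj (v x i 0)).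
Proof.
by move=> Du Dv; apply: (citgM_cder (ltW L0) (citg_mulpot i Du) (is_cder_conj (Dv i))).
Qed.

Lemma citg_pform u v du dv : is_vder L u du -> is_vder L v dv ->
  citg L (fun x => dotc (V x *m u x) (v x)).
Proof.
move=> Du Dv; have := citg_sum (index_enum 'I_M) (fun i => citg_mulpotM i Du Dv).
by apply: eq_citg.
Qed.

Lemma pformE u v : pform u v = cint0 L (fun x => dotc (V x *m u x) (v x)).
Proof. by []. Qed.

Lemma pform_semi_ip : semi_ip (vH1per L) pform.
Proof.
split; [exact: vH1per0|exact: vH1per_lin| | |].
- move=> a u v w /vH1per_vder Du /vH1per_vder Dv /vH1per_vder Dw.
  rewrite !pformE -cint0_lin; [|exact: citg_pform Du Dw|exact: citg_pform Dv Dw].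
  apply: eq_cint0 => x xI; exact: (sip_lin (nonneg_herm_semi_ip (potential_nonneg xI))).
- move=> u v /vH1per_vder Du /vH1per_vder Dv.
  rewrite !pformE -cint0_conj; last exact: citg_pform Du Dv.
  by apply: eq_cint0 => x xI; exact: (sip_conj (nonneg_herm_semi_ip (potential_nonneg xI))).
- move=> u _; apply: int0_ge0 => x xI.
  exact: (sip_ge0 (nonneg_herm_semi_ip (potential_nonneg xI)) (I : setT (u x))).
Qed.

Lemma N2_dform u du : is_vder L u du -> N2 dform u = \sum_i int0 L (fun x => cn2 (du x i 0)).
Proof.
move=> Du; rewrite /N2 /dform (vip_vder L0 Du Du) -/(N2 _ _) N2_vip//.
exact: is_vder_vL2 Du.
Qed.

Lemma vagmon u x e : 0 < e -> vH1per L u -> 0 <= x <= L ->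
  N2 (@dotc R M) (u x) <= e * N2 dform u + (L^-1 + e^-1) * N2 vip u.
Proof.
move=> e0 /vH1per_vder Du xI; rewrite N2_dotc (N2_dform Du) N2_vip; last exact: is_vder_vL2_fun Du.
rewrite !mulr_sumr -big_split/=; apply: ler_sum => i _.
exact: cder_agmon (Du i) xI.
Qed.

Lemma pform_le u e : 0 < e -> vH1per L u ->
  N2 pform u <= int0 L majorant * (e * N2 dform u + (L^-1 + e^-1) * N2 vip u).
Proof.
move=> e0 Hu; have Du := vH1per_vder Hu; set B := _ + _.
rewrite [leRHS]mulrC -int0Z; last exact: itg_majorant.
apply: le_int0; [exact: (citg_pform Du Du).1|apply: itgZ; exact: itg_majorant|].
move=> x xI; have An := potential_nonneg xI.
apply: le_trans (quad_le_tr (u x) An) _; rewrite mulrC; apply: ler_pM.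
- exact: (N2_ge0 (dotc_semi_ip R M) (I : setT _)).
- exact: sum_eigval_ge0.
- apply: vagmon => //; move: xI; rewrite in_itv/= => /andP[a b]; rewrite !ltW//.
- exact: majorant_ge.
Qed.

(* By Agmon's inequality |u x|^2 <= eps |u'|^2 + (1/L + 1/eps) |u|^2, so with this eps
   the potential is bounded by half of |u'|^2 and b |u|^2. *)
Let w := int0 L majorant.
Let eps := (2 * (w + 1))^-1.
Let b := w * (L^-1 + eps^-1).
(** [- kappa] cancels the term of the form, [b] absorbs the potential, and 1 leaves a full L_2 norm
    in [shifted_ge]. *)
Definition shift := b - kappa + 1.
Local Notation a := (shifted vip kform shift).

Lemma int0_majorant_ge0 : 0 <= w.
Proof.
by apply: int0_ge0 => x xI; apply: le_trans (majorant_ge xI); exact: sum_eigval_ge0.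
Qed.

Lemma relative_bound_ge0 : 0 <= b.
Proof.
have w0 := int0_majorant_ge0; rewrite mulr_ge0// addr_ge0// ?invr_ge0 ?(ltW L0)//.
rewrite mulr_ge0//; lra.
Qed.

Lemma N2_shifted u : N2 a u = N2 dform u + (b + 1) * N2 vip u - N2 pform u.
Proof.
rewrite /N2 /shifted /kform /shift !(ReD, ReN, ReM) !ReC !ImC; ring.
Qed.

Lemma shifted_ge u : Qper u -> 2^-1 * N2 dform u + N2 vip u <= N2 a u.
Proof.
move=> [Hu _]; rewrite N2_shifted.
have w0 := int0_majorant_ge0; have e0 : 0 < eps by rewrite invr_gt0; lra.
have := pform_le e0 Hu; rewrite -/w mulrDr mulrA mulrA -/b.
have D0 : 0 <= N2 dform u by exact: (N2_ge0 (dform_semi_ip M L0)).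
have : w * eps * N2 dform u <= 2^-1 * N2 dform u.
  rewrite ler_wpM2r// /eps ler_pdivrMr; lra.
rewrite [(b + 1) * _]mulrDl; lra.
Qed.

Lemma shifted_le u : Qper u -> N2 a u <= N2 dform u + (b + 1) * N2 vip u.
Proof.
move=> [Hu _]; rewrite N2_shifted.
have := N2_ge0 pform_semi_ip Hu; lra.
Qed.

Lemma shifted_semi_ip : semi_ip Qper a.
Proof.
have S1 := dform_semi_ip M L0; have S2 := vip_semi_ip M L; have S3 := pform_semi_ip.
split; [exact: Qper0|exact: Qper_lin| | |].
- move=> z u v x [Hu _] [Hv _] [Hx _]; rewrite /shifted /kform.
  rewrite (sip_lin S1)// (sip_lin S3)// (sip_lin S2)//; try exact: vH1per_vL2.
  ring.
- move=> u v [Hu _] [Hv _]; rewrite /shifted /kform.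
  rewrite (sip_conj S1 Hu Hv) (sip_conj S3 Hu Hv) (sip_conj S2 (vH1per_vL2 L0 Hu) (vH1per_vL2 L0 Hv)).
  have := conj_real kappa; have := conj_real shift.
  by move: (shift%:C) (kappa%:C) => p q Ep Eq; rewrite !(rmorphD, rmorphN, rmorphM)/= Ep Eq.
- move=> u Qu; have [Hu _] := Qu; apply: le_trans (shifted_ge Qu).
  by rewrite addr_ge0 ?mulr_ge0 ?(N2_ge0 S1) ?(N2_ge0 S2)//; exact: vH1per_vL2.
Qed.

Lemma shifted_compact e : 0 < e -> exists m (l : 'I_m -> vfun R M -> C),
  [/\ forall i (z : C) u v, l i (z *: u + v) = z * l i u + l i v,
      exists B, forall i u, Qper u -> cn2 (l i u) <= B * N2 a u
    & forall u, Qper u -> N2 vip u <= e * N2 a u + \sum_i cn2 (l i u)].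
Proof.
move=> e0.
(* The sampling error is [2 * h ^+ 2 * N2 dform u], and [N2 dform u <= 2 * N2 a u] by [shifted_ge];
   this is the 4. *)
have [N HN] : exists N : nat, 4 * (L / N.+1%:R) ^+ 2 <= e.
  have e1 : 0 < Order.min 1 (e / (4 * L ^+ 2 )).
    by rewrite lt_min ltr01 divr_gt0// mulr_gt0// exprn_gt0.
  have [n0 /(_ n0 (leqnn _)) Hn] := invn_small e1; exists n0.
  move: Hn; rewrite le_min => /andP[]; have : 0 <= n0.+1%:R^-1 :> R by rewrite invr_ge0.
  move: (n0.+1%:R^-1) => t t0 t1; rewrite ler_pdivlMr; last by rewrite mulr_gt0// exprn_gt0.
  have h : t ^+ 2 * (4 * L ^+ 2) <= t * (4 * L ^+ 2).
    have ht : t ^+ 2 <= t by rewrite expr2 ler_piMr.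
    by apply: ler_wpM2r => //; rewrite mulr_ge0 ?sqr_ge0.
  by move=> h2; rewrite exprMn; lra.
set h := L / N.+1%:R in HN.
have h0 : 0 <= h by rewrite divr_ge0 ?ltW.
have hh : 0 <= 2 * h by rewrite mulr_ge0.
(* One functional for each node and component. The factor [sqrt (2 * h)] makes the squared moduli
   add up to the sum in the sampling inequality. *)
pose l (s : 'I_#|{: 'I_N.+1 * 'I_M}|) u : C :=
  (Num.sqrt (2 * h))%:C * u ((enum_val s).1%:R * h) (enum_val s).2 0.
have S1 := dform_semi_ip M L0; have S2 := vip_semi_ip M L.
have bd u x : Qper u -> 0 <= x <= L -> N2 (@dotc R M) (u x) <= (L^-1 + 2) * N2 a u.
  move=> Qu xI; have [Hu _] := Qu; have := vagmon ltr01 Hu xI; rewrite invr1 mul1r.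
  have := shifted_ge Qu; have := N2_ge0 S1 Hu; have := N2_ge0 S2 (vH1per_vL2 L0 Hu).
  have Li : 0 < L^-1 by rewrite invr_gt0.
  by move: (L^-1) Li => t t0 h1 h2 h3 h4; nra.
have xI (k : 'I_N.+1) : 0 <= k%:R * h <= L.
  rewrite mulr_ge0//= /h mulrCA ler_piMr ?(ltW L0)// ler_pdivrMr// mul1r ler_nat.
  exact: ltnW.
exists _, l; split.
- by move=> s z u v; rewrite /l vfun_lin; ring.
- exists (2 * h * (L^-1 + 2)) => s u Qu; rewrite /l cn2M cn2_real sqr_sqrtr//.
  rewrite -[leRHS]mulrA ler_wpM2l//; apply: le_trans (bd u _ Qu (xI (enum_val s).1)).
  rewrite N2_dotc (bigD1 (enum_val s).2)//= lerDl; apply: sumr_ge0 => k _; exact: cn2_ge0.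
- move=> u Qu; have [Hu _] := Qu; have Du := vH1per_vder Hu.
  have -> : \sum_s cn2 (l s u) = 2 * h * \sum_i \sum_(k < N.+1) cn2 (u (k%:R * h) i 0).
    rewrite exchange_big/= pair_big/= mulr_sumr.
    rewrite (reindex (@enum_rank ('I_N.+1 * 'I_M)%type))/=; last exact: onW_bij (@enum_rank_bij _).
    by apply: eq_bigr => p _; rewrite /l enum_rankK cn2M cn2_real sqr_sqrtr.
  have : N2 vip u <= 2 * h * \sum_i \sum_(k < N.+1) cn2 (u (k%:R * h) i 0) + 2 * h ^+ 2 * N2 dform u.
    rewrite (N2_dform Du) N2_vip; last exact: vH1per_vL2.
    rewrite !mulr_sumr -big_split/=; apply: ler_sum => i _.
    exact: cder_sampling.
  have D0 := N2_ge0 S1 Hu; have I0 := N2_ge0 S2 (vH1per_vL2 L0 Hu).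
  have := shifted_ge Qu => h1.
  have : 2 * h ^+ 2 * N2 dform u <= e * N2 a u.
    apply: (@le_trans _ _ (4 * h ^+ 2 * N2 a u)).
      have h2 : N2 dform u <= 2 * N2 a u by lra.
      have h3 : 0 <= 2 * h ^+ 2 by rewrite mulr_ge0 ?sqr_ge0.
      by apply: le_trans (ler_wpM2l h3 h2) _; rewrite le_eqVlt; apply/orP; left; apply/eqP; ring.
    by rewrite ler_wpM2r//; lra.
  lra.
Qed.

(** By [shifted_ge] each component is Cauchy in H^1 and has a limit by [cder_lim]. Uniform
    convergence carries periodicity and mean zero over to the limit, and [shifted_le] turns H^1
    convergence back into convergence for the shifted form. *)
Lemma shifted_complete (u : nat -> vfun R M) : (forall n, Qper (u n)) -> sip_cauchy a u ->
  exists2 v, Qper v & sip_cvg a u v.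
Proof.
move=> Qu Cu; have S1 := dform_semi_ip M L0; have S2 := vip_semi_ip M L.
have Du n : is_vder L (u n) (vwderiv L (u n)) := vH1per_vder (Qu n).1.
have subD (f g df dg : vfun R M) : is_vder L f df -> is_vder L g dg -> is_vder L (f - g) (df - dg).
  by move=> Df Dg; have := is_vder_lin (-1) Dg Df; rewrite !scaleN1r ![- _ + _]addrC.
have Hc i : exists G : (R -> C) * (R -> C), is_cder L G.1 G.2 /\ forall e, 0 < e -> exists N, forall n, (N <= n)%N ->
     int0 L (fun x => cn2 (vwderiv L (u n) x i 0 - G.2 x)) <= e /\
     forall x, 0 <= x <= L -> cn2 (u n x i 0 - G.1 x) <= e.
  have [|g [dg Hg]] := @cder_lim R L (fun n x => u n x i 0) (fun n x => vwderiv L (u n) x i 0) L0 (fun n => Du n i).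
    move=> e e0; have [N HN] := Cu (e / 2) (ltac:(lra)); exists N => m n mN nN.
    have Qd : Qper (u m - u n).
      have := Qper_lin (-1) (Qu n) (Qu m); by rewrite scaleN1r addrC.
    have := HN m n mN nN; have := shifted_ge Qd.
    rewrite (N2_dform (subD _ _ _ _ (Du m) (Du n))) N2_vip; last exact: vH1per_vL2 Qd.1.
    rewrite (bigD1 i)//= [X in _ + X <= _](bigD1 i)//=.
    have pos (f : vfun R M) : 0 <= \sum_(j < M | j != i) int0 L (fun x => cn2 (f x j 0)).
      by apply: sumr_ge0 => j _; apply: int0_ge0 => x _; exact: cn2_ge0.
    have := pos (u m - u n); have := pos (vwderiv L (u m) - vwderiv L (u n)).
    have E (f g : vfun R M) : int0 L (fun x => cn2 ((f - g) x i 0)) = int0 L (fun x => cn2 (f x i 0 - g x i 0 : C)).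
      by apply: eq_int0 => x _; rewrite !mxE.
    have i0 : 0 <= int0 L (fun x => cn2 (u m x i 0 - u n x i 0)).
      by apply: int0_ge0 => x _; exact: cn2_ge0.
    rewrite ?E; lra.
  by exists (g, dg).
have [G HG] := choice Hc.
pose v : vfun R M := fun x => \col_i (G i).1 x.
pose dv : vfun R M := fun x => \col_i (G i).2 x.
have Dv : is_vder L v dv.
  by move=> i; have := (HG i).1; congr (is_cder L); apply/funext => x; rewrite mxE.
have unif e : 0 < e -> exists N, forall n, (N <= n)%N -> forall i,
     int0 L (fun x => cn2 (vwderiv L (u n) x i 0 - dv x i 0)) <= e /\
     forall x, 0 <= x <= L -> cn2 (u n x i 0 - v x i 0) <= e.
  move=> e0; have [N HN] := choice (fun i => (HG i).2 e e0).
  exists (\max_i N i)%N => n nN i.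
  have [h1 h2] := HN i n (leq_trans (leq_bigmax i) nN).
  split; last by move=> x xI; rewrite mxE; exact: h2.
  apply: le_trans h1; rewrite le_eqVlt; apply/orP; left; apply/eqP.
  by apply: eq_int0 => x _; rewrite [dv _ _ _]mxE.
have lim0 (z : C) : (forall e : R, 0 < e -> cn2 z <= e) -> z = 0.
  move=> h; apply: cn2_eq0; apply/eqP; rewrite eq_le cn2_ge0 andbT.
  by apply/ler_addgt0Pr => e e0; rewrite add0r h.
have vp : v L = v 0.
  apply/matrixP => i j; rewrite ord1; apply/eqP; rewrite -subr_eq0; apply/eqP.
  apply: lim0 => e e0; have [N HN] := unif (e / 4) (ltac:(lra)).
  have [_ h] := HN N (leqnn _) i.
  have -> : v L i 0 - v 0 i 0 = - (u N L i 0 - v L i 0) + (u N 0 i 0 - v 0 i 0).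
    by have /vH1perP[_ ->] := (Qu N).1; ring.
  apply: le_trans (cn2D_le _ _) _; rewrite cn2N.
  have := h 0; have := h L; rewrite !lexx ltW// => /(_ isT) ? /(_ isT) ?; lra.
have v0 : mean_zero v.
  move=> d i; apply: lim0 => e e0; pose e' : R := e / (2 * L ^+ 2 + 1).
  have L20 : 0 <= L ^+ 2 by exact: sqr_ge0.
  have e'0 : 0 < e' by rewrite divr_gt0//; lra.
  have [N HN] := unif e' e'0; have [_ h] := HN N (leqnn _) i.
  have Dd := subD _ _ _ _ (Du N) Dv.
  have Iu : citg L (fun x => u N x i 0) by apply: csqi_citg; exact: (is_vder_vL2_fun L0 (Du N)).
  have Iv : citg L (fun x => v x i 0) by apply: csqi_citg; exact: (is_vder_vL2_fun L0 Dv).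
  have Sd : csqi L (fun x => (u N - v) x i 0) by exact: (is_vder_vL2_fun L0 Dd).
  have E : cint0 L (fun x => (u N - v) x i 0) = - cint0 L (fun x => v x i 0).
    rewrite -[RHS]add0r -((Qu N).2 d i) -mulN1r -cint0Z// -cint0D//.
      by apply: eq_cint0 => x _; rewrite !mxE mulN1r.
    by have := citg_lin (-1) Iv (citg0 L); apply: eq_citg => x _; rewrite addr0.
  rewrite -cn2N -E.
  have CS f : @sq_integrable R L f -> int0 L f ^+ 2 <= L * int0 L (fun x => f x ^+ 2).
    move=> sf; have := int0CS (ltW L0) (sqi_cst L 1) sf.
    under eq_int0 do rewrite mul1r.
    by under [X in _ <= X * _]eq_int0 do rewrite expr1n; rewrite int0_cst ?mul1r// ltW.
  have := CS _ Sd.1; have := CS _ Sd.2; rewrite /cn2 Re_cint0 Im_cint0 => h1 h2.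
  have h3 : int0 L (fun x => cn2 ((u N - v) x i 0)) <= e' * L.
    rewrite -int0_cst ?(ltW L0)//; apply: le_int0 => [||x]; [|exact: itg_cst|].
      by apply: itgD; apply: sqi_itg2; [exact: Sd.1|exact: Sd.2].
    by rewrite in_itv/= => /andP[x0 xL]; rewrite !mxE; have := h x; rewrite mxE; apply; rewrite !ltW.
  have h4 := cn2_int0 Sd.
  have h5 : L * int0 L (fun x => cn2 ((u N - v) x i 0)) <= e' * L ^+ 2.
    by rewrite expr2 mulrCA ler_wpM2l// ltW.
  have h6 : e' * (2 * L ^+ 2 + 1) = e by rewrite /e' divfK// gt_eqF//; lra.
  rewrite h4 mulrDr in h5; nra.
have Qv : Qper v by split => //; apply/vH1perP; split => //; exists dv.
exists v => // e e0.
have b0 := relative_bound_ge0.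
(* With errors at most [e / K], the [M] derivatives contribute [M] times that, and the [M]
   components, bounded pointwise on an interval of length [L] and weighted by [b + 1], contribute
   the second summand. *)
pose K := (M%:R + (b + 1) * (M%:R * L)) + 1.
have M0 : 0 <= M%:R :> R by [].
have ML0 : 0 <= M%:R * L by rewrite mulr_ge0// ltW.
have K0 : 0 < K by rewrite /K; nra.
have e'0 : 0 < e / K by rewrite divr_gt0.
have [N HN] := unif _ e'0; exists N => n nN; have h := HN n nN.
have Dd := subD _ _ _ _ (Du n) Dv.
have Qd : Qper (u n - v).
  by have := Qper_lin (-1) Qv (Qu n); rewrite scaleN1r addrC.
apply: le_trans (shifted_le Qd) _.
rewrite (N2_dform Dd) N2_vip; last exact: vH1per_vL2 Qd.1.
have h1 : \sum_i int0 L (fun x => cn2 ((vwderiv L (u n) - dv) x i 0)) <= e / K * M%:R.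
  rewrite mulr_natr -[M in leRHS]card_ord -sumr_const; apply: ler_sum => i _.
  apply: le_trans (h i).1; rewrite le_eqVlt; apply/orP; left; apply/eqP.
  by apply: eq_int0 => x _; rewrite !mxE.
have h2 : \sum_i int0 L (fun x => cn2 ((u n - v) x i 0)) <= e / K * L * M%:R.
  rewrite mulr_natr -[M in leRHS]card_ord -sumr_const; apply: ler_sum => i _.
  have Sd : csqi L (fun x => (u n - v) x i 0) by exact: (is_vder_vL2_fun L0 Dd).
  rewrite -int0_cst ?(ltW L0)//; apply: le_int0 => [||x]; [|exact: itg_cst|].
    by apply: itgD; apply: sqi_itg2; [exact: Sd.1|exact: Sd.2].
  by rewrite in_itv/= => /andP[x0 xL]; rewrite !mxE; have := (h i).2 x; rewrite mxE; apply; rewrite !ltW.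
have h3 : e / K * K = e by rewrite divfK// gt_eqF//; lra.
have h4 : (b + 1) * \sum_i int0 L (fun x => cn2 ((u n - v) x i 0)) <= (b + 1) * (e / K * L * M%:R).
  by rewrite ler_wpM2l//; lra.
have h5 : e / K * M%:R + (b + 1) * (e / K * L * M%:R) = e - e / K.
  by rewrite -{3}h3 /K; ring.
lra.
Qed.

End FormHypotheses.

(** * The Lieb-Thirring inequality *)

(** For [K > 0], the maximum of [d * rho - rho ^+ 3 / K ^+ 2] over [rho >= 0] is attained at
    [rho = K * sqrt (d / 3)] and equals [2 / (3 * sqrt 3) * K * d ^ (3/2)]; this is where the
    constant of the theorem comes from. For [K = 0] the hypothesis forces [rho = 0]. *)
Lemma young32 (R : realType) (d rho K e : R) : 0 <= d -> 0 <= rho -> 0 <= K -> 0 <= e ->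
  rho ^+ 3 <= K ^+ 2 * e -> d * rho <= 2 / (3 * Num.sqrt 3) * K * d `^ (3 / 2) + e.
Proof.
move=> d0 rho0; rewrite le_eqVlt => /orP[/eqP<-|K0] e0 H.
  have : rho ^+ 3 = 0.
    by apply/eqP; rewrite eq_le exprn_ge0// andbT; move: H; rewrite expr0n mul0r.
  by move=> /eqP; rewrite expf_eq0 => /eqP ->; rewrite !(mulr0, mul0r) add0r.
(* With d = 3 t^2 and rho = K r this is (t - r)^2 (2 t + r) >= 0. *)
pose q := Num.sqrt (3 : R); have q2 : q ^+ 2 = 3 by rewrite sqr_sqrtr.
have q0 : 0 < q by rewrite sqrtr_gt0.
pose t := Num.sqrt d / q; pose r := rho / K.
have t0 : 0 <= t by rewrite divr_ge0 ?sqrtr_ge0 ?ltW.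
have r0 : 0 <= r by rewrite divr_ge0// ltW.
have sE : Num.sqrt d = q * t by rewrite /t mulrCA divff ?mulr1// gt_eqF.
have dE : d = 3 * t ^+ 2 by rewrite -[LHS]sqr_sqrtr// sE exprMn q2.
have d32 : d `^ (3 / 2) = 3 * q * t ^+ 3.
  have -> : 3 / 2 = 1 + 2^-1 :> R by field.
  rewrite powRD; last by rewrite gt_eqF//; lra.
  by rewrite powRr1// powR12_sqrt// sE {1}dE; ring.
have rhoE : rho = K * r by rewrite /r mulrCA divff ?mulr1// gt_eqF.
have : K * r ^+ 3 <= e.
  have K2 : 0 < K ^+ 2 by rewrite exprn_gt0.
  rewrite -(ler_pM2l K2); apply: le_trans H; rewrite rhoE le_eqVlt; apply/orP; left; apply/eqP; ring.
rewrite -/q d32 rhoE.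
have -> : 2 / (3 * q) * K * (3 * q * t ^+ 3) = 2 * K * t ^+ 3 by field; rewrite gt_eqF.
have : 0 <= K * ((t - r) ^+ 2 * (2 * t + r)).
  by rewrite mulr_ge0 ?(ltW K0)// mulr_ge0 ?sqr_ge0// addr_ge0// mulr_ge0.
have -> : K * ((t - r) ^+ 2 * (2 * t + r)) = 2 * K * t ^+ 3 + K * r ^+ 3 - 3 * t ^+ 2 * (K * r) by ring.
rewrite dE; lra.
Qed.

(** * The Sobolev inequality for complex-valued functions *)

Section ComplexSobolev.
Variables (R : realType) (L kappa : R) (dot : bool) (c0 : R).
Local Notation Re := complex.Re.
Local Notation Im := complex.Im.
Local Notation C := R[i].
Hypothesis L0 : 0 < L.
Hypothesis Hc : coercive L kappa dot c0.

Definition cadm (f : R -> C) := f L = f 0 /\ (dot -> cint0 L f = 0).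
Definition cenergy (f df : R -> C) :=
  int0 L (fun x => cn2 (df x)) + kappa * int0 L (fun x => cn2 (f x)).

Lemma cadm_ReIm f : cadm f -> adm L dot (fun x => Re (f x)) /\ adm L dot (fun x => Im (f x)).
Proof.
move=> [fp fm]; split; split; rewrite ?fp// => /fm m.
  by rewrite -Re_cint0 m.
by rewrite -Im_cint0 m.
Qed.

Lemma energy_ge0 (u du : R -> R) : is_wderiv L u du -> adm L dot u ->
  0 <= int0 L (fun x => du x ^+ 2) + kappa * int0 L (fun x => u x ^+ 2).
Proof.
move=> Du au; have [c00 H] := Hc; apply: le_trans (H _ _ Du au).
by rewrite mulr_ge0 ?(ltW c00)// addr_ge0//; apply: int0_ge0 => x _; exact: sqr_ge0.
Qed.

Lemma cenergyE f df : is_cder L f df -> cenergy f df =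
  (int0 L (fun x => Re (df x) ^+ 2) + kappa * int0 L (fun x => Re (f x) ^+ 2)) +
  (int0 L (fun x => Im (df x) ^+ 2) + kappa * int0 L (fun x => Im (f x) ^+ 2)).
Proof.
move=> Df; rewrite /cenergy !cn2_int0; first by ring.
  exact: is_cder_csqi_fun (ltW L0) Df.
exact: is_cder_csqi Df.
Qed.

Lemma cenergy_ge0 f df : is_cder L f df -> cadm f -> 0 <= cenergy f df.
Proof.
move=> Df /cadm_ReIm[a1 a2]; rewrite cenergyE//; case: Df => D1 D2.
by apply: addr_ge0; exact: energy_ge0.
Qed.

(** The real constant survives unchanged: the inequalities for the real and the imaginary part are
    added, and [(p q + r s)^2 <= (p^2 + r^2) (q^2 + s^2)] recombines the energies and the norms. *)
Lemma complex_sobolev f df x : is_cder L f df -> cadm f -> 0 <= x <= L ->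
  cn2 (f x) ^+ 2 <= sobolev_const L kappa dot ^+ 2 * (cenergy f df * int0 L (fun x => cn2 (f x))).
Proof.
move=> Df /cadm_ReIm[a1 a2] xI; have [K0 HK] := sobolev_constP L0 Hc.
rewrite cenergyE// cn2_int0; last exact: is_cder_csqi_fun (ltW L0) Df.
case: Df => D1 D2.
have := HK _ _ _ D1 a1 xI; have := HK _ _ _ D2 a2 xI.
have := energy_ge0 D1 a1; have := energy_ge0 D2 a2.
have sq0 (g : R -> R) : 0 <= int0 L (fun x => g x ^+ 2) by apply: int0_ge0 => y _; exact: sqr_ge0.
have := sq0 (fun x => Re (f x)); have := sq0 (fun x => Im (f x)).
move: (sobolev_const _ _ _) K0 => K K0.
move: (int0 L (fun x => Re (df x) ^+ 2) + _) (int0 L (fun x => Im (df x) ^+ 2) + _) => E1 E2.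
move: (int0 L (fun x => Re (f x) ^+ 2)) (int0 L (fun x => Im (f x) ^+ 2)) => I1 I2 I20 I10 E20 E10.
rewrite -{2}(sqr_sqrtr I10) -{2}(sqr_sqrtr I20) -{2}(sqr_sqrtr E10) -{2}(sqr_sqrtr E20).
move: (Num.sqrt I1) (Num.sqrt I2) (Num.sqrt E1) (Num.sqrt E2)
  (sqrtr_ge0 I1) (sqrtr_ge0 I2) (sqrtr_ge0 E1) (sqrtr_ge0 E2).
move=> q s p r q0 s0 p0 r0 h2 h1.
have h : cn2 (f x) <= K * (p * q + r * s) by rewrite /cn2; lra.
apply: (@le_trans _ _ ((K * (p * q + r * s)) ^+ 2)).
  by rewrite ler_sqr ?nnegrE ?cn2_ge0// mulr_ge0// addr_ge0// mulr_ge0.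
rewrite exprMn ler_wpM2l ?sqr_ge0//.
have : 0 <= (p * s - r * q) ^+ 2 by exact: sqr_ge0.
nra.
Qed.

End ComplexSobolev.

(** * The trace inequality for finitely many orthonormal functions *)

Section LiebThirring.
Variables (R : realType) (M : nat) (L kappa : R) (dot : bool) (V : R -> 'M[R[i]]_M) (c0 : R).
Local Notation Re := complex.Re.
Local Notation Im := complex.Im.
Local Notation C := R[i].
Local Notation vip := (@vip R M L).
Local Notation dform := (@dform R M L).
Local Notation Qper := (@Qper R M L dot).
Local Notation Hper := (@Hper R M L dot).
Local Notation K := (sobolev_const L kappa dot).
Hypothesis L0 : 0 < L.
Hypothesis HV : potential L V.
Hypothesis Hc : coercive L kappa dot c0.
Implicit Types u v du dv : vfun R M.

Definition eform u v := dform u v + kappa%:C * vip u v.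

Lemma Qper_cadm u i : Qper u -> cadm L dot (fun x => u x i 0).
Proof. by move=> [/vH1perP[_ up] u0]; split; [rewrite up|move=> d; exact: u0]. Qed.

Lemma N2_eformE u : N2 eform u = N2 dform u + kappa * N2 vip u.
Proof. by rewrite {1}/N2 /eform ReD ReM ReC ImC mul0r subr0. Qed.

Lemma N2_eform u du : Qper u -> is_vder L u du ->
  N2 eform u = \sum_i cenergy L kappa (fun x => u x i 0) (fun x => du x i 0).
Proof.
move=> [Hu _] Du; rewrite N2_eformE (N2_dform L0 Du) N2_vip; last exact: vH1per_vL2.
by rewrite mulr_sumr -big_split.
Qed.

Lemma eform_semi_ip : semi_ip Qper eform.
Proof.
have S1 := dform_semi_ip M L0; have S2 := vip_semi_ip M L.
split; [exact: Qper0|exact: Qper_lin| | |].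
- move=> z u v x [Hu _] [Hv _] [Hx _]; rewrite /eform.
  rewrite (sip_lin S1)// (sip_lin S2)//; try exact: vH1per_vL2.
  ring.
- move=> u v [Hu _] [Hv _]; rewrite /eform.
  rewrite (sip_conj S1 Hu Hv) (sip_conj S2 (vH1per_vL2 L0 Hu) (vH1per_vL2 L0 Hv)).
  have := conj_real kappa; move: (kappa%:C) => p Ep.
  by rewrite !(rmorphD, rmorphM)/= Ep.
- move=> u Qu; have Du := vH1per_vder Qu.1.
  rewrite -/(N2 _ u) (N2_eform Qu Du); apply: sumr_ge0 => i _.
  exact: (cenergy_ge0 L0 Hc (Du i) (Qper_cadm i Qu)).
Qed.

Lemma Qper_mulmx (A : 'M[C]_M) u : Qper u -> Qper (fun x => A *m u x).
Proof.
move=> Qu; have [/vH1perP[[du Du] up] u0] := Qu; split.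
  by apply/vH1perP; split; [exists (fun x => A *m du x); exact: is_vder_mulmx|rewrite up].
move=> d i; have cu j : citg L (fun x => u x j 0).
  by apply: csqi_citg; exact: (is_vder_vL2_fun L0 Du).
have cu' j : citg L (fun x => A i j * u x j 0).
  by have := citg_lin (A i j) (cu j) (citg0 L); apply: eq_citg => x _; rewrite addr0.
transitivity (\sum_j cint0 L (fun x => A i j * u x j 0)).
  by rewrite -cint0_sum//; apply: eq_cint0 => x _; rewrite mxE.
by apply: big1 => j _; rewrite cint0Z// u0// mulr0.
Qed.

Lemma vip_unitary (A : 'M[C]_M) u v : A \is unitarymx ->
  vip (fun x => A *m u x) (fun x => A *m v x) = vip u v.
Proof. by move=> Au; apply: eq_cint0 => x _; exact: dotc_unitary. Qed.

Lemma eform_unitary (A : 'M[C]_M) u : A \is unitarymx -> Qper u ->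
  N2 eform (fun x => A *m u x) = N2 eform u.
Proof.
move=> Au [Hu _]; have Du := vH1per_vder Hu.
have N2u w : N2 vip (fun x => A *m w x) = N2 vip w by exact: congr1 (vip_unitary w w Au).
rewrite !N2_eformE N2u (N2_dform L0 (is_vder_mulmx A Du)) (N2_dform L0 Du).
rewrite -(N2_vip (is_vder_vL2 Du)) -(N2_vip (is_vder_vL2 (is_vder_mulmx A Du))).
by rewrite N2u.
Qed.

Variables (I : finType) (us : I -> vfun R M).
Hypothesis Qus : forall j, Qper (us j).
Hypothesis ous : orthonormal vip us.

Section Pointwise.
Variable x : R.
Hypothesis xI : x \in `]0, L[.
Let A := V x.
Let P := spectralmx A.
Let y j l := eigcoord A (us j x) l.
(** On the span of the [us] this is the Riesz representative of the functional sending [u] to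
    component [l] of [P *m u x]. Hence its squared norm and component [l] of [P *m U l x] are the
    same number [rho l]. *)
Let U l : vfun R M := \sum_j Num.conj (y j l) *: us j.
Let rho l := \sum_j cn2 (y j l).

Lemma Qper_test_vector l : Qper (U l).
Proof. by apply: (sip_sum eform_semi_ip) => j _; apply: (sipZ eform_semi_ip). Qed.

Lemma N2_vip_test_vector l : N2 vip (U l) = rho l.
Proof.
have S := Hper_semi_ip M L dot.
have Hus j : Hper (us j) by exact: Qper_H.
rewrite /N2 /U (sip_suml S); last 2 first.
- by move=> j _; apply: (sipZ S).
- by apply: (sip_sum S) => j _; apply: (sipZ S).
rewrite Re_sum; apply: eq_bigr => j _.
rewrite (sip_sumr S); last 2 first.
- by move=> k _; apply: (sipZ S).
- exact: (sipZ S).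
rewrite (bigD1 j)//= big1 ?addr0; last first.
  move=> k kj; rewrite (sip_Zl S)//; last exact: (sipZ S).
  by rewrite (sip_Zr S)// ous eq_sym (negbTE kj) !mulr0.
rewrite (sip_Zl S)//; last exact: (sipZ S).
by rewrite (sip_Zr S)// ous eqxx mulr1n mulr1 mulz_conj cn2_conj.
Qed.

Lemma density_ge0 l : 0 <= rho l.
Proof. by apply: sumr_ge0 => j _; exact: cn2_ge0. Qed.

(** The Sobolev inequality for component [l] of [P *m U l] at [x] has [rho l ^+ 4] on the left and
    at most [K ^+ 2 * N2 eform (U l) * rho l] on the right; one factor [rho l] cancels. Energy and
    norm of one component are at most those of the whole vector, because the other components
    contribute non-negative terms, and [P] is unitary. *)
Lemma density_cube_le l : rho l ^+ 3 <= K ^+ 2 * N2 eform (U l).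
Proof.
have Pu : P \is unitarymx := spectral_unitarymx A.
pose w : vfun R M := fun t => P *m U l t.
have Qw : Qper w by apply: Qper_mulmx; exact: Qper_test_vector.
have Dw := vH1per_vder Qw.1.
have wx : w x l 0 = (rho l)%:C.
  rewrite /w /U mxE /rho rmorph_sum/=.
  under eq_bigr do rewrite vfun_sum mulr_sumr.
  rewrite exchange_big/=; apply: eq_bigr => j _.
  rewrite -mulz_conj mulrC /y /eigcoord mxE mulr_sumr; apply: eq_bigr => k _.
  by rewrite mulrCA.
have xI' : 0 <= x <= L by move: xI; rewrite in_itv/= => /andP[a b]; rewrite !ltW.
have := complex_sobolev L0 Hc (Dw l) (Qper_cadm l Qw) xI'.
rewrite wx cn2_real; set E := cenergy _ _ _ _; set F := int0 _ _ => H.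
have EE : 0 <= E <= N2 eform (U l).
  rewrite (cenergy_ge0 L0 Hc (Dw l) (Qper_cadm l Qw))/=.
  rewrite -(eform_unitary Pu (Qper_test_vector l)) (N2_eform Qw Dw) (bigD1 l)//= lerDl.
  by apply: sumr_ge0 => k _; exact: (cenergy_ge0 L0 Hc (Dw k) (Qper_cadm k Qw)).
have FF : F <= rho l.
  rewrite -N2_vip_test_vector -[N2 vip (U l)]/(Re (vip (U l) (U l))) -(vip_unitary _ _ Pu) -/(N2 vip w).
  rewrite N2_vip; last exact: vH1per_vL2 Qw.1.
  by rewrite (bigD1 l)//= lerDl; apply: sumr_ge0 => k _; apply: int0_ge0 => t _; exact: cn2_ge0.
have F0 : 0 <= F by apply: int0_ge0 => t _; exact: cn2_ge0.
have H2 : (rho l ^+ 2) ^+ 2 <= K ^+ 2 * (N2 eform (U l) * rho l).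
  apply: le_trans H _; rewrite ler_wpM2l ?sqr_ge0//.
  by case/andP: EE => E0 E1; apply: ler_pM.
have := density_ge0 l; rewrite le_eqVlt => /orP[/eqP h|h].
  rewrite -h expr0n mulr_ge0 ?sqr_ge0//; exact: (N2_ge0 eform_semi_ip (Qper_test_vector l)).
rewrite -(ler_pM2r h); apply: le_trans _ (le_trans H2 _).
  by rewrite le_eqVlt; apply/orP; left; apply/eqP; ring.
by rewrite mulrA.
Qed.

(** Unitarity of [P] turns the sum over [l] of products of coordinates into the inner product of
    [us j x] and [us i x]. The eigenbasis disappears, and what remains is integrable in [x], with
    integral given by orthonormality. *)
Lemma sum_N2_eform_test_vector : \sum_l N2 eform (U l) =
  \sum_i \sum_j Re (eform (us i) (us j) * dotc (us j x) (us i x)).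
Proof.
have S := eform_semi_ip.
have E l : N2 eform (U l) = \sum_i \sum_j Re (eform (us i) (us j) * (y j l * Num.conj (y i l))).
  rewrite /N2 {1}/U (sip_suml S); [|by move=> j _; exact: (sipZ S)|exact: Qper_test_vector].
  rewrite Re_sum; apply: eq_bigr => i _.
  rewrite /U (sip_sumr S); [|by move=> j _; exact: (sipZ S)|exact: (sipZ S)].
  rewrite Re_sum; apply: eq_bigr => j _; congr complex.Re.
  rewrite (sip_Zl S _ (Qus i) (sipZ S _ (Qus j))) (sip_Zr S _ (Qus j) (Qus i)) conjCK; ring.
under eq_bigr do rewrite E.
rewrite exchange_big/=; apply: eq_bigr => i _; rewrite exchange_big/=; apply: eq_bigr => j _.
by rewrite -Re_sum -mulr_sumr sum_eigcoord.
Qed.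

Lemma pointwise_lieb_thirring : \sum_j Re (dotc (V x *m us j x) (us j x)) <=
  2 / (3 * Num.sqrt 3) * K * tr_pow32 V x +
  \sum_i \sum_j Re (eform (us i) (us j) * dotc (us j x) (us i x)).
Proof.
have [Ah A0] : nonneg_herm (V x) := potential_nonneg HV xI.
rewrite -sum_N2_eform_test_vector /tr_pow32 tr_herm_pow Re_sum mulr_sumr -big_split/=.
under eq_bigr do rewrite N2_mulmx//.
rewrite exchange_big/=; apply: ler_sum => l _; rewrite -mulr_sumr.
apply: young32; [exact: eigval_ge0|exact: density_ge0|exact: (sobolev_constP L0 Hc).1| |exact: density_cube_le].
exact: (N2_ge0 eform_semi_ip (Qper_test_vector l)).
Qed.

End Pointwise.

Lemma lieb_thirring_trace : \sum_j N2 (pform L V) (us j) <=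
  2 / (3 * Num.sqrt 3) * K * int0 L (tr_pow32 V) + \sum_j N2 eform (us j).
Proof.
have Du j := vH1per_vder (Qus j).1.
have Hus j : vL2 L (us j) by exact: vH1per_vL2 (Qus j).1.
have cdot i j : citg L (fun x => dotc (us j x) (us i x)).
  have := citg_sum (index_enum 'I_M) (fun k => csqi_citgM (Hus j k) (Hus i k)).
  exact: eq_citg.
have cG i j : citg L (fun x => eform (us i) (us j) * dotc (us j x) (us i x)).
  by have := citg_lin (eform (us i) (us j)) (cdot i j) (citg0 L); apply: eq_citg => x _; rewrite addr0.
have IG : itg L (fun x => \sum_i \sum_j Re (eform (us i) (us j) * dotc (us j x) (us i x))).
  by apply: itg_bigsum => i; apply: itg_bigsum => j; exact: (cG i j).1.
have IT : itg L (fun x => 2 / (3 * Num.sqrt 3) * K * tr_pow32 V x).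
  by apply: itgZ; exact: itg_tr_pow32.
have -> : \sum_j N2 eform (us j) = int0 L (fun x => \sum_i \sum_j Re (eform (us i) (us j) * dotc (us j x) (us i x))).
  rewrite int0_bigsum; last by move=> i; apply: itg_bigsum => j; exact: (cG i j).1.
  apply: eq_bigr => i _; rewrite int0_bigsum; last by move=> j; exact: (cG i j).1.
  under eq_bigr => j _ do rewrite -Re_cint0 (cint0Z _ (cdot i j)) -[cint0 L _]/(vip (us j) (us i)) ous.
  rewrite (bigD1 i)//= eqxx mulr1n mulr1 big1 ?addr0// => j ji.
  by rewrite (negbTE ji) mulr0.
rewrite -int0Z; last exact: itg_tr_pow32.
rewrite -int0D//.
have -> : \sum_j N2 (pform L V) (us j) = int0 L (fun x => \sum_j Re (dotc (V x *m us j x) (us j x))).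
  by rewrite int0_bigsum// => j; exact: (citg_pform L0 HV (Du j) (Du j)).1.
apply: le_int0 => [||x xI]; [|exact: itgD|exact: pointwise_lieb_thirring].
by apply: itg_bigsum => j; exact: (citg_pform L0 HV (Du j) (Du j)).1.
Qed.

(** The eigenvalue equation tested with its own eigenvector gives [lam i = N2 (pform L V) (us i) -
    N2 eform (us i)], so the energies in [lieb_thirring_trace] cancel. *)
Lemma eigenvalue_sum_le (lam : I -> R) :
  (forall i, form_operator Hper vip Qper (kform L kappa V) (us i) ((- lam i)%:C *: us i)) ->
  \sum_i lam i <= 2 / (3 * Num.sqrt 3) * K * int0 L (tr_pow32 V).
Proof.
move=> HT; have S := Hper_semi_ip M L dot.
have E i : lam i = N2 (pform L V) (us i) - N2 eform (us i).
  have [_ _ /(_ _ (Qus i))] := HT i; rewrite (sip_Zl S); [|exact: Qper_H|exact: Qper_H].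
  rewrite ous eqxx mulr1n mulr1 => h.
  have : N2 (kform L kappa V) (us i) = - lam i by rewrite /N2 h ReC.
  have -> : N2 (kform L kappa V) (us i) = N2 eform (us i) - N2 (pform L V) (us i) by exact: ReB.
  lra.
under eq_bigr do rewrite E.
by rewrite sumrB; have := lieb_thirring_trace; lra.
Qed.

End LiebThirring.

(** * Both operators as instances of one Schroedinger operator *)

Section SchroedingerOperator.
Variables (R : realType) (M : nat) (L kappa : R) (dot : bool) (c0 : R).
Variable V : R -> 'M[R[i]]_M.
Local Notation T := (form_operator (@Hper R M L dot) (@vip R M L) (@Qper R M L dot) (kform L kappa V)).
Hypothesis L0 : 0 < L.
Hypothesis HV : potential L V.
Hypothesis Hc : coercive L kappa dot c0.

Lemma schroedinger_spectrum : discrete_spectrum (@Hper R M L dot) (@vip R M L) T /\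
  (neg_eigenvalue_sum (@vip R M L) T <=
    (2 / (3 * Num.sqrt 3) * sobolev_const L kappa dot * int0 L (tr_pow32 V))%:E)%E.
Proof.
have Hip := Hper_semi_ip M L dot.
have QH := fun u => @Qper_H R M L dot L0 u.
have Qa := shifted_semi_ip kappa dot L0 HV.
have cpl := @shifted_complete R M L kappa dot V L0 HV.
have cpt := @shifted_compact R M L kappa dot V L0 HV.
split; first exact: (discrete_spectrum_form_operator Hip QH Qa cpl cpt).
apply: (neg_eigenvalue_sum_le Hip QH Qa cpt) => I us lam ous lam0 HT.
apply: (eigenvalue_sum_le L0 HV Hc (us := us)) => // i.
by case: (HT i).
Qed.

End SchroedingerOperator.

Lemma eq_form_operator (R : realType) (E : lmodType R[i]) (H Q : set E)
    (ip h h' : E -> E -> R[i]) : (forall u v, Q u -> Q v -> h u v = h' u v) ->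
  form_operator H ip Q h = form_operator H ip Q h'.
Proof.
move=> hh'; apply/funext => u; apply/funext => f; apply/propext.
by split=> -[Qu Hf He]; split => // v Qv; rewrite -He// hh'.
Qed.

Lemma H1opE (R : realType) (M : nat) (alpha beta : R) (V : R -> 'M[R[i]]_M) :
  H1op alpha beta V = form_operator (@Hper R M (2 * pi / alpha) false)
    (@vip R M (2 * pi / alpha)) (@Qper R M (2 * pi / alpha) false)
    (kform (2 * pi / alpha) (alpha ^+ 2 * beta) V).
Proof.
have HE : @Hper R M (2 * pi / alpha) false = vL2 (2 * pi / alpha).
  by apply/seteqP; split => u => [[]|].
have QE : @Qper R M (2 * pi / alpha) false = vH1per (2 * pi / alpha).
  by apply/seteqP; split => u => [[]|].
by rewrite HE QE.
Qed.

Lemma Pmean_id (R : realType) (M : nat) (u : vfun R M) :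
  (forall i, cint0 (2 * pi) (fun x => u x i 0) = 0) -> Pmean u = u.
Proof.
move=> u0; apply/funext => x; apply/matrixP => i j; rewrite ord1 !mxE u0 mulr0.
exact: subr0.
Qed.

(** The difference between [w] and [Pmean w] is constant, hence orthogonal to [v]. Both projections
    thus drop out of [form2] on its form domain. *)
Lemma vip_Pmean (R : realType) (M : nat) (w v : vfun R M) :
  (forall i, citg (2 * pi) (fun x => w x i 0 * Num.conj (v x i 0))) ->
  (forall i, citg (2 * pi) (fun x => v x i 0)) ->
  (forall i, cint0 (2 * pi) (fun x => v x i 0) = 0) ->
  vip (2 * pi) (Pmean w) v = vip (2 * pi) w v.
Proof.
move=> Iw Iv v0; pose m i := ((2 * pi)^-1 : R)%:C * cint0 (2 * pi) (fun t => w t i 0).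
have E i x : Pmean w x i 0 * Num.conj (v x i 0) =
    - m i * Num.conj (v x i 0) + w x i 0 * Num.conj (v x i 0).
  by rewrite !mxE -/(m i); ring.
have Ic i := citg_conj (Iv i).
transitivity (\sum_i cint0 (2 * pi) (fun x => - m i * Num.conj (v x i 0) + w x i 0 * Num.conj (v x i 0))).
  rewrite -cint0_sum => [|i]; last exact: citg_lin.
  by apply: eq_cint0 => x _; apply: eq_bigr => i _; exact: E.
rewrite /vip cint0_sum//; apply: eq_bigr => i _.
by rewrite cint0_lin// cint0_conj// v0 rmorph0 mulr0 add0r.
Qed.

Lemma H2opE (R : realType) (M : nat) (delta : R) (V : R -> 'M[R[i]]_M) :
  potential (2 * pi) V ->
  H2op delta V = form_operator (@Hper R M (2 * pi) true)
    (@vip R M (2 * pi)) (@Qper R M (2 * pi) true) (kform (2 * pi) (- delta) V).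
Proof.
move=> HV; have L0 : 0 < 2 * pi :> R by rewrite mulr_gt0 ?pi_gt0.
have HE : @Hper R M (2 * pi) true = vL2dot (2 * pi).
  by apply/seteqP; split => u [Hu u0]; split => // i; exact: u0.
have QE : @Qper R M (2 * pi) true = vH1perdot (2 * pi).
  by apply/seteqP; split => u [Hu u0]; split => // i; exact: u0.
rewrite HE QE; apply: eq_form_operator => u v [Hu u0] [Hv v0].
rewrite /form2 /kform (Pmean_id u0) vip_Pmean//; first by rewrite rmorphN mulNr.
  by move=> i; exact: (citg_mulpotM L0 HV i (vH1per_vder Hu) (vH1per_vder Hv)).
by move=> i; apply: csqi_citg; exact: (vH1per_vL2 L0 Hv).
Qed.

Theorem theorem3p2 (R : realType) (alpha beta delta : R) (M : nat)
    (halpha : 0 < alpha) (hbeta : 0 < beta)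
    (hdelta0 : 0 <= delta) (hdelta1 : delta < 1) (hM : (1 <= M)%N) :
  (forall V : R -> 'M[R[i]]_M, potential (2 * pi / alpha) V ->
    discrete_spectrum (vL2 (2 * pi / alpha)) (vip (2 * pi / alpha))
      (H1op alpha beta V) /\
    (neg_eigenvalue_sum (vip (2 * pi / alpha)) (H1op alpha beta V) <=
      (2 / (3 * Num.sqrt 3) * K1 alpha beta *
        int0 (2 * pi / alpha) (tr_pow32 V))%:E)%E) /\
  (forall V : R -> 'M[R[i]]_M, potential (2 * pi) V ->
    discrete_spectrum (vL2dot (2 * pi)) (vip (2 * pi)) (H2op delta V) /\
    (neg_eigenvalue_sum (vip (2 * pi)) (H2op delta V) <=
      (2 / (3 * Num.sqrt 3) * K2 delta *
        int0 (2 * pi) (tr_pow32 V))%:E)%E).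
Proof.
have pi0 : 0 < 2 * pi :> R by rewrite mulr_gt0 ?pi_gt0.
split=> V HV.
  have L0 : 0 < 2 * pi / alpha by rewrite divr_gt0.
  have [c0 Hc] := coercive_pos (2 * pi / alpha) (mulr_gt0 (exprn_gt0 2 halpha) hbeta).
  (* The statement has [vL2] where the common treatment has [Hper]; with the flag off the mean-zero
     condition is vacuous and the two sets coincide. *)
  rewrite H1opE K1E -(_ : Hper (2 * pi / alpha) false = vL2 (2 * pi / alpha)).
    exact: schroedinger_spectrum L0 HV Hc.
  by apply/seteqP; split => u => [[]|].
have [c0 Hc] := coercive_meanzero hdelta0 hdelta1.
rewrite H2opE// K2E -(_ : Hper (2 * pi) true = vL2dot (2 * pi)).
  exact: schroedinger_spectrum pi0 HV Hc.
by apply/seteqP; split => u [Hu u0]; split => // i; exact: u0.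
Qed.
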